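(* Let $n\ge 1$. Suppose that either $1<p<\infty$, $1\le q<\infty$, $m'\ge 0$, $m>0$, or $1<p<\infty$, $q=\infty$, $m'>0$, $m>0$. If $f\in \dot{B}^{\frac{n}{p}-1,q}_{p,\infty}(\mathbb{R}^n)$, then $e^{t\Delta}f\in {}^{m'}_{m}\dot{B}^{\frac{n}{p}-1,q}_{p,\infty}$.
   Context: Meyer wavelets. With $\hat g(\xi)=\int g(x)e^{-ix\cdot\xi}dx$, let $\phi^0(\xi)$ be an even function in $C_0^\infty([-\frac{4\pi}{3},\frac{4\pi}{3}])$ with $0\le\phi^0\le1$, $\phi^0(\xi)=1$ for $|\xi|\le\frac{2\pi}{3}$; put $\varphi(\xi)=[(\phi^0(\xi/2))^2-(\phi^0(\xi))^2]^{1/2}$ (assumed smooth, with $\varphi^2(\xi)+\varphi^2(2\pi-\xi)=1$ for $\frac{2\pi}{3}\le\xi\le\frac{4\pi}{3}$) and $\phi^1(\xi)=e^{-i\xi/2}\varphi(\xi)$. For $\epsilon\in\{0,1\}^n$ let $\phi^\epsilon$ be the function on $\mathbb{R}^n$ with $\widehat{\phi^\epsilon}(\xi)=\prod_{i=1}^n\phi^{\epsilon_i}(\xi_i)$, and for $j\in\mathbb{Z}$, $k\in\mathbb{Z}^n$ let $\phi^\epsilon_{j,k}(x)=2^{nj/2}\phi^\epsilon(2^jx-k)$. Let $E_n=\{0,1\}^n\setminus\{0\}$ and $\Gamma_n=E_n\times\mathbb{Z}^n$. Then $\{\phi^\epsilon_{j,k}\}_{\epsilon\in E_n,j\in\mathbb{Z},k\in\mathbb{Z}^n}$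 is an orthonormal basis of $L^2(\mathbb{R}^n)$. For a distribution $f$ write $f^\epsilon_{j,k}=\langle f,\phi^\epsilon_{j,k}\rangle$; distributions are identified with their wavelet series $f=\sum_{\epsilon\in E_n,j,k}f^\epsilon_{j,k}\phi^\epsilon_{j,k}$. Let $\chi$ be the characteristic function of $[0,1]^n$ and $|E|$ the Lebesgue measure of $E$. Besov-Lorentz space. Put $f_j(x)=2^{nj/2}\sum_{(\epsilon,k)\in\Gamma_n}|f^\epsilon_{j,k}|\chi(2^jx-k)$. Then $f\in\dot{B}^{s,q}_{p,\infty}$ iff $\big(\sum_{j\in\mathbb{Z}}2^{jqs}\big(\sup_{\lambda>0}\lambda|\{x:f_j(x)>\lambda\}|^{1/p}\big)^q\big)^{1/q}<\infty$ (supremum over $j$ if $q=\infty$). Flow space. For $f(t,x)$, $t>0$, put $f^\epsilon_{j,k}(t)=\langle f(t,\cdot),\phi^\epsilon_{j,k}\rangle$, $f_j(t,x)=2^{nj/2}\sum_{(\epsilon,k)\in\Gamma_n}|f^\epsilon_{j,k}(t)|\chi(2^jx-k)$ and, for $j,j_t\in\mathbb{Z}$, $f_{j,j_t}(x)=\sup_{2^{-2j_t}\le t<2^{2-2j_t}}f_j(t,x)$. For $\mu\in\mathbb{R}$ let $$A^{p,\mu}_{j,j_t}=2^{2(j-j_t)\mu}\,2^{j(\frac np-1)}\sup_{\lambda>0}\lambda\,|\{x:f_{j,j_t}(x)>\lambda\}|^{1/p}.$$ For $1\le p<\infty$, $1\le q\le\infty$, $m'\ge0$, $m>0$, $f(t,x)\in{}^{m'}_{m}\dot{B}^{\frac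 np-1,q}_{p,\infty}$ iff $$\sup_{j_t\in\mathbb{Z}}\Big(\sum_{j\ge j_t}(A^{p,m}_{j,j_t})^q+\sum_{j<j_t}(A^{p,m'}_{j,j_t})^q\Big)<\infty\quad(1\le q<\infty),$$ $$\sup_{j_t\in\mathbb{Z},\,j\ge j_t}A^{p,m}_{j,j_t}+\sup_{j_t\in\mathbb{Z},\,j<j_t}A^{p,m'}_{j,j_t}<\infty\quad(q=\infty).$$ The heat semigroup is $\widehat{e^{t\Delta}f}(\xi)=e^{-t|\xi|^2}\hat f(\xi)$. *)

(* Defs.v *)
From HB Require Import structures.
From mathcomp Require Import all_boot all_order all_algebra.
From mathcomp Require Import complex.
From mathcomp Require Import all_classical all_reals all_analysis.

Set Implicit Arguments.
Unset Strict Implicit.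
Unset Printing Implicit Defensive.

Import Order.TTheory GRing.Theory Num.Theory.
Import numFieldNormedType.Exports.

Local Open Scope classical_set_scope.
Local Open Scope ring_scope.
Local Open Scope complex_scope.

Definition rV_display : measure_display -> measure_display.
Proof. exact. Qed.

Section measurable_rV.
Context (R : realType) (n : nat).

Let coors : 'I_n -> 'rV[R]_n -> measurableTypeR R := fun i x => x ord0 i.

Let rV_set0 : g_sigma_preimage coors set0.
Proof. exact: sigma_algebra0. Qed.

Let rV_setC A : g_sigma_preimage coors A -> g_sigma_preimage coors (~` A).
Proof. exact: sigma_algebraC. Qed.

Let rV_bigcup (F : (set 'rV[R]_n)^nat) :
  (forall i, g_sigma_preimage coors (F i)) ->
  g_sigma_preimage coors (\bigcup_i (F i)).
Proof. exact: sigma_algebra_bigcup. Qed.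

HB.instance Definition _ := @isMeasurable.Build (rV_display default_measure_display)
  'rV[R]_n (g_sigma_preimage coors) rV_set0 rV_setC rV_bigcup.

End measurable_rV.

Section measurable_rV_theory.
Context (R : realType).

Lemma measurable_coord n (i : 'I_n) :
  measurable_fun setT (fun x : 'rV[R]_n => (x ord0 i : measurableTypeR R)).
Proof.
move=> _ Y mY; rewrite setTI; apply: sub_sigma_algebra => /=.
rewrite -bigcup_seq/=; exists i => /=; first by rewrite mem_index_enum.
by exists Y => //; rewrite setTI.
Qed.

Lemma measurable_fun_rV d (T : measurableType d) n (g : T -> 'rV[R]_n) :
  (forall i, measurable_fun setT (fun x => (g x ord0 i : measurableTypeR R))) ->
  measurable_fun setT g.
Proof.
move=> mg; suff sG : g_sigma_preimage
    (fun (i : 'I_n) (x : 'rV[R]_n) => (x ord0 i : measurableTypeR R)) `<=`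
    [set A | measurable (g @^-1` A)].
  by move=> _ A mA; rewrite setTI; exact: sG.
apply: smallest_sub.
  split => /=.
  - by rewrite preimage_set0.
  - by move=> A mA; rewrite setTD preimage_setC; exact: measurableC.
  - by move=> F mF; rewrite preimage_bigcup; exact: bigcup_measurable.
rewrite -bigcup_seq => A [i _ [B mB <-]] /=.
by rewrite setTI -[X in measurable X]setTI; exact: (mg i).
Qed.

Definition cons_rV n (z : measurableTypeR R * 'rV[R]_n) : 'rV[R]_n.+1 :=
  \row_i oapp (z.2 ord0) z.1 (unlift ord0 i).

Definition uncons_rV n (x : 'rV[R]_n.+1) : measurableTypeR R * 'rV[R]_n :=
  (x ord0 ord0, \row_i x ord0 (lift ord0 i)).

Lemma uncons_rVK n : cancel (@uncons_rV n) (@cons_rV n).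
Proof.
move=> x; apply/rowP => i; rewrite mxE /=.
by case: unliftP => [j ->|->] //=; rewrite mxE.
Qed.

Lemma cons_rVK n : cancel (@cons_rV n) (@uncons_rV n).
Proof.
move=> [a x]; rewrite /uncons_rV mxE unlift_none /=; congr pair.
by apply/rowP => i; rewrite !mxE liftK.
Qed.

Lemma measurable_cons_rV n : measurable_fun setT (@cons_rV n).
Proof.
apply: measurable_fun_rV => i; under eq_fun do rewrite mxE.
case: unliftP => [j _|_] /=; last exact: measurable_fst.
exact: (measurableT_comp (measurable_coord j) measurable_snd).
Qed.

Lemma measurable_uncons_rV n : measurable_fun setT (@uncons_rV n).
Proof.
apply/measurable_fun_pairP; split; first exact: measurable_coord.
apply: measurable_fun_rV => i /=.
under eq_fun do rewrite mxE.
exact: measurable_coord.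
Qed.

Section step.
Context (n : nat) (mu : {sigma_finite_measure set 'rV[R]_n -> \bar R}).

Definition lebesgue_step : set 'rV[R]_n.+1 -> \bar R :=
  pushforward (@lebesgue_measure R \x mu)%E (@cons_rV n).

Let m_cons : {measure set 'rV[R]_n.+1 -> \bar R} :=
  measure_function_pushforward__canonical__measure_function_Measure
    (@lebesgue_measure R \x mu)%E (@measurable_cons_rV n).

Let lebesgue_step0 : lebesgue_step set0 = 0%E.
Proof. exact: (measure0 m_cons). Qed.

Let lebesgue_step_ge0 A : (0 <= lebesgue_step A)%E.
Proof. exact: (measure_ge0 m_cons). Qed.

Let lebesgue_step_sigma_additive : semi_sigma_additive lebesgue_step.
Proof. exact: (@measure_semi_sigma_additive _ _ _ m_cons). Qed.

HB.instance Definition _ := isMeasure.Build _ _ _ lebesgue_step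
  lebesgue_step0 lebesgue_step_ge0 lebesgue_step_sigma_additive.

Let lebesgue_step_sigma_finite : sigma_finite setT lebesgue_step.
Proof.
have /sigma_finiteP[F [FT ndF Foo]] := sigma_finiteT (@lebesgue_measure R).
have /sigma_finiteP[G [GT ndG Goo]] := sigma_finiteT mu.
exists (fun k => @uncons_rV n @^-1` (F k `*` G k)).
  apply/seteqP; split => // x _.
  have [i _ Fi] : (\bigcup_i F i) (uncons_rV x).1 by rewrite -FT.
  have [j _ Gj] : (\bigcup_i G i) (uncons_rV x).2 by rewrite -GT.
  exists (maxn i j) => //; split.
  - by move: Fi; exact/subsetPset/ndF/leq_maxl.
  - by move: Gj; exact/subsetPset/ndG/leq_maxr.
move=> k; have [mF Fk] := Foo k; have [mG Gk] := Goo k; split.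
  rewrite -[X in measurable X]setTI.
  by apply: measurable_uncons_rV => //; exact: measurableX.
rewrite /lebesgue_step /pushforward -comp_preimage.
rewrite (_ : _ \o _ = id) ?preimage_id; last first.
  by apply/funext => z /=; rewrite cons_rVK.
by rewrite product_measure1E// lte_mul_pinfty// ge0_fin_numE.
Qed.

HB.instance Definition _ := Measure_isSigmaFinite.Build _ _ _ lebesgue_step
  lebesgue_step_sigma_finite.
End step.

Fixpoint lebesgue_rV n : {sigma_finite_measure set 'rV[R]_n -> \bar R} :=
  match n with
  | 0 => \d_(0 : 'rV[R]_0)
  | n'.+1 => lebesgue_step (lebesgue_rV n')
  end.

Lemma lebesgue_rV_box n (A : 'I_n -> set (measurableTypeR R)) :
  (forall i, measurable (A i)) ->
  lebesgue_rV n [set x | forall i, A i (x ord0 i)] =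
  (\prod_(i < n) lebesgue_measure (A i))%E.
Proof.
elim: n A => [|n IHn] A mA.
  by rewrite big_ord0 /= diracE mem_set// => -[].
rewrite big_ord_recl -IHn// -product_measure1E//; last first.
  rewrite (_ : (fun x => _) =
    \bigcap_(i in [set: 'I_n])
      ((fun x : 'rV[R]_n => (x ord0 i : measurableTypeR R)) @^-1` A (lift ord0 i))).
    apply: fin_bigcap_measurable => //= i _.
    by rewrite -[X in measurable X]setTI; apply: measurable_coord.
  by apply/seteqP; split=> x /= h i; [move=> _|]; exact: h.
rewrite /= /lebesgue_step /pushforward; congr (_ _); apply/seteqP; split=> [[a x]|[a x]] /=.
  move=> h; split=> /= [|i].
    by have := h ord0; rewrite mxE unlift_none.
  by have := h (lift ord0 i); rewrite mxE liftK.
by move=> [/= h0 h] i; rewrite mxE; case: unliftP => [j ->|->] /=.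
Qed.

End measurable_rV_theory.

Section fourier.
Context (R : realType) (n : nat).
Local Notation V := 'rV[R]_n.
Local Notation C := R[i].
Implicit Types (g : V -> C) (f : (V -> C) -> C).

Definition dot (x y : V) : R := \sum_i x ord0 i * y ord0 i.

Definition expi (t : R) : C := cos t +i* sin t.

Definition Cintegral g : C :=
  (\int[lebesgue_rV R n]_x complex.Re (g x)) +i*
  (\int[lebesgue_rV R n]_x complex.Im (g x)).

Definition fourier g (xi : V) : C :=
  Cintegral (fun x => g x * expi (- dot x xi)).

Definition ifourier g (x : V) : C :=
  (((2 * pi) ^- n : R)%:C) * Cintegral (fun xi => g xi * expi (dot x xi)).

Definition partial (i : 'I_n) g (x : V) : C :=
  ('D_(delta_mx ord0 i) (fun y => complex.Re (g y) : R^o) x) +i*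
  ('D_(delta_mx ord0 i) (fun y => complex.Im (g y) : R^o) x).

Definition partials (s : seq 'I_n) g : V -> C := foldr partial g s.

Definition smooth g : Prop := forall (s : seq 'I_n) (x : V),
  differentiable (fun y => complex.Re (partials s g y) : R^o) x /\
  differentiable (fun y => complex.Im (partials s g y) : R^o) x.

Definition seminorm (N : nat) g : \bar R := ereal_sup
  [set y | exists (s : seq 'I_n) (x : V), (size s <= N)%N /\
     y = ((1 + `|x|) ^+ N * Normc.normc (partials s g x))%:E].

Definition schwartz g : Prop :=
  smooth g /\ forall N, (seminorm N g < +oo)%E.

(* Distributions are total functionals on V -> C; only their values on Schwartz
   functions are meaningful. The duality bracket is bilinear. *)
Definition tempered f : Prop :=
  (forall (a : C) g h, schwartz g -> schwartz h ->
     f (fun x => a * g x + h x) = a * f g + f h) /\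
  exists (K : R) (N : nat), forall g, schwartz g ->
    ((Normc.normc (f g))%:E <= K%:E * seminorm N g)%E.

Definition dfourier f : (V -> C) -> C := fun g => f (fourier g).
Definition difourier f : (V -> C) -> C := fun g => f (ifourier g).
Definition dmul (a : V -> C) f : (V -> C) -> C :=
  fun g => f (fun x => a x * g x).

Definition heat (t : R) f : (V -> C) -> C :=
  difourier (dmul (fun xi => (expR (- (t * dot xi xi)))%:C) (dfourier f)).

(* Schwartz functions whose Fourier transform vanishes to infinite order at 0:
   the space whose dual is S'/polynomials. *)
Definition schwartz0 g : Prop :=
  schwartz g /\ forall s : seq 'I_n, partials s (fourier g) 0 = 0.

End fourier.

Section meyer.
Context (R : realType) (n : nat).
Local Notation V := 'rV[R]_n.
Local Notation C := R[i].

Definition meyer_varphi (phi0 : R -> R) (xi : R) : R :=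
  Num.sqrt (phi0 (xi / 2) ^+ 2 - phi0 xi ^+ 2).

Record meyer_scaling (phi0 : R -> R) : Prop := {
  phi0_smooth : forall k (x : R), derivable (derive1n k phi0) x 1;
  phi0_supp : forall xi, 4 * pi / 3 < `|xi| -> phi0 xi = 0;
  phi0_even : forall xi, phi0 (- xi) = phi0 xi;
  phi0_bounds : forall xi, 0 <= phi0 xi <= 1;
  phi0_one : forall xi, `|xi| <= 2 * pi / 3 -> phi0 xi = 1;
  varphi_smooth : forall k (x : R),
    derivable (derive1n k (meyer_varphi phi0)) x 1;
  varphi_sqr : forall xi, 2 * pi / 3 <= xi <= 4 * pi / 3 ->
    meyer_varphi phi0 xi ^+ 2 + meyer_varphi phi0 (2 * pi - xi) ^+ 2 = 1
}.

(* The one-dimensional symbols phi^0 (b = false) and phi^1 (b = true). *)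
Definition meyer_symbol (phi0 : R -> R) (b : bool) (xi : R) : C :=
  if b then expi (- (xi / 2)) * (meyer_varphi phi0 xi)%:C else (phi0 xi)%:C.

(* A Fourier transform determines an integrable function only almost
   everywhere; asking for Schwartz functions selects the smooth representative. *)
Definition meyer_functions (phi0 : R -> R)
    (phi : {ffun 'I_n -> bool} -> V -> C) : Prop :=
  forall e, schwartz (phi e) /\
    forall xi, fourier (phi e) xi = \prod_i meyer_symbol phi0 (e i) (xi ord0 i).

Definition Gamma : set ({ffun 'I_n -> bool} * 'rV[int]_n) :=
  [set a | a.1 != [ffun=> false]].

Definition dilate (j : int) (k : 'rV[int]_n) (x : V) : V :=
  (2 : R) ^ j *: x - map_mx intr k.

Definition wavelet (phi : {ffun 'I_n -> bool} -> V -> C)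
    (e : {ffun 'I_n -> bool}) (j : int) (k : 'rV[int]_n) (x : V) : C :=
  (2 `^ (n%:R * j%:~R / 2))%:C * phi e (dilate j k x).

(* The identification of f with its wavelet series: the sum of the
   f_{j,k}^e phi_{j,k}^e converges unconditionally to f in S'/polynomials. *)
Definition wavelet_series (phi : {ffun 'I_n -> bool} -> V -> C)
    (f : (V -> C) -> C) : Prop :=
  forall g, schwartz0 g ->
  let term (b : int * ({ffun 'I_n -> bool} * 'rV[int]_n)) :=
    let w := wavelet phi b.2.1 b.1 b.2.2 in
    f w * Cintegral (fun x => w x * g x) in
  forall r : R, 0 < r ->
  exists A0, [/\ finite_set A0, A0 `<=` setT `*` Gamma &
    forall A, finite_set A -> A0 `<=` A -> A `<=` setT `*` Gamma ->
      Normc.normc (f g - \sum_(b \in A) term b) < r].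

Definition unit_cube : set V := [set x | forall i, 0 <= x ord0 i <= 1].

Definition level (phi : {ffun 'I_n -> bool} -> V -> C) (f : (V -> C) -> C)
    (j : int) (x : V) : \bar R :=
  ((2 `^ (n%:R * j%:~R / 2))%:E *
   \esum_(a in Gamma)
     (Normc.normc (f (wavelet phi a.1 j a.2)) *
      \1_unit_cube (dilate j a.2 x))%:E)%E.

Definition weak_norm (p : R) (F : V -> \bar R) : \bar R :=
  ereal_sup [set (l%:E * (lebesgue_rV R n [set x | l%:E < F x]) `^ p^-1)%E
            | l in [set l : R | 0 < l]].

Definition besov_lorentz (phi : {ffun 'I_n -> bool} -> V -> C)
    (s p : R) (q : \bar R) (f : (V -> C) -> C) : Prop :=
  match q with
  | r%:E => ((\esum_(j in [set: int])
      ((2 `^ (j%:~R * r * s))%:E * weak_norm p (level phi f j) `^ r)) `^ r^-1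
      < +oo)%E
  | +oo%E => (ereal_sup (range (fun j : int =>
      (2 `^ (j%:~R * s))%:E * weak_norm p (level phi f j))) < +oo)%E
  | -oo%E => False
  end.

Definition flow_level (phi : {ffun 'I_n -> bool} -> V -> C)
    (F : R -> (V -> C) -> C) (j jt : int) (x : V) : \bar R :=
  ereal_sup [set level phi (F t) j x
    | t in [set t : R | (2 : R) ^ (- 2 * jt) <= t < (2 : R) ^ (2 - 2 * jt)]].

Definition flow_coef (phi : {ffun 'I_n -> bool} -> V -> C) (p mu : R)
    (F : R -> (V -> C) -> C) (j jt : int) : \bar R :=
  ((2 `^ (2 * (j - jt)%:~R * mu))%:E * (2 `^ (j%:~R * (n%:R / p - 1)))%:E *
   weak_norm p (flow_level phi F j jt))%E.

Definition flow_space (phi : {ffun 'I_n -> bool} -> V -> C) (m' m p : R)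
    (q : \bar R) (F : R -> (V -> C) -> C) : Prop :=
  match q with
  | r%:E => (ereal_sup (range (fun jt : int =>
      \esum_(j in [set j : int | (jt <= j)%R]) (flow_coef phi p m F j jt) `^ r +
      \esum_(j in [set j : int | (j < jt)%R]) (flow_coef phi p m' F j jt) `^ r))
      < +oo)%E
  | +oo%E =>
      (ereal_sup [set flow_coef phi p m F jj.1 jj.2
                 | jj in [set jj : int * int | (jj.2 <= jj.1)%R]] +
       ereal_sup [set flow_coef phi p m' F jj.1 jj.2
                 | jj in [set jj : int * int | (jj.1 < jj.2)%R]] < +oo)%E
  | -oo%E => False
  end.

End meyer.

(* Main.v *)
(** The heat flow [e^{t Delta}] acts on a wavelet [w = phi^e_{j,k}] through its Fourier
    transform, an explicit product of smooth compactly supported functions of one variable.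
    Expanding [f] in wavelets, the coefficient of [e^{t Delta} f] at [w] is the sum of the
    coefficients of [f] against the pairings of [e^{t Delta} w] with the other wavelets
    [phi^e'_{j',k'}]. By the multiplication formula such a pairing is a product of
    one-dimensional oscillatory integrals. It vanishes when [|j - j'| >= 2], the supports being
    disjoint; otherwise integration by parts bounds it by a high negative power of the distance
    between the cells, and, since some factor is supported away from the origin, by
    [C_M (1 + t 4^j)^{-M}] for every [M].

    Hence the level function of [e^{t Delta} f] at [j] is dominated, for all times in a dyadic
    block at once, by [C_M (1 + t 4^j)^{-M}] times a rapidly weighted sum of lattice translates
    of the level functions of [f] at [j - 1], [j] and [j + 1]. As translations preserve the
    distribution function, a weighted union bound controls the weak norm of such a sum, without
    any maximal function, and the factor with [M >= m] absorbs [2^{2(j-j_t)m}]. *)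

Require Import Defs.
From HB Require Import structures.
From mathcomp Require Import all_boot all_order all_algebra.
From mathcomp Require Import complex.
From mathcomp Require Import ring lra zify.
From mathcomp Require Import all_classical all_reals all_analysis.
From mathcomp Require Import measurable_realfun.

Set Implicit Arguments.
Unset Strict Implicit.
Unset Printing Implicit Defensive.

Import Order.TTheory GRing.Theory Num.Theory.
Import numFieldNormedType.Exports.

Local Open Scope classical_set_scope.
Local Open Scope ring_scope.

(** * Smooth functions of one variable *)

(** The wavelet expansion of $f$ is granted only on test functions whose Fourier transform vanishes
    to infinite order at the origin, and the heat flow is defined by duality. Before any estimate,
    $e^{t\Delta}w$ must therefore be shown to be such a test function. It is itself a Fourier
    transform, of a damped symbol, so a double transform has to vanish near the origin; dividing the
    symbol by $y^2-\xi^2$ turns the integrals in question into integrals of exact derivatives.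

    The decay of order 4 per coordinate is the square of the summable lattice weight $(1+|z|)^{-2}$:
    in the union bound one factor sums the thresholds and the other sums the measures.

    Rescaling frequencies by $2^j$ leaves only the parameter $t4^j$, three ratios of scales and
    finitely many types, whence uniform constants. The supremum over a block of times is uncountable
    and its level sets are not shown to be measurable, so they are compared with measurable sets by
    monotonicity alone. For $j<j_t$ the heat factor is bounded by 1 and the weight $2^{2(j-j_t)m'}$
    is at most 1. *)

Section smooth_functions.
Context {R : realType}.
Implicit Types (u v w : R -> R) (k : nat).

(** The recursion passes to the derivative of the whole function, so that rules for products and
    quotients close by induction on [k] over all functions. *)
Fixpoint Ck k u : Prop :=
  if k is k'.+1 then (forall x, derivable u x 1) /\ Ck k' (derive1 u) else True.

Definition smooth1 u := forall k, Ck k u.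

Lemma smooth1_derive1n u :
  (forall k x, derivable (derive1n k u) x 1) -> smooth1 u.
Proof.
move=> h k; elim: k u h => [//|k IH] u h; split; first by move=> x; have := h 0 x.
by apply: IH => j x; rewrite -derive1Sn.
Qed.

Lemma Ck_is_derive k u v :
  (forall x : R, is_derive x (1:R) u (v x)) -> Ck k v -> Ck k.+1 u.
Proof.
move=> uv kv; split; first by move=> x; have [] := uv x.
suff -> : derive1 u = v by [].
by apply/funext => x; rewrite derive1E; have [_ ->] := uv x.
Qed.

Lemma Ck_derive k u x : Ck k.+1 u -> is_derive x (1:R) u ((derive1 u) x).
Proof. by move=> [du _]; apply: DeriveDef => //; rewrite derive1E. Qed.

Lemma CkW k u : Ck k.+1 u -> Ck k u.
Proof. by elim: k u => [//|k IH] u [du ku]; split => //; exact: IH. Qed.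

Lemma CkD k u v : Ck k u -> Ck k v -> Ck k (u \+ v).
Proof.
elim: k u v => [//|k IH] u v ku kv.
apply: (@Ck_is_derive _ _ ((derive1 u) \+ (derive1 v))).
  by move=> x; exact: (is_deriveD (Ck_derive x ku) (Ck_derive x kv)).
by apply: IH; [case: ku|case: kv].
Qed.

Lemma CkM k u v : Ck k u -> Ck k v -> Ck k (u \* v).
Proof.
elim: k u v => [//|k IH] u v ku kv.
apply: (@Ck_is_derive _ _ ((u \* (derive1 v)) \+ (v \* (derive1 u)))).
  by move=> x; exact: (is_deriveM (Ck_derive x ku) (Ck_derive x kv)).
by apply: CkD; apply: IH; [exact: CkW|by case: kv|exact: CkW|by case: ku].
Qed.

Lemma Ck_cst k (a : R) : Ck k (fun=> a).
Proof.
elim: k a => [//|k IH] a; apply: (@Ck_is_derive _ _ (fun=> 0)) => //.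
Qed.

Lemma Ck_id k : Ck k (fun x : R => x).
Proof.
case: k => [//|k]; by apply: (@Ck_is_derive _ _ (fun=> 1)); exact: Ck_cst.
Qed.

Lemma is_derive_addf u v (x du dv : R) : is_derive x (1:R) u du ->
  is_derive x (1:R) v dv -> is_derive x (1:R) (fun x => u x + v x) (du + dv).
Proof. by move=> hu hv; exact: (is_deriveD hu hv). Qed.

Lemma is_derive_mulf u v (x du dv : R) : is_derive x (1:R) u du ->
  is_derive x (1:R) v dv ->
  is_derive x (1:R) (fun x => u x * v x) (du * v x + u x * dv).
Proof.
move=> hu hv; have := is_deriveM hu hv.
by rewrite /GRing.scale /= addrC [v x * _]mulrC.
Qed.

Lemma is_derive_idf (x : R) : is_derive x (1:R) (fun x => x) 1.
Proof. exact: is_derive_id. Qed.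

Lemma is_derive_cstf (a x : R) : is_derive x (1:R) (fun=> a) 0.
Proof. exact: is_derive_cst. Qed.

Lemma is_derive_sqr (x : R) : is_derive x (1:R) (fun x => x ^+ 2) (2 * x).
Proof.
have := is_derive_mulf (is_derive_idf x) (is_derive_idf x).
by move/is_derive_eq; apply; ring.
Qed.

Lemma is_derive_comp_scale u (a df x : R) :
  is_derive (a * x) (1:R) u df -> is_derive x (1:R) (fun x => u (a * x)) (a * df).
Proof.
move=> h; have h2 : is_derive x (1:R) (fun x => a * x) a.
  have := is_derive_mulf (is_derive_cstf a x) (is_derive_idf x).
  by move/is_derive_eq; apply; ring.
by rewrite mulrC; exact: (@is_derive1_comp _ u (fun x => a * x) x _ _ h h2).
Qed.

Lemma is_derive_comp_shift u (a df x : R) :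
  is_derive (x + a) (1:R) u df -> is_derive x (1:R) (fun x => u (x + a)) df.
Proof.
move=> h; have h2 : is_derive x (1:R) (fun x => x + a) 1.
  have := is_derive_addf (is_derive_idf x) (is_derive_cstf a x).
  by rewrite addr0.
rewrite -[df]mulr1.
exact: (@is_derive1_comp _ u (fun x => x + a) x _ _ h h2).
Qed.

Lemma Ck_scale k u (a : R) : Ck k u -> Ck k (fun x => u (a * x)).
Proof.
elim: k u => [//|k IH] u ku.
apply: (@Ck_is_derive _ _ ((fun=> a) \* (fun x => (derive1 u) (a * x)))).
  by move=> x; apply: is_derive_comp_scale; exact: Ck_derive ku.
by apply: CkM; [exact: Ck_cst|apply: IH; case: ku].
Qed.

Lemma is_derive_gauss (t x : R) : is_derive x (1:R)
  (fun x => expR (- (t * x ^+ 2))) (- (2 * t) * x * expR (- (t * x ^+ 2))).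
Proof.
have h2 : is_derive x (1:R) (fun x => - (t * x ^+ 2)) (- (2 * t) * x).
  have := is_derive_mulf (is_derive_cstf (- t) x) (is_derive_sqr x).
  under eq_fun do rewrite mulNr.
  by move/is_derive_eq; apply; ring.
rewrite mulrC.
exact: (@is_derive1_comp _ expR (fun x => - (t * x ^+ 2)) x _ _
  (is_derive_expR _) h2).
Qed.

Lemma Ck_gauss k (t : R) : Ck k (fun x => expR (- (t * x ^+ 2))).
Proof.
elim: k => [//|k IH].
apply: (@Ck_is_derive _ _ ((fun x => - (2 * t) * x) \*
                           (fun x => expR (- (t * x ^+ 2))))).
  by move=> x; exact: is_derive_gauss.
by apply: CkM => //; exact: (Ck_scale _ (@Ck_id _)).
Qed.

(** For [a = 0] the condition is empty; this case serves the coordinates whose symbol is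
    $\phi^0$. *)
Definition gap (a : R) u := forall x, `|x| < a -> u x = 0.

Lemma near_gap (a x : R) u : gap a u -> `|x| < a -> \near x, u x = 0.
Proof.
move=> ga xa; have h := @cvgr_norm_lt R R R (nbhs x) _ id x cvg_id a xa.
by near=> y; apply: ga; near: y; exact: h.
Unshelve. all: by end_near. Qed.

Lemma is_derive_near0 (x : R) u : (\near x, u x = 0) -> is_derive x (1:R) u 0.
Proof.
move=> h; apply: (@near_eq_is_derive R R R (fun=> 0) u x 1 0 _ (is_derive_cstf _ _)).
by near=> y; apply/esym; near: y; exact: h.
Unshelve. all: by end_near.
Qed.

Lemma gap_derive1 a u : gap a u -> gap a (derive1 u).
Proof.
move=> ga x xa; rewrite derive1E.
by have [_ ->] := is_derive_near0 (near_gap ga xa).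
Qed.

Lemma gapM a u v : gap a u -> gap a (v \* u).
Proof. by move=> ga x xa /=; rewrite ga// mulr0. Qed.

(** The zeros $\pm b$ of the denominator lie inside the gap, where the quotient is locally 0.
    Elsewhere the quotient rule gives terms of the same shape, the second being two successive
    divisions of a function with the same gap, so the induction hypothesis applies to it twice. *)
Lemma Ck_gap_div k (a b : R) u : `|b| < a -> gap a u -> Ck k u ->
  Ck k (fun x => u x / (x ^+ 2 - b ^+ 2)).
Proof.
move=> ba; elim: k u => [//|k IH] u ga ku.
have gd v : gap a v -> gap a (fun x => v x / (x ^+ 2 - b ^+ 2)).
  by move=> gv x xa; rewrite gv// mul0r.
apply: (@Ck_is_derive _ _ ((fun x => (derive1 u) x / (x ^+ 2 - b ^+ 2)) \+
  ((fun x => (- 2) * x) \* (fun x => u x / (x ^+ 2 - b ^+ 2) / (x ^+ 2 - b ^+ 2))))).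
  move=> x; have [xa|xa] := ltP `|x| a.
    rewrite /= (gap_derive1 ga xa) ga// !mul0r mulr0 addr0.
    by apply: is_derive_near0; exact: near_gap (gd _ ga) xa.
  have xb : x ^+ 2 - b ^+ 2 != 0.
    rewrite subr_eq0 eqf_sqr; apply/negP => /orP[]/eqP e;
      by move: xa; rewrite e ?normrN leNgt ba.
  have dr : is_derive x (1:R) (fun x => (x ^+ 2 - b ^+ 2)^-1)
      (- (x ^+ 2 - b ^+ 2) ^- 2 *: (2 * x)).
    apply: is_deriveV => //.
    have := is_derive_addf (is_derive_sqr x) (is_derive_cstf (- b ^+ 2) x).
    by rewrite addr0.
  have := is_deriveM (Ck_derive x ku) dr.
  move/is_derive_eq; apply; rewrite /GRing.scale/=.
  by field.
apply: CkD; first by apply: IH; [exact: gap_derive1|case: ku].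
apply: CkM; first by exact: (Ck_scale _ (@Ck_id _)).
apply: (IH _ (gd _ ga)); apply: IH => //; exact: CkW.
Qed.

End smooth_functions.

(** * One-dimensional cosine and sine transforms *)

Section bump_functions.
Context {R : realType}.
Implicit Types (u v w : R -> R) (k : nat).
Local Notation mu := (@lebesgue_measure R).

Definition bump u := smooth1 u /\ exists A : R, forall x, A < `|x| -> u x = 0.

Lemma bump_smooth u : bump u -> smooth1 u. Proof. by case. Qed.

Lemma smooth1_derive u x : smooth1 u -> is_derive x (1:R) u (derive1 u x).
Proof. by move=> su; exact: (Ck_derive x (su 1%N)). Qed.

Lemma smooth1_derive1 u : smooth1 u -> smooth1 (derive1 u).
Proof. by move=> su k; have [] := su k.+1. Qed.

Lemma is_derive_continuous u du : (forall x : R, is_derive x (1:R) u (du x)) ->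
  continuous u.
Proof.
move=> h x; apply: differentiable_continuous; apply/derivable1_diffP.
by have [] := h x.
Qed.

Lemma smooth1_continuous u : smooth1 u -> continuous u.
Proof.
move=> su; apply: (is_derive_continuous (du := derive1 u)) => x.
exact: smooth1_derive.
Qed.

Lemma bump_bound u : bump u -> exists2 A : R, 0 < A & forall x, A < `|x| -> u x = 0.
Proof.
move=> [_ [A hA]]; exists (Num.max 1 A); first by rewrite lt_max ltr01.
by move=> x; rewrite gt_max => /andP[_]; exact: hA.
Qed.

Lemma bump_derive1 u : bump u -> bump (derive1 u).
Proof.
move=> bu; split; first by apply: smooth1_derive1; case: bu.
have [A A0 hA] := bump_bound bu; exists A => x xA.
rewrite derive1E.
have h := @cvgr_norm_gt R R R (nbhs x) _ id x cvg_id A xA.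
suff /is_derive_near0[_ ->] : \near x, u x = 0 by [].
by near=> y; apply: hA; near: y; exact: h.
Unshelve. all: by end_near. Qed.

Lemma bumpMl u v : smooth1 v -> bump u -> bump (fun x => v x * u x).
Proof.
move=> sv [su [A hA]]; split; first by move=> k; exact: (CkM (sv k) (su k)).
by exists A => x /hA ->; rewrite mulr0.
Qed.

Lemma smooth1_id : smooth1 (fun x : R => x).
Proof. move=> k; exact: Ck_id. Qed.

Lemma bump_mulid u : bump u -> bump (fun x => x * u x).
Proof. exact: bumpMl smooth1_id. Qed.

Lemma bump_scale u (a : R) : a != 0 -> bump u -> bump (fun x => u (a * x)).
Proof.
move=> a0 [su [A hA]]; split; first by move=> k; exact: (Ck_scale _ (su k)).
exists (A / `|a|) => x; rewrite ltr_pdivrMr ?normr_gt0// => h; apply: hA.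
by rewrite normrM mulrC.
Qed.

Lemma continuous_cs_integrable u A : continuous u ->
  (forall x, A < `|x| -> u x = 0) -> mu.-integrable setT (EFin \o u).
Proof.
move=> cu hA.
have : mu.-integrable `[- A, A] (EFin \o u).
  apply: continuous_compact_integrable; first exact: segment_compact.
  by apply: continuous_subspaceT => x; exact: cu.
rewrite integrable_mkcond// (_ : _ \_ _ = EFin \o u)//.
apply/funext => x; rewrite /patch; case: ifPn => // /negP xA.
rewrite /= hA// ltNge; apply/negP => h; apply: xA.
by rewrite inE/= in_itv/= -ler_norml.
Qed.

Lemma Rintegral_cs u A : (forall x, A < `|x| -> u x = 0) ->
  \int[mu]_x u x = \int[mu]_(x in `[- A, A]) u x.
Proof.
move=> hA; rewrite [RHS]Rintegral_mkcond; congr Rintegral.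
apply/funext => x; rewrite /patch; case: ifPn => // /negP xA.
rewrite /= hA// ltNge; apply/negP => h; apply: xA.
by rewrite inE/= in_itv/= -ler_norml.
Qed.

Lemma continuous_LR u a b : (forall x, derivable u x 1) -> a < b ->
  derivable_oo_LRcontinuous u a b.
Proof.
move=> du ab; have cu x : u y @[y --> x] --> u x.
  by apply: differentiable_continuous; apply/derivable1_diffP.
split => //; [exact: cvg_at_right_filter|exact: cvg_at_left_filter].
Qed.

Lemma Rintegral_derive u du a b : (forall x : R, is_derive x (1:R) u (du x)) ->
  continuous du -> a < b -> \int[mu]_(x in `[a, b]) du x = u b - u a.
Proof.
move=> h cdu ab; rewrite /Rintegral (@continuous_FTC2 _ _ u)//.
- by apply: continuous_subspaceT => x; exact: cdu.
- by apply: continuous_LR => // x; have [] := h x.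
- by move=> x _; rewrite derive1E; have [_ ->] := h x.
Qed.

Lemma Rintegral_derive_cs u du A : (forall x : R, is_derive x (1:R) u (du x)) ->
  continuous du -> (forall x, A < `|x| -> u x = 0) -> \int[mu]_x du x = 0.
Proof.
(* [A] may be negative: [|A| + 1] gives a nondegenerate interval at whose ends [u] still
   vanishes. *)
move=> h cdu hA; have A0 : 0 < `|A| + 1 by rewrite ltr_wpDl.
have AB : A < `|A| + 1 by rewrite (le_lt_trans (ler_norm _))// ltrDl.
rewrite (@Rintegral_cs _ (`|A| + 1)); last first.
  move=> x xA.
  have g := @cvgr_norm_gt R R R (nbhs x) _ id x cvg_id A (lt_trans AB xA).
  have : \near x, u x = 0 by near=> y; apply: hA; near: y; exact: g.
  by move/is_derive_near0 => [_ <-]; have [_ ->] := h x.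
rewrite (Rintegral_derive h)//; last by rewrite gtrN.
by rewrite !hA ?subrr// ?normrN ger0_norm// ltW.
Unshelve. all: by end_near. Qed.

Lemma is_derive_cosM (x y : R) :
  is_derive y (1:R) (fun y => cos (x * y)) (- x * sin (x * y)).
Proof. by rewrite mulNr -mulrN; exact: is_derive_comp_scale. Qed.

Lemma is_derive_sinM (x y : R) :
  is_derive y (1:R) (fun y => sin (x * y)) (x * cos (x * y)).
Proof. exact: is_derive_comp_scale. Qed.

Lemma continuous_cosM (x : R) : continuous (fun y => cos (x * y)).
Proof. by apply: is_derive_continuous => y; exact: is_derive_cosM. Qed.

Lemma continuous_sinM (x : R) : continuous (fun y => sin (x * y)).
Proof. by apply: is_derive_continuous => y; exact: is_derive_sinM. Qed.

Lemma Ck_cos_sin k : Ck k (@cos R) /\ Ck k (@sin R).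
Proof.
elim: k => [//|k [IHc IHs]]; split.
  apply: (@Ck_is_derive _ _ _ ((fun=> -1) \* sin)).
    by move=> x; rewrite /= mulN1r; exact: is_derive_cos.
  by apply: CkM => //; exact: Ck_cst.
by apply: (@Ck_is_derive _ _ _ cos).
Qed.

Lemma smooth1_cosM (x : R) : smooth1 (fun y => cos (x * y)).
Proof. by move=> k; exact: (Ck_scale _ (Ck_cos_sin k).1). Qed.

Lemma smooth1_sinM (x : R) : smooth1 (fun y => sin (x * y)).
Proof. by move=> k; exact: (Ck_scale _ (Ck_cos_sin k).2). Qed.

(** Real and imaginary parts of the integral of $e^{ixy}u(y)$; splitting them keeps the one-variable
    analysis real. *)
Definition Ic u x := \int[mu]_y (cos (x * y) * u y).
Definition Is u x := \int[mu]_y (sin (x * y) * u y).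
Definition L1 u := \int[mu]_y `|u y|.

Lemma continuousMf u v : continuous u -> continuous v ->
  continuous (fun x : R => u x * v x : R).
Proof. by move=> cu cv x; apply: cvgM; [exact: cu|exact: cv]. Qed.

Lemma bump_integrableM u v : continuous v -> bump u ->
  mu.-integrable setT (EFin \o (fun x => v x * u x)).
Proof.
move=> cv bu; have [A _ hA] := bump_bound bu.
apply: (@continuous_cs_integrable _ A).
  by apply: continuousMf => //; exact: smooth1_continuous bu.1.
by move=> x xA; rewrite hA// mulr0.
Qed.

Lemma bump_integrable u : bump u -> mu.-integrable setT (EFin \o u).
Proof.
move=> bu; have [A _ hA] := bump_bound bu.
by apply: (@continuous_cs_integrable _ A) => //; exact: smooth1_continuous bu.1.
Qed.

(** The derivative of $\sin(xy)u(y)$ integrates to 0. *)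
Lemma Ic_parts u x : bump u -> x * Ic u x = - Is (derive1 u) x.
Proof.
move=> bu; have [A _ hA] := bump_bound bu.
have bu' := bump_derive1 bu.
have cx := @continuous_cosM x; have sx := @continuous_sinM x.
have h y := is_derive_mulf (is_derive_sinM x y) (smooth1_derive y bu.1).
have := Rintegral_derive_cs h.
have cu := smooth1_continuous bu.1; have cu' := smooth1_continuous bu'.1.
move=> /(_ A) => H.
have {H} : \int[mu]_y (x * (cos (x * y) * u y) + sin (x * y) * derive1 u y) = 0.
  under eq_Rintegral do rewrite mulrA.
  apply: H; last by move=> y yA; rewrite hA// mulr0.
  move=> y; apply: cvgD; last by apply: cvgM; [exact: sx|exact: cu'].
  by apply: cvgM; [apply: cvgM; [exact: cvg_cst|exact: cx]|exact: cu].
rewrite RintegralD//; last 2 first.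
- by apply: (bump_integrableM (v := fun=> _)); [exact: cst_continuous|
    apply: bumpMl => //; (exact: smooth1_cosM || exact: smooth1_sinM)].
- exact: bump_integrableM.
rewrite RintegralZl//; last exact: bump_integrableM.
by move/eqP; rewrite addr_eq0 => /eqP.
Qed.

Lemma Is_parts u x : bump u -> x * Is u x = Ic (derive1 u) x.
Proof.
move=> bu; have [A _ hA] := bump_bound bu.
have bu' := bump_derive1 bu.
have cx := @continuous_cosM x; have sx := @continuous_sinM x.
have h y := is_derive_mulf (is_derive_cosM x y) (smooth1_derive y bu.1).
have := Rintegral_derive_cs h.
have cu := smooth1_continuous bu.1; have cu' := smooth1_continuous bu'.1.
move=> /(_ A) => H.
have {H} : \int[mu]_y (- x * (sin (x * y) * u y) + cos (x * y) * derive1 u y) = 0.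
  under eq_Rintegral do rewrite mulrA.
  apply: H; last by move=> y yA; rewrite hA// mulr0.
  move=> y; apply: cvgD; last by apply: cvgM; [exact: cx|exact: cu'].
  by apply: cvgM; [apply: cvgM; [exact: cvg_cst|exact: sx]|exact: cu].
rewrite RintegralD//; last 2 first.
- by apply: (bump_integrableM (v := fun=> _)); [exact: cst_continuous|
    apply: bumpMl => //; (exact: smooth1_cosM || exact: smooth1_sinM)].
- exact: bump_integrableM.
rewrite RintegralZl//; last exact: bump_integrableM.
by move/eqP; rewrite addrC addr_eq0 mulNr opprK => /eqP.
Qed.

Lemma Ic_bound u x : bump u -> `|Ic u x| <= L1 u.
Proof.
move=> bu; have iu := @bump_integrableM u _ (@continuous_cosM x) bu.
apply: (le_trans (le_normr_Rintegral _ iu)) => //.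
apply: le_Rintegral => //; last 1 first.
- by move=> y _; rewrite normrM ler_piMl//; have := @cos_max _ (x * y).
- by move/integrable_norm : iu.
- by move/integrable_norm : (bump_integrable bu).
Qed.

Lemma Is_bound u x : bump u -> `|Is u x| <= L1 u.
Proof.
move=> bu; have iu := @bump_integrableM u _ (@continuous_sinM x) bu.
apply: (le_trans (le_normr_Rintegral _ iu)) => //.
apply: le_Rintegral => //; last 1 first.
- by move=> y _; rewrite normrM ler_piMl//; have := @sin_max _ (x * y).
- by move/integrable_norm : iu.
- by move/integrable_norm : (bump_integrable bu).
Qed.

End bump_functions.

(** * Derivatives and rapid decay of the cosine and sine transforms *)

Section rapid_decay.
Context {R : realType}.
Implicit Types (u v w : R -> R) (k : nat).
Local Notation mu := (@lebesgue_measure R).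

Lemma is_derive_Rintegral d (T : measurableType d) (nu : {measure set T -> \bar R})
    (f g : R -> T -> R) (G : T -> R) (x : R) :
  (forall z y, is_derive z (1:R) (fun z => f z y) (g z y)) ->
  (forall z, nu.-integrable setT (EFin \o f z)) ->
  nu.-integrable setT (EFin \o G) -> (forall z y, `|g z y| <= G y) ->
  is_derive x (1:R) (fun z => \int[nu]_y f z y) (\int[nu]_y g x y).
Proof.
move=> df intf intG gG.
(* Differentiation under the integral is local in the parameter; the domination being global, any
   interval around [x] serves. *)
have Ix : `]x - 1, x + 1[%classic x by rewrite /= in_itv/= ltrBlDr !ltrDl ltr01.
have p1 z y : partial1of2 f z y = g z y by rewrite partial1of2E; have [_ ->] := df z y.
have der z y : derivable (f ^~ y) z 1 by have [] := df z y.
have G0 y : 0 <= G y by apply: le_trans (gG 0 y).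
apply: DeriveDef.
  apply: (@derivable_under_integral _ _ _ nu f setT measurableT _ _ _ Ix _ _ G) => //.
  by move=> z y _ _; rewrite p1.
rewrite -derive1E (@differentiation_under_integral _ _ _ nu f setT measurableT _ _ _ Ix _ _ G) //.
  by apply: eq_Rintegral => y _; rewrite -p1.
by move=> z y _ _; rewrite p1.
Qed.

Lemma Ic_derive u x : bump u -> is_derive x (1:R) (Ic u) (- Is (fun y => y * u y) x).
Proof.
move=> bu; have bxu : bump (fun y => y * u y) := bump_mulid bu.
have -> : - Is (fun y => y * u y) x = \int[mu]_y (- sin (x * y) * (y * u y)).
  rewrite /Is -mulN1r -RintegralZl//; last exact: bump_integrableM (@continuous_sinM _ _) _.
  by apply: eq_Rintegral => y _; ring.
apply: (@is_derive_Rintegral _ _ mu _ (fun z y => - sin (z * y) * (y * u y))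
  (fun y => `|y * u y|)).
- move=> z y; have h : is_derive z (1:R) (fun z => cos (z * y)) (- y * sin (z * y)).
    by under eq_fun do rewrite mulrC; rewrite [z * y]mulrC; exact: is_derive_cosM.
  have := is_derive_mulf h (is_derive_cstf (u y) z).
  by move/is_derive_eq; apply; ring.
- by move=> z; exact: (bump_integrableM (@continuous_cosM _ z) bu).
- by have := integrable_norm (bump_integrable bxu).
- move=> z y; rewrite normrM normrN ler_piMl//; have := @sin_max _ (z * y).
  by rewrite ler_norml.
Qed.

Lemma Is_derive u x : bump u -> is_derive x (1:R) (Is u) (Ic (fun y => y * u y) x).
Proof.
move=> bu; have bxu : bump (fun y => y * u y) := bump_mulid bu.
apply: (@is_derive_Rintegral _ _ mu _ (fun z y => cos (z * y) * (y * u y))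
  (fun y => `|y * u y|)).
- move=> z y; have h : is_derive z (1:R) (fun z => sin (z * y)) (y * cos (z * y)).
    by under eq_fun do rewrite mulrC; rewrite [z * y]mulrC; exact: is_derive_sinM.
  have := is_derive_mulf h (is_derive_cstf (u y) z).
  by move/is_derive_eq; apply; ring.
- by move=> z; exact: (bump_integrableM (@continuous_sinM _ z) bu).
- by have := integrable_norm (bump_integrable bxu).
- move=> z y; rewrite normrM ler_piMl//; have := @cos_max _ (z * y).
  by rewrite ler_norml.
Qed.

(* The [k]-th derivative of [Ic u] ([b = true]) or [Is u] ([b = false]). *)
Fixpoint Icsn (b : bool) k u : R -> R :=
  if k is k'.+1 then
    if b then fun x => - Icsn false k' (fun y => y * u y) x
    else Icsn true k' (fun y => y * u y)
  else if b then Ic u else Is u.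

Lemma Icsn_derive b k u x : bump u -> is_derive x (1:R) (Icsn b k u) (Icsn b k.+1 u x).
Proof.
elim: k b u => [|k IH] b u bu.
  by case: b => /=; [exact: Ic_derive|exact: Is_derive].
have bxu := bump_mulid bu; case: b; last exact: IH.
by apply: is_deriveN; exact: IH.
Qed.

(** Each integration by parts trades one factor $x$ for a derivative of [u], which is again a
    bump. *)
Lemma Ics_pow_bound N u : bump u ->
  exists C, forall x, `|x| ^+ N * `|Ic u x| <= C /\ `|x| ^+ N * `|Is u x| <= C.
Proof.
elim: N u => [|N IH] u bu.
  exists (L1 u) => x; rewrite expr0 !mul1r; split; [exact: Ic_bound|exact: Is_bound].
have [C hC] := IH _ (bump_derive1 bu); exists C => x; have [h1 h2] := hC x; split.
  by rewrite exprSr -mulrA -normrM Ic_parts// normrN.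
by rewrite exprSr -mulrA -normrM Is_parts.
Qed.

Definition rapid v := forall N, exists C, forall x, (1 + `|x|) ^+ N * `|v x| <= C.

Lemma rapidN v : rapid v -> rapid (fun x => - v x).
Proof.
by move=> rv N; have [C hC] := rv N; exists C => x; rewrite normrN.
Qed.

(** From $1+a\le 2\max(1,a)$. It reduces decay in $1+|x|$ to decay in $|x|$ together with
    boundedness. *)
Lemma onep_pow (a : R) N : 0 <= a -> (1 + a) ^+ N <= 2 ^+ N * (1 + a ^+ N).
Proof.
move=> a0; have [a1|a1] := leP a 1.
  apply: (@le_trans _ _ (2 ^+ N)).
    by rewrite lerXn2r// ?nnegrE; lra.
  by rewrite ler_peMr ?exprn_ge0// lerDl exprn_ge0.
apply: (@le_trans _ _ ((2 * a) ^+ N)).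
  by rewrite lerXn2r// ?nnegrE; lra.
by rewrite exprMn ler_pM2l ?exprn_gt0// lerDr.
Qed.

(** Up to sign, a $k$-th derivative is the transform of $y^ku$, and multiplication by $y$ preserves
    bumps. *)
Lemma Icsn_rapid b k u : bump u -> rapid (Icsn b k u).
Proof.
elim: k b u => [|k IH] b u bu; last first.
  by case: b; [apply: rapidN|]; apply: IH; exact: bump_mulid.
move=> N; have [C hC] := Ics_pow_bound N bu.
have [C0 hC0] := Ics_pow_bound 0 bu.
exists (2 ^+ N * (C0 + C)) => x.
apply: (@le_trans _ _ (2 ^+ N * (1 + `|x| ^+ N) * `|Icsn b 0 u x|)).
  by rewrite ler_wpM2r// onep_pow.
rewrite -mulrA ler_pM2l ?exprn_gt0// mulrDl.
by apply: lerD; case: b => /=; [case: (hC0 x)|case: (hC0 x)|case: (hC x)|case: (hC x)].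
Qed.

Lemma Ic_rapid u : bump u -> rapid (Ic u). Proof. exact: (@Icsn_rapid true 0). Qed.
Lemma Is_rapid u : bump u -> rapid (Is u). Proof. exact: (@Icsn_rapid false 0). Qed.

Lemma rapid_shift v (s : R) : rapid v -> rapid (fun x => v (x + s)).
Proof.
move=> rv N; have [C hC] := rv N; exists ((1 + `|s|) ^+ N * C) => x.
apply: (@le_trans _ _ ((1 + `|s|) ^+ N * (1 + `|x + s|) ^+ N * `|v (x + s)|)).
  rewrite ler_wpM2r// -exprMn lerXn2r ?nnegrE ?mulr_ge0 ?addr_ge0//.
  (* Peetre's inequality: $1+|x|\le(1+|s|)(1+|x+s|)$. *)
  have -> : `|x| = `|(x + s) - s| by rewrite addrK.
  have := ler_normB (x + s) s; have := normr_ge0 s; have := normr_ge0 (x + s); nra.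
by rewrite -mulrA ler_wpM2l// exprn_ge0 ?addr_ge0.
Qed.

Lemma integrable_oneDsqrV : mu.-integrable setT (EFin \o (fun x => (oneDsqr x)^-1)).
Proof.
apply/integrableP; split.
  apply/measurable_EFinP; apply: continuous_measurable_fun.
  exact: continuous_oneDsqrV.
under eq_integral do rewrite /= ger0_norm//.
rewrite (ge0_symfun_integralT (f := fun x => (oneDsqr x)^-1)).
- by rewrite -set_itvcy integral0y_oneDsqr// -EFinM ltry.
- by [].
- exact: continuous_oneDsqrV.
- by move=> x /=; rewrite /oneDsqr sqrrN.
Qed.

Lemma rapid_integrable v : continuous v -> rapid v -> mu.-integrable setT (EFin \o v).
Proof.
move=> cv rv; have [C hC] := rv 2.
have C0 : 0 <= C by apply: le_trans (hC 0); rewrite mulr_ge0// exprn_ge0// addr_ge0.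
apply: (@le_integrable _ _ _ mu setT measurableT _ (fun x => C%:E * ((oneDsqr x)^-1)%:E)%E).
- by apply/measurable_EFinP; exact: continuous_measurable_fun.
- move=> x _ /=; rewrite lee_fin normrM (ger0_norm C0) ger0_norm//.
  rewrite ler_pdivlMr; last by rewrite (lt_le_trans _ (oneDsqr_ge1 x)).
  apply: le_trans (hC x); rewrite mulrC ler_wpM2r// /oneDsqr.
  by rewrite -(real_normK (num_real x)); have := normr_ge0 x; nra.
- by apply: integrableZl => //; exact: integrable_oneDsqrV.
Qed.

(** The fundamental theorem on growing symmetric intervals, with dominated convergence on one side
    and vanishing boundary terms on the other. *)
Lemma Rintegral_derive_rapid u du : (forall x : R, is_derive x (1:R) u (du x)) ->
  continuous du -> rapid u -> rapid du -> \int[mu]_x du x = 0.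
Proof.
move=> h cdu ru rdu; have idu := rapid_integrable cdu rdu.
(* With half-length [n.+1] no interval is degenerate, and decay of order one bounds the boundary
   terms by [2 * C / n.+1]. *)
pose I n : set R := `[(- n.+1%:R : R), n.+1%:R]%classic.
have mI n : measurable (I n) by exact: measurable_itv.
have mdu : measurable_fun setT (EFin \o du) by exact: measurable_int idu.
have cv : (\int[mu]_(x in setT) ((EFin \o du) \_ (I n)) x)%E @[n --> \oo] -->
    (\int[mu]_(x in setT) (EFin \o du) x)%E.
  apply: (@dominated_cvg _ _ _ mu setT measurableT _ _ (fun x => `|du x|%:E)).
  - move=> n; apply/(measurable_restrictT _ (mI n)).
    exact: measurable_funS mdu.
  - move=> x _; apply: cvg_near_cst; exists (Num.truncn `|x|) => // n /= xn.
    rewrite /patch mem_set// /I /= in_itv/= -ler_norml.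
    rewrite (le_trans (ltW (truncnS_gt _)))// ler_nat ltnS//.
  - by move=> x _.
  - by have := integrable_norm idu.
  - move=> n x _; rewrite /patch; case: ifPn => //= _.
    by rewrite lee_fin normr0 normr_ge0.
have [C hC] := ru 1.
have eI n : (\int[mu]_(x in setT) ((EFin \o du) \_ (I n)) x)%E =
    (u n.+1%:R - u (- n.+1%:R))%:E.
  rewrite -integral_mkcond (@continuous_FTC2 _ _ u) ?EFinB//.
  - by rewrite gtrN.
  - by apply: continuous_subspaceT => x; exact: cdu.
  - by apply: continuous_LR; [move=> x; have [] := h x|rewrite gtrN].
  - by move=> x _; rewrite derive1E; have [_ ->] := h x.
have cv0 : (u n.+1%:R - u (- n.+1%:R))%:E @[n --> \oo] --> 0%:E.
  apply: cvg_EFin; first exact: nearW.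
  apply/norm_cvg0P; apply: (@squeeze_cvgr _ _ _ _ (cst 0) (fun n => 2 * C * (n.+1%:R)^-1)).
  - apply: nearW => n; rewrite normr_ge0/= ler_pdivlMr//.
    have B (e : R) : `|e| = n.+1%:R -> n.+1%:R * `|u e| <= C.
      move=> <-; apply: le_trans (hC e); rewrite expr1 ler_wpM2r//; lra.
    have n0 : `|n.+1%:R : R| = n.+1%:R by rewrite ger0_norm.
    have h1 := B _ n0; have h2 := B (- n.+1%:R) (etrans (normrN _) n0).
    apply: (le_trans (ler_wpM2r _ (ler_normB _ _))) => //.
    by rewrite mulrDl mulrC [X in _ + X]mulrC mulr_natl mulr2n lerD.
  - exact: cvg_cst.
  - rewrite -[0](mulr0 (2 * C)); apply: cvgM; first exact: cvg_cst.
    exact: cvg_harmonic.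
rewrite /Rintegral; suff -> : (\int[mu]_x (du x)%:E = 0)%E by [].
by rewrite (funext eI) in cv; exact: (cvg_unique _ cv cv0).
Qed.

End rapid_decay.

(** * Transforms of functions vanishing near a point, and Gaussian damping *)

Section gaussian_bounds.
Context {R : realType}.
Implicit Types (u v w : R -> R) (k : nat).
Local Notation mu := (@lebesgue_measure R).

Lemma rapidD u v : rapid u -> rapid v -> rapid (fun x => u x + v x).
Proof.
move=> ru rv N; have [C hC] := ru N; have [D hD] := rv N; exists (C + D) => x.
by apply: le_trans (lerD (hC x) (hD x)); rewrite -mulrDr ler_wpM2l ?ler_normD//.
Qed.

Lemma rapidMl u v (B : R) : (forall x, `|v x| <= B) -> rapid u ->
  rapid (fun x => v x * u x).
Proof.
move=> vB ru N; have [C hC] := ru N; exists (B * C) => x.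
rewrite normrM mulrCA; by apply: ler_pM.
Qed.

Lemma IcD u v x : bump u -> bump v -> Ic (fun y => u y + v y) x = Ic u x + Ic v x.
Proof.
move=> bu bv; rewrite /Ic -RintegralD//; last 2 first.
- exact: (bump_integrableM (@continuous_cosM _ x) bu).
- exact: (bump_integrableM (@continuous_cosM _ x) bv).
by apply: eq_Rintegral => y _; rewrite mulrDr.
Qed.

Lemma IsD u v x : bump u -> bump v -> Is (fun y => u y + v y) x = Is u x + Is v x.
Proof.
move=> bu bv; rewrite /Is -RintegralD//; last 2 first.
- exact: (bump_integrableM (@continuous_sinM _ x) bu).
- exact: (bump_integrableM (@continuous_sinM _ x) bv).
by apply: eq_Rintegral => y _; rewrite mulrDr.
Qed.

Lemma IcZ u a x : bump u -> Ic (fun y => a * u y) x = a * Ic u x.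
Proof.
move=> bu; rewrite /Ic -RintegralZl//.
  by apply: eq_Rintegral => y _; rewrite mulrCA.
exact: (bump_integrableM (@continuous_cosM _ x) bu).
Qed.

Lemma IsZ u a x : bump u -> Is (fun y => a * u y) x = a * Is u x.
Proof.
move=> bu; rewrite /Is -RintegralZl//.
  by apply: eq_Rintegral => y _; rewrite mulrCA.
exact: (bump_integrableM (@continuous_sinM _ x) bu).
Qed.

Lemma bumpZ u a : bump u -> bump (fun y => a * u y).
Proof. by apply: bumpMl => k; exact: Ck_cst. Qed.

(* With [u y = (y^2 - xi^2) v y] and [V := Ic v], [Ic u = - (V'' + xi^2 V)], so that the
   integrands below are derivatives of rapidly decreasing functions. *)
Lemma Ic_gap_transform u (a xi s : R) : bump u -> gap a u -> `|xi| < a ->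
  \int[mu]_x (cos (xi * x) * Ic u (x + s)) = 0 /\
  \int[mu]_x (sin (xi * x) * Ic u (x + s)) = 0.
Proof.
move=> bu ga xia; pose v y := u y / (y ^+ 2 - xi ^+ 2).
have bv : bump v.
  split; first by move=> k; apply: Ck_gap_div xia ga (bu.1 k).
  by have [A _ hA] := bump_bound bu; exists A => y yA; rewrite /v hA// mul0r.
have bxv := bump_mulid bv; have bxxv := bump_mulid bxv.
have uE : u = (fun y => (y * (y * v y)) + (- xi ^+ 2) * v y).
  apply/funext => y; rewrite /v; have [ya|ya] := ltP `|y| a.
    by rewrite ga// mul0r !mulr0 addr0.
  have yx : y ^+ 2 - xi ^+ 2 != 0.
    rewrite subr_eq0 eqf_sqr; apply/negP => /orP[]/eqP e;
      by move: ya; rewrite e ?normrN leNgt xia.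
  by field.
have IE x : Ic u x = Ic (fun y => y * (y * v y)) x - xi ^+ 2 * Ic v x.
  by rewrite {1}uE IcD// ?IcZ ?mulNr//; exact: bumpZ.
have dV x := is_derive_comp_shift (Ic_derive (x + s) bv).
have dW x := is_derive_comp_shift (Is_derive (x + s) bxv).
have du x : is_derive x (1:R) (fun x => Ic u (x + s)) (- Is (fun y => y * u y) (x + s)).
  exact: is_derive_comp_shift (Ic_derive _ bu).
have cu : continuous (fun x => Ic u (x + s)).
  exact: (is_derive_continuous du).
have ru : rapid (fun x => Ic u (x + s)) by apply: rapid_shift; exact: Ic_rapid.
have rV : rapid (fun x => Ic v (x + s)) by apply: rapid_shift; exact: Ic_rapid.
have rW : rapid (fun x => Is (fun y => y * v y) (x + s)) by apply: rapid_shift; exact: Is_rapid.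
have c1 x : `|cos (xi * x)| <= 1 by exact: cos_max.
have s1 x : `|sin (xi * x)| <= 1 by exact: sin_max.
have cst1 (b x : R) : `|b| <= `|b| by [].
split.
(* Minus the Wronskian of $\cos(\xi x)$ and $V$, where [Is (fun y => y * v y)] is $-V'$. As
   $\cos(\xi x)$ solves $g''+\xi^2g=0$, its derivative is $-\cos(\xi x)(V''+\xi^2V)$. The sine is
   treated in the same way below. *)
- apply: (@Rintegral_derive_rapid _ (fun x => cos (xi * x) * Is (fun y => y * v y) (x + s) +
      (- xi) * (sin (xi * x) * Ic v (x + s)))).
  + move=> x; have := is_derive_addf (is_derive_mulf (is_derive_cosM xi x) (dW x))
      (is_derive_mulf (is_derive_cstf (- xi) x)
        (is_derive_mulf (is_derive_sinM xi x) (dV x))).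
    by move/is_derive_eq; apply; rewrite IE; ring.
  + by apply: continuousMf => //; exact: continuous_cosM.
  + apply: rapidD; first exact: (rapidMl c1).
    by apply: (rapidMl (v := fun=> _) (cst1 _)); exact: (rapidMl s1).
  + exact: (rapidMl c1).
- apply: (@Rintegral_derive_rapid _ (fun x => sin (xi * x) * Is (fun y => y * v y) (x + s) +
      xi * (cos (xi * x) * Ic v (x + s)))).
  + move=> x; have := is_derive_addf (is_derive_mulf (is_derive_sinM xi x) (dW x))
      (is_derive_mulf (is_derive_cstf xi x)
        (is_derive_mulf (is_derive_cosM xi x) (dV x))).
    by move/is_derive_eq; apply; rewrite IE; ring.
  + by apply: continuousMf => //; exact: continuous_sinM.
  + apply: rapidD; first exact: (rapidMl s1).
    by apply: (rapidMl (v := fun=> _) (cst1 _)); exact: (rapidMl c1).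
  + exact: (rapidMl s1).
Qed.

Definition gauss (t y : R) := expR (- (t * y ^+ 2)).

Lemma smooth1_gauss t : smooth1 (gauss t).
Proof. by move=> k; exact: Ck_gauss. Qed.

(** Where [u] is nonzero, $|y|\ge a$, so the Gaussian is at most $e^{-ta^2}$. *)
Lemma L1_gauss u a t : bump u -> gap a u -> 0 <= a -> 0 <= t ->
  L1 (fun y => gauss t y * u y) <= expR (- (t * a ^+ 2)) * L1 u.
Proof.
move=> bu ga a0 t0; rewrite /L1 -RintegralZl//; last first.
  by have := integrable_norm (bump_integrable bu).
have bgu : bump (fun y => gauss t y * u y) by apply: bumpMl => //; exact: smooth1_gauss.
apply: le_Rintegral => //.
- by have := integrable_norm (bump_integrable bgu).
- have := integrable_norm (bump_integrable bu).
  by move/(integrableZl measurableT (expR (- (t * a ^+ 2)))).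
- move=> y _; rewrite normrM ger0_norm ?expR_ge0//.
  have [ya|ya] := ltP `|y| a; first by rewrite ga// normr0 !mulr0.
  rewrite ler_wpM2r// ler_expR lerN2 ler_wpM2l//.
  by rewrite -(real_normK (num_real y)) lerXn2r// nnegrE.
Qed.

(** The point is the explicit dependence on $t$. An integration by parts either differentiates $u$
    or brings down $-2ty$ from the Gaussian; both $u'$ and $yu$ are bumps with the same gap, so each
    step costs at most a factor $1+t$ and the exponential survives. *)
Lemma gauss_decay N u a : bump u -> gap a u -> 0 <= a ->
  exists2 C, 0 <= C & forall t x, 0 <= t ->
    `|x| ^+ N * `|Ic (fun y => gauss t y * u y) x| <=
       C * ((1 + t) ^+ N * expR (- (t * a ^+ 2))) /\
    `|x| ^+ N * `|Is (fun y => gauss t y * u y) x| <=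
       C * ((1 + t) ^+ N * expR (- (t * a ^+ 2))).
Proof.
move=> + + a0; elim: N u => [|N IH] u bu ga.
  exists (L1 u); first by apply: le_trans (Ic_bound 0 bu).
  move=> t x t0; rewrite !expr0 !mul1r mulrC.
  have bgu : bump (fun y => gauss t y * u y) by apply: bumpMl => //; exact: smooth1_gauss.
  have L := L1_gauss bu ga a0 t0.
  by split; apply: le_trans L; [exact: Ic_bound|exact: Is_bound].
have [C C0 hC] := IH _ (bump_derive1 bu) (gap_derive1 ga).
have [D D0 hD] := IH _ (bump_mulid bu) (gapM id ga).
(* [C] comes from the term with $u'$, and [2 * D] from the factor $2t$ in front of the term with
   $yu$. *)
exists (C + 2 * D) => [|t x t0]; first by rewrite addr_ge0// mulr_ge0.
have sg := smooth1_gauss t.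
have bgu : bump (fun y => gauss t y * u y) by apply: bumpMl.
have bgu' : bump (fun y => gauss t y * derive1 u y) by apply: bumpMl => //; exact: bump_derive1.
have bgxu : bump (fun y => gauss t y * (y * u y)) by apply: bumpMl => //; exact: bump_mulid.
have dE : derive1 (fun y => gauss t y * u y) =
    (fun y => gauss t y * derive1 u y + (- (2 * t)) * (gauss t y * (y * u y))).
  apply/funext => y; rewrite derive1E.
  have := is_derive_mulf (is_derive_gauss t y) (smooth1_derive y bu.1).
  by move=> [_ ->]; rewrite /gauss; ring.
have [hC1 hC2] := hC t x t0; have [hD1 hD2] := hD t x t0.
set E := expR _ in hC1 hC2 hD1 hD2 *; set P := (1 + t) ^+ N in hC1 hC2 hD1 hD2 *.
have E0 : 0 <= E by exact: expR_ge0.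
have P0 : 0 <= P by rewrite exprn_ge0// addr_ge0.
have X0 : 0 <= `|x| ^+ N by rewrite exprn_ge0.
have fin A B : `|x| ^+ N * `|A| <= C * (P * E) -> `|x| ^+ N * `|B| <= D * (P * E) ->
    `|x| ^+ N * `|A + (- (2 * t)) * B| <= (C + 2 * D) * ((1 + t) ^+ N.+1 * E).
  move=> hA hB; apply: (@le_trans _ _ (`|x| ^+ N * `|A| + 2 * t * (`|x| ^+ N * `|B|))).
    rewrite mulrCA -mulrDr ler_wpM2l// (le_trans (ler_normD _ _))// normrM normrN.
    by rewrite (ger0_norm (mulr_ge0 _ t0)).
  apply: (@le_trans _ _ (C * (P * E) + 2 * t * (D * (P * E)))).
    by rewrite lerD// ler_wpM2l// mulr_ge0.
  rewrite exprSr -/P; have PE0 : 0 <= P * E by rewrite mulr_ge0.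
  have : 0 <= C * t * (P * E) by rewrite !mulr_ge0.
  have : 0 <= D * (P * E) by rewrite !mulr_ge0.
  nra.
have xS A : `|x| ^+ N.+1 * `|A| = `|x| ^+ N * `|x * A|.
  by rewrite exprSr -mulrA -normrM.
rewrite !xS Ic_parts// Is_parts// normrN dE.
rewrite IsD ?IsZ ?IcD ?IcZ//; try exact: bumpZ.
by split; apply: fin.
Qed.

End gaussian_bounds.

(** * Lebesgue measure on row vectors *)

Section affine_changes.
Context {R : realType}.
Local Notation mu := (@lebesgue_measure R).

(** Affine maps, reflection and the splitting of a coordinate are all instances of this form, each
    requiring only an identity between measures. *)
Lemma ge0_integral_image d1 d2 (X : measurableType d1) (Y : measurableType d2)
    (m1 : {measure set X -> \bar R}) (m2 : {measure set Y -> \bar R})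
    (phi : X -> Y) (c : {nonneg R}) (g : Y -> \bar R) :
  measurable_fun setT phi ->
  (forall A, measurable A -> m2 A = (c%:num%:E * m1 (phi @^-1` A))%E) ->
  measurable_fun setT g -> (forall y, (0 <= g y)%E) ->
  (\int[m2]_y g y = c%:num%:E * \int[m1]_x g (phi x))%E.
Proof.
move=> mphi h mg g0.
pose push : {measure set Y -> \bar R} :=
  measure_function_pushforward__canonical__measure_function_Measure m1 mphi.
transitivity (\int[mscale c push]_y g y)%E.
  by apply: eq_measure_integral => A mA _; rewrite h.
rewrite ge0_integral_mscale//; congr (_ * _)%E.
by rewrite (ge0_integral_pushforward mphi m1 measurableT mg)// => y _; exact: g0.
Qed.

Definition affine1 (a b x : measurableTypeR R) : measurableTypeR R := a * x + b.

Lemma measurable_affine1 (a b : R) : measurable_fun setT (affine1 a b).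
Proof.
apply: measurable_funD => //; apply: measurable_funM => //.
Qed.

Lemma lebesgue_affine1 (a b : R) (A : set (measurableTypeR R)) : 0 < a -> measurable A ->
  (mu A = a%:E * mu (affine1 a b @^-1` A))%E.
Proof.
move=> a0 mA; pose an := NngNum (ltW a0).
pose push : {measure set (measurableTypeR R) -> \bar R} :=
  measure_function_pushforward__canonical__measure_function_Measure mu
    (@measurable_affine1 a b).
apply: (@lebesgue_measure_unique R (mscale an push)) => // _ [[c d] _ <-] /=.
rewrite /mscale /= /pushforward.
have -> : affine1 a b @^-1` `]c, d] = `](c - b) / a, (d - b) / a]%classic.
  apply/seteqP; split => x /=; rewrite /affine1 !in_itv/=;
  by rewrite ler_pdivlMr// ltr_pdivrMr// ltrBlDr lerBrDr mulrC.
rewrite !lebesgue_measure_itv/= !lte_fin ltr_pM2r ?invr_gt0// ltrD2r.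
case: ifPn => _; last by rewrite mule0.
rewrite -!EFinB -EFinM; congr EFin; field.
by rewrite gt_eqF.
Qed.

Lemma ge0_integral_affine1 (a b : R) (g : measurableTypeR R -> \bar R) : 0 < a ->
  measurable_fun setT g -> (forall y, (0 <= g y)%E) ->
  (\int[mu]_y g y = a%:E * \int[mu]_x g (affine1 a b x))%E.
Proof.
move=> a0; have := @ge0_integral_image _ _ _ _ mu mu (affine1 a b) (NngNum (ltW a0)) g.
by apply; [exact: measurable_affine1|move=> A; exact: lebesgue_affine1].
Qed.

Lemma lebesgue_rV_integral n (g : 'rV[R]_n.+1 -> \bar R) :
  measurable_fun setT g -> (forall y, (0 <= g y)%E) ->
  (\int[lebesgue_rV R n.+1]_y g y =
   \int[mu]_z \int[lebesgue_rV R n]_x g (cons_rV (z, x)))%E.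
Proof.
move=> mg g0.
have h := @ge0_integral_image _ _ _ _ (mu \x lebesgue_rV R n)%E (lebesgue_rV R n.+1)
  (@cons_rV R n) (NngNum (@ler01 R)) g (@measurable_cons_rV R n).
rewrite h//; last by move=> A mA; rewrite mul1e.
rewrite mul1e (fubini_tonelli1 (g \o @cons_rV R n))//.
- by apply: measurableT_comp => //; exact: measurable_cons_rV.
- by move=> z; exact: g0.
Qed.

Definition affine n (a : R) (v x : 'rV[R]_n) : 'rV[R]_n := a *: x + v.

Lemma measurable_affine n (a : R) (v : 'rV[R]_n) : measurable_fun setT (affine a v).
Proof.
apply: measurable_fun_rV => i; under eq_fun do rewrite !mxE.
have h := measurableT_comp (measurable_affine1 a (v ord0 i)) (@measurable_coord R n i).
exact: h.
Qed.

(** Tonelli peels off one coordinate at a time, and each contributes one factor $a$. *)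
Lemma ge0_integral_affine n (a : R) (v : 'rV[R]_n) (g : 'rV[R]_n -> \bar R) : 0 < a ->
  measurable_fun setT g -> (forall y, (0 <= g y)%E) ->
  (\int[lebesgue_rV R n]_y g y =
   (a ^+ n)%:E * \int[lebesgue_rV R n]_x g (affine a v x))%E.
Proof.
move=> a0; elim: n v g => [|n IH] v g mg g0.
  rewrite expr0 mul1e; apply: eq_integral => x _; congr g.
  by apply/rowP => -[].
have mga : measurable_fun setT (g \o affine a v).
  exact: (measurableT_comp mg (measurable_affine a v)).
have mgc : measurable_fun setT (g \o @cons_rV R n).
  exact: (measurableT_comp mg (@measurable_cons_rV R n)).
rewrite lebesgue_rV_integral// lebesgue_rV_integral//.
pose v' := \row_i v ord0 (lift ord0 i).
pose F z := (\int[lebesgue_rV R n]_x g (cons_rV (z, x)))%E.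
have mF : measurable_fun setT F.
  exact: (measurable_fun_fubini_tonelli_F (m2 := lebesgue_rV R n)
    (g \o @cons_rV R n) mgc (fun z => g0 _)).
have F0 z : (0 <= F z)%E by apply: integral_ge0.
have cE z x : affine a v (cons_rV (z, x)) = cons_rV (affine1 a (v ord0 ord0) z, affine a v' x).
  apply/rowP => i; rewrite !mxE /=; case: unliftP => [j ->|->] //=.
  by rewrite !mxE.
rewrite (ge0_integral_affine1 (v ord0 ord0) a0 mF F0) exprS EFinM -muleA.
congr (_ * _)%E; rewrite -ge0_integralZl//; last first.
- by rewrite lee_fin exprn_ge0// ltW.
- by move=> z _; exact: integral_ge0.
- exact: (measurable_fun_fubini_tonelli_F (m2 := lebesgue_rV R n)
    (g \o affine a v \o @cons_rV R n)
    (measurableT_comp mga (@measurable_cons_rV R n)) (fun z => g0 _)).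
apply: eq_integral => z _.
under [in RHS]eq_integral do rewrite cE.
rewrite /F (IH v' (fun x => g (cons_rV (affine1 a (v ord0 ord0) z, x))))//.
by apply: (measurableT_comp mgc); exact: measurable_pair1.
Qed.

Lemma lebesgue_rV_affine n (a : R) (v : 'rV[R]_n) (A : set 'rV[R]_n) : 0 < a ->
  measurable A ->
  (lebesgue_rV R n A = (a ^+ n)%:E * lebesgue_rV R n (affine a v @^-1` A))%E.
Proof.
move=> a0 mA; have := @ge0_integral_affine n a v (EFin \o \1_A) a0.
have mpA : measurable (affine a v @^-1` A).
  by rewrite -[X in measurable X]setTI; exact: measurable_affine.
rewrite integral_indic// setIT => ->//; last by move=> y; rewrite lee_fin.
by rewrite -[X in _ = (_ * lebesgue_rV R n X)%E]setIT -integral_indic.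
by apply/measurable_EFinP; exact: measurable_indic.
Qed.

(* No measurability is required: integrals of nonnegative functions are suprema of
   integrals of simple functions. This is what allows an uncountable supremum over
   times in the flow space. *)
Lemma lebesgue_rV_mono n (A B : set 'rV[R]_n) : A `<=` B ->
  (lebesgue_rV R n A <= lebesgue_rV R n B)%E.
Proof.
elim: n A B => [|n IH] A B AB.
  rewrite /= !diracE lee_fin ler_nat.
  by case: (boolP (_ \in A)) => //; rewrite inE => /AB/mem_set ->.
rewrite /= /lebesgue_step /pushforward /product_measure1.
have h x : (lebesgue_rV R n (xsection (@cons_rV R n @^-1` A) x) <=
            lebesgue_rV R n (xsection (@cons_rV R n @^-1` B) x))%E.
  by apply: IH => y; rewrite /xsection /= !inE; exact: AB.
rewrite !ge0_integralTE//; [|by move=> x; exact: measure_ge0..].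
apply: ge_ereal_sup => _ [s hs <-]; apply: ereal_sup_ubound; exists s => // x.
exact: le_trans (hs x) (h x).
Qed.

End affine_changes.

(** * Complex integrals *)

Section complex_integrals.
Context {R : realType}.
Local Notation C := R[i].

Section image.
Context d1 d2 (X : measurableType d1) (Y : measurableType d2)
    (m1 : {measure set X -> \bar R}) (m2 : {measure set Y -> \bar R})
    (phi : X -> Y) (c : {nonneg R}).
Hypothesis mphi : measurable_fun setT phi.
Hypothesis h : forall A, measurable A -> m2 A = (c%:num%:E * m1 (phi @^-1` A))%E.

Lemma integrable_image (f : Y -> R) : measurable_fun setT f ->
  m1.-integrable setT (EFin \o (f \o phi)) -> m2.-integrable setT (EFin \o f).
Proof.
move=> mf /integrableP[_ foo]; apply/integrableP; split; first exact/measurable_EFinP.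
rewrite (ge0_integral_image (c := c) mphi h) //; last first.
  by apply/measurable_EFinP; apply: measurableT_comp.
by rewrite lte_mul_pinfty.
Qed.

Lemma Rintegral_image (f : Y -> R) : measurable_fun setT f ->
  m1.-integrable setT (EFin \o (f \o phi)) ->
  \int[m2]_y f y = c%:num * \int[m1]_x f (phi x).
Proof.
move=> mf if1; have mEf : measurable_fun setT (EFin \o f) by exact/measurable_EFinP.
rewrite -RintegralZl// /Rintegral; congr fine.
under [in RHS]eq_integral do rewrite EFinM.
rewrite integralZl// integralE [in RHS]integralE.
rewrite (ge0_integral_image (c := c) mphi h) //; last exact: measurable_funepos.
rewrite (ge0_integral_image (c := c) mphi h) //; last exact: measurable_funeneg.
rewrite -muleBr//.
  congr (_ * (_ - _))%E; apply: eq_integral => x _.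
    by rewrite !funeposE.
  by rewrite !funenegE.
rewrite fin_num_adde_defl// fin_numN.
have := integrable_neg_fin_num measurableT if1.
by congr (_ \is a fin_num); apply: eq_integral => x _; rewrite !funenegE.
Qed.
End image.

Section fubini.
Context d1 d2 (X : measurableType d1) (Y : measurableType d2)
  (m1 : {sigma_finite_measure set X -> \bar R})
  (m2 : {sigma_finite_measure set Y -> \bar R}).
Implicit Types (f : X * Y -> R).

(** Domination by a tensor product makes every section integrable, not only almost every one, so the
    inner integrals are real numbers at every point. *)
Definition dominated f (h1 : X -> R) (h2 : Y -> R) := [/\ measurable_fun setT f,
  m1.-integrable setT (EFin \o h1), m2.-integrable setT (EFin \o h2) &
  forall z, `|f z| <= `|h1 z.1| * `|h2 z.2|].

Lemma dominated_integrable f h1 h2 : dominated f h1 h2 ->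
  (m1 \x m2)%E.-integrable setT (EFin \o f).
Proof.
move=> [mf i1 i2 fh].
have mg : measurable_fun setT (fun z : X * Y => h1 z.1 * h2 z.2).
  apply: measurable_funM.
  - apply: (measurableT_comp (f := h1)) => //.
    by apply/measurable_EFinP; exact: measurable_int i1.
  - apply: (measurableT_comp (f := h2)) => //.
    by apply/measurable_EFinP; exact: measurable_int i2.
apply: (@le_integrable _ _ _ _ setT measurableT _ (fun z => (h1 z.1 * h2 z.2)%:E)) => //.
- exact/measurable_EFinP.
- by move=> z _ /=; rewrite lee_fin normrM.
- apply/integrable12ltyP; first exact/measurable_EFinP.
  have [/integrableP[mh1 h1oo] /integrableP[mh2 h2oo]] := conj i1 i2.
  have E x : (\int[m2]_y `|(h1 (x, y).1 * h2 (x, y).2)%:E| =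
      `|h1 x|%:E * \int[m2]_y `|(EFin \o h2) y|)%E.
    under eq_integral do rewrite /= normrM EFinM.
    rewrite ge0_integralZl//; apply/measurable_EFinP; apply: measurableT_comp => //.
    exact/measurable_EFinP.
  under eq_integral do rewrite E.
  rewrite ge0_integralZr//; last 2 first.
  - apply/measurable_EFinP; apply: measurableT_comp => //; exact/measurable_EFinP.
  - by apply: integral_ge0.
  rewrite lte_mul_pinfty//; first exact: integral_ge0.
  by rewrite ge0_fin_numE//; exact: integral_ge0.
Qed.

Lemma dominated_integrable2 f h1 h2 x : dominated f h1 h2 ->
  m2.-integrable setT (EFin \o (fun y => f (x, y))).
Proof.
move=> [mf i1 i2 fh].
apply: (@le_integrable _ _ _ _ setT measurableT _ (fun y => (h1 x * h2 y)%:E)) => //.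
- apply/measurable_EFinP; apply: (measurableT_comp mf); exact: measurable_pair1.
- by move=> y _ /=; rewrite lee_fin normrM; exact: fh (x, y).
- by have := integrableZl measurableT (h1 x) i2.
Qed.

Lemma dominated_integrable1 f h1 h2 y : dominated f h1 h2 ->
  m1.-integrable setT (EFin \o (fun x => f (x, y))).
Proof.
move=> [mf i1 i2 fh].
apply: (@le_integrable _ _ _ _ setT measurableT _ (fun x => (h2 y * h1 x)%:E)) => //.
- apply/measurable_EFinP; apply: (measurableT_comp mf); exact: measurable_pair2.
- by move=> x _ /=; rewrite lee_fin mulrC normrM; exact: fh (x, y).
- by have := integrableZl measurableT (h2 y) i1.
Qed.

Lemma dominated_FE f h1 h2 x : dominated f h1 h2 ->
  fubini_F m2 (EFin \o f) x = (\int[m2]_y f (x, y))%:E.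
Proof.
move=> df; rewrite /Rintegral fineK//.
exact: integrable_fin_num (dominated_integrable2 x df).
Qed.

Lemma dominated_GE f h1 h2 y : dominated f h1 h2 ->
  fubini_G m1 (EFin \o f) y = (\int[m1]_x f (x, y))%:E.
Proof.
move=> df; rewrite /Rintegral fineK//.
exact: integrable_fin_num (dominated_integrable1 y df).
Qed.

Lemma dominated_fubini12 f h1 h2 : dominated f h1 h2 ->
  \int[(m1 \x m2)%E]_z f z = \int[m1]_x \int[m2]_y f (x, y).
Proof.
move=> df; rewrite {1}/Rintegral -(integral12_prod_meas1 (dominated_integrable df)).
by rewrite /Rintegral; congr fine; apply: eq_integral => x _; rewrite (dominated_FE _ df).
Qed.

Lemma dominated_fubini21 f h1 h2 : dominated f h1 h2 ->
  \int[(m1 \x m2)%E]_z f z = \int[m2]_y \int[m1]_x f (x, y).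
Proof.
move=> df; rewrite {1}/Rintegral -(integral21_prod_meas1 (dominated_integrable df)).
by rewrite /Rintegral; congr fine; apply: eq_integral => x _; rewrite (dominated_GE _ df).
Qed.
End fubini.

Section complex.
Context d (X : measurableType d) (mu : {measure set X -> \bar R}).
Implicit Types (g h : X -> C).

(** [Cintegral] over an arbitrary measure. For [lebesgue_rV] the two are convertible, which later
    rewrites with [-[LHS]/(cint _ _)] exploit. *)
Definition cint g : C :=
  ((\int[mu]_x complex.Re (g x)) +i* (\int[mu]_x complex.Im (g x)))%C.

Definition cmeasurable g := measurable_fun setT (fun x => complex.Re (g x)) /\
  measurable_fun setT (fun x => complex.Im (g x)).

Definition cintegrable g := mu.-integrable setT (EFin \o (fun x => complex.Re (g x))) /\
  mu.-integrable setT (EFin \o (fun x => complex.Im (g x))).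

(** Equivalent to the modulus and submultiplicative, but free of square roots: its integrability is
    that of a sum of two absolute values. *)
Definition norm1 (z : C) : R := `|complex.Re z| + `|complex.Im z|.

Lemma ReM (a b : C) : complex.Re (a * b) =
  complex.Re a * complex.Re b - complex.Im a * complex.Im b.
Proof. by case: a b => [? ?] [? ?]. Qed.

Lemma ImM (a b : C) : complex.Im (a * b) =
  complex.Re a * complex.Im b + complex.Im a * complex.Re b.
Proof. by case: a b => [? ?] [? ?]. Qed.

Lemma norm1_ge0 (z : C) : 0 <= norm1 z. Proof. exact: addr_ge0. Qed.

Lemma le_Re_norm1 (z : C) : `|complex.Re z| <= norm1 z. Proof. by rewrite lerDl. Qed.
Lemma le_Im_norm1 (z : C) : `|complex.Im z| <= norm1 z. Proof. by rewrite lerDr. Qed.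

Lemma norm1M (a b : C) : norm1 (a * b) <= norm1 a * norm1 b.
Proof.
rewrite /norm1 ReM ImM.
have := ler_normB (complex.Re a * complex.Re b) (complex.Im a * complex.Im b).
have := ler_normD (complex.Re a * complex.Im b) (complex.Im a * complex.Re b).
rewrite !normrM; lra.
Qed.

Lemma cintegrable_measurable g : cintegrable g -> cmeasurable g.
Proof. by move=> [/measurable_int/measurable_EFinP ? /measurable_int/measurable_EFinP]. Qed.

Lemma cintegrable_norm1 g : cintegrable g ->
  mu.-integrable setT (EFin \o (fun x => norm1 (g x))).
Proof.
move=> [ir ii]; have := integrableD measurableT (integrable_norm ir) (integrable_norm ii).
exact.
Qed.

Lemma cmeasurableM g h : cmeasurable g -> cmeasurable h -> cmeasurable (fun x => g x * h x).
Proof.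
move=> [mg1 mg2] [mh1 mh2]; split.
- under eq_fun do rewrite ReM.
  by apply: measurable_funB; apply: measurable_funM.
- under eq_fun do rewrite ImM.
  by apply: measurable_funD; apply: measurable_funM.
Qed.

Lemma le_cintegrable g (h : X -> R) : cmeasurable g -> mu.-integrable setT (EFin \o h) ->
  (forall x, norm1 (g x) <= `|h x|) -> cintegrable g.
Proof.
move=> [m1 m2] ih gh; split; apply: le_integrable ih => //.
- exact/measurable_EFinP.
- by move=> x _; rewrite lee_fin (le_trans _ (gh x))// le_Re_norm1.
- exact/measurable_EFinP.
- by move=> x _; rewrite lee_fin (le_trans _ (gh x))// le_Im_norm1.
Qed.

Lemma cintZ (a : C) g : cintegrable g -> cint (fun x => a * g x) = a * cint g.
Proof.
move=> [ir ii]; apply/eqP; rewrite eq_complex; apply/andP; split; apply/eqP.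
- rewrite ReM /cint /=; under eq_Rintegral do rewrite ReM.
  rewrite RintegralB//; [|by have := integrableZl measurableT (complex.Re a) ir|
    by have := integrableZl measurableT (complex.Im a) ii].
  by rewrite !RintegralZl.
- rewrite ImM /cint /=; under eq_Rintegral do rewrite ImM.
  rewrite RintegralD//; [|by have := integrableZl measurableT (complex.Re a) ii|
    by have := integrableZl measurableT (complex.Im a) ir].
  by rewrite !RintegralZl.
Qed.

Lemma cintZr (a : C) g : cintegrable g -> cint (fun x => g x * a) = cint g * a.
Proof.
by move=> ig; rewrite mulrC -cintZ//; congr cint; apply/funext => x; rewrite mulrC.
Qed.
End complex.

End complex_integrals.

(** * Fubini, tensor products and changes of variables for complex integrals *)

Section complex_fubini.
Context {R : realType}.
Local Notation C := R[i].
Local Notation mu := (@lebesgue_measure R).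

Section product.
Context d1 d2 (X : measurableType d1) (Y : measurableType d2)
  (m1 : {sigma_finite_measure set X -> \bar R})
  (m2 : {sigma_finite_measure set Y -> \bar R}).
Variables (F : X * Y -> C) (h1 : X -> R) (h2 : Y -> R).
Hypothesis mF : cmeasurable F.
Hypothesis i1 : m1.-integrable setT (EFin \o h1).
Hypothesis i2 : m2.-integrable setT (EFin \o h2).
Hypothesis Fh : forall z, norm1 (F z) <= `|h1 z.1| * `|h2 z.2|.

Let dRe : dominated m1 m2 (fun z => complex.Re (F z)) h1 h2.
Proof. by split => //; [exact: mF.1|move=> z; exact: le_trans (le_Re_norm1 _) (Fh z)]. Qed.

Let dIm : dominated m1 m2 (fun z => complex.Im (F z)) h1 h2.
Proof. by split => //; [exact: mF.2|move=> z; exact: le_trans (le_Im_norm1 _) (Fh z)]. Qed.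

Lemma cintegrable_prod : cintegrable (m1 \x m2)%E F.
Proof. by split; [exact: (dominated_integrable dRe)|exact: (dominated_integrable dIm)]. Qed.

Lemma cint_prod12 : cint (m1 \x m2)%E F = cint m1 (fun x => cint m2 (fun y => F (x, y))).
Proof. by rewrite /cint (dominated_fubini12 dRe) (dominated_fubini12 dIm). Qed.

Lemma cint_prod21 : cint (m1 \x m2)%E F = cint m2 (fun y => cint m1 (fun x => F (x, y))).
Proof. by rewrite /cint (dominated_fubini21 dRe) (dominated_fubini21 dIm). Qed.
End product.

Lemma cmeasurable_comp d1 d2 (X : measurableType d1) (Y : measurableType d2)
    (phi : X -> Y) (g : Y -> C) : measurable_fun setT phi -> cmeasurable g ->
  cmeasurable (g \o phi).
Proof.
by move=> mphi [m1 m2]; split; [exact: measurableT_comp m1 mphi|exact: measurableT_comp m2 mphi].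
Qed.

Lemma cint_image d1 d2 (X : measurableType d1) (Y : measurableType d2)
    (m1 : {measure set X -> \bar R}) (m2 : {measure set Y -> \bar R})
    (phi : X -> Y) (c : {nonneg R}) (g : Y -> C) :
  measurable_fun setT phi ->
  (forall A, measurable A -> m2 A = (c%:num%:E * m1 (phi @^-1` A))%E) ->
  cmeasurable g -> cintegrable m1 (g \o phi) ->
  cintegrable m2 g /\ cint m2 g = (c%:num)%:C%C * cint m1 (g \o phi).
Proof.
move=> mphi h [mg1 mg2] [ig1 ig2]; split.
  by split; [exact: (integrable_image mphi h mg1 ig1)|exact: (integrable_image mphi h mg2 ig2)].
rewrite /cint (Rintegral_image mphi h mg1 ig1) (Rintegral_image mphi h mg2 ig2) /=.
by apply/eqP; rewrite eq_complex /= !mul0r subr0 addr0 !eqxx.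
Qed.

Lemma cintegrable_tensor2 d1 d2 (X : measurableType d1) (Y : measurableType d2)
  (m1 : {sigma_finite_measure set X -> \bar R})
  (m2 : {sigma_finite_measure set Y -> \bar R}) (f : X -> C) (g : Y -> C) :
  cintegrable m1 f -> cintegrable m2 g ->
  cintegrable (m1 \x m2)%E (fun z => f z.1 * g z.2) /\
  cint (m1 \x m2)%E (fun z => f z.1 * g z.2) = cint m1 f * cint m2 g.
Proof.
move=> iif iig.
have mF : cmeasurable (fun z : X * Y => f z.1 * g z.2).
  apply: (@cmeasurableM _ _ _ (f \o fst) (g \o snd)).
  - by apply: cmeasurable_comp => //; exact: cintegrable_measurable iif.
  - by apply: cmeasurable_comp => //; exact: cintegrable_measurable iig.
have n1 := cintegrable_norm1 iif; have n2 := cintegrable_norm1 iig.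
have dom (z : X * Y) : norm1 (f z.1 * g z.2) <= `|norm1 (f z.1)| * `|norm1 (g z.2)|.
  by rewrite !ger0_norm ?norm1_ge0//; exact: norm1M.
split; first exact: (cintegrable_prod mF n1 n2 dom).
rewrite (cint_prod12 mF n1 n2 dom) -cintZr//; congr cint.
by apply/funext => x /=; rewrite cintZ.
Qed.

Lemma cint_rV_cons n (g : 'rV[R]_n.+1 -> C) : cmeasurable g ->
  cintegrable (mu \x lebesgue_rV R n)%E (g \o @cons_rV R n) ->
  cintegrable (lebesgue_rV R n.+1) g /\
  cint (lebesgue_rV R n.+1) g = cint (mu \x lebesgue_rV R n)%E (g \o @cons_rV R n).
Proof.
move=> mg ig.
have := @cint_image _ _ _ _ (mu \x lebesgue_rV R n)%E (lebesgue_rV R n.+1)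
  (@cons_rV R n) (NngNum (@ler01 R)) g (@measurable_cons_rV R n).
rewrite mul1r; apply => //.
by move=> A mA; rewrite mul1e.
Qed.

Lemma cmeasurable_coord n (i : 'I_n) (g : R -> C) : cmeasurable (g : measurableTypeR R -> C) ->
  cmeasurable (fun x : 'rV[R]_n => g (x ord0 i)).
Proof. by move=> mg; apply: (cmeasurable_comp (measurable_coord i) mg). Qed.

Lemma cmeasurable_cst d (X : measurableType d) (a : C) : cmeasurable (fun _ : X => a).
Proof. by split. Qed.

Lemma cmeasurable_prod d (X : measurableType d) (I : Type) (s : seq I) (F : I -> X -> C) :
  (forall i, cmeasurable (F i)) -> cmeasurable (fun x => \prod_(i <- s) F i x).
Proof.
move=> mF; elim: s => [|i s IH].
  by under eq_fun do rewrite big_nil; exact: cmeasurable_cst.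
by under eq_fun do rewrite big_cons; exact: cmeasurableM.
Qed.

Lemma cmeasurable_tensor n (g : 'I_n -> measurableTypeR R -> C) :
  (forall i, cmeasurable (g i)) ->
  cmeasurable (fun x : 'rV[R]_n => \prod_i g i (x ord0 i)).
Proof. by move=> mg; apply: cmeasurable_prod => i; exact: cmeasurable_coord. Qed.

Lemma cint_rV0 (g : 'rV[R]_0 -> C) :
  cintegrable (lebesgue_rV R 0) g /\ cint (lebesgue_rV R 0) g = g 0.
Proof.
have gE : g = (fun=> g 0) by apply/funext => x; congr g; apply/rowP => -[].
rewrite gE; split; first split.
- apply/integrableP; split; first exact: measurable_cst.
  by rewrite /= integral_dirac// diracT mul1e ltry.
- apply/integrableP; split; first exact: measurable_cst.
  by rewrite /= integral_dirac// diracT mul1e ltry.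
rewrite /cint /Rintegral /= !integral_dirac// diracT !mul1e /=.
by case: (g 0).
Qed.

Lemma cint_tensor n (g : 'I_n -> measurableTypeR R -> C) :
  (forall i, cintegrable mu (g i)) ->
  cintegrable (lebesgue_rV R n) (fun x : 'rV[R]_n => \prod_i g i (x ord0 i)) /\
  cint (lebesgue_rV R n) (fun x : 'rV[R]_n => \prod_i g i (x ord0 i)) =
    \prod_i cint mu (g i).
Proof.
elim: n g => [|n IH] g ig.
  have [h1 h2] := cint_rV0 (fun x : 'rV[R]_0 => \prod_i g i (x ord0 i)).
  by split => //; rewrite h2 !big_ord0.
have [it et] := IH (fun i => g (lift ord0 i)) (fun i => ig _).
have [i2 e2] := cintegrable_tensor2 (ig ord0) it.
have cE : (fun x : 'rV[R]_n.+1 => \prod_i g i (x ord0 i)) \o @cons_rV R n =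
    (fun z => g ord0 z.1 * \prod_i g (lift ord0 i) (z.2 ord0 i)).
  apply/funext => -[z y] /=; rewrite big_ord_recl /= mxE unlift_none; congr (_ * _).
  by apply: eq_bigr => i _; rewrite mxE liftK.
have mg : cmeasurable (fun x : 'rV[R]_n.+1 => \prod_i g i (x ord0 i)).
  by apply: cmeasurable_tensor => i; exact: cintegrable_measurable (ig i).
have [] := cint_rV_cons mg; first by rewrite cE.
move=> h1 h2; split => //; rewrite h2 cE e2 et.
by rewrite [RHS]big_ord_recl.
Qed.

Lemma cint_affine n (a : R) (v : 'rV[R]_n) (g : 'rV[R]_n -> C) : 0 < a ->
  cmeasurable g -> cintegrable (lebesgue_rV R n) (g \o affine a v) ->
  cintegrable (lebesgue_rV R n) g /\
  cint (lebesgue_rV R n) g = (a ^+ n)%:C%C * cint (lebesgue_rV R n) (g \o affine a v).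
Proof.
move=> a0 mg ig; have an : 0 <= a ^+ n by rewrite exprn_ge0// ltW.
have := @cint_image _ _ _ _ (lebesgue_rV R n) (lebesgue_rV R n) (affine a v)
  (NngNum an) g (measurable_affine a v).
by apply => // A mA; exact: lebesgue_rV_affine.
Qed.

End complex_fubini.

(** * Schwartz functions and Fourier transforms *)

Section schwartz_functions.
Context {R : realType}.
Local Notation C := R[i].
Local Notation mu := (@lebesgue_measure R).

(** [B] is a union of fibres of [K], and there are only countably many of them. *)
Lemma measurable_saturated d (X : measurableType d) (T : countType) (K : X -> T) (B : set X) :
  (forall k, measurable (K @^-1` [set k])) ->
  (forall x y, K x = K y -> B x -> B y) -> measurable B.
Proof.
move=> mK hB.
have -> : B = \bigcup_m (if pselect (exists x, B x /\ pickle (K x) = m) then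
    [set x | pickle (K x) = m] else set0).
  apply/seteqP; split => [x Bx|x [m _]].
    exists (pickle (K x)) => //; case: pselect => //= h; exfalso; apply: h.
    by exists x.
  case: pselect => //= -[y [By ym]] xm; apply: (hB y) => //.
  by apply: (pcan_inj pickleK); rewrite ym xm.
apply: bigcup_measurable => m _; case: pselect => //= -[y [By <-]].
rewrite (_ : [set x | _] = K @^-1` [set K y])//.
by apply/seteqP; split => x /=; [move/(pcan_inj pickleK)|move=> ->].
Qed.

Lemma measurable_floor_coord n (i : 'I_n) (a : R) (k : int) :
  measurable [set x : 'rV[R]_n | Num.floor (a * x ord0 i) = k].
Proof.
have mf : measurable_fun setT (fun y : measurableTypeR R => a * y).
  exact: measurable_funM.
rewrite (_ : [set x | _] = (fun x : 'rV[R]_n => a * (x ord0 i)) @^-1` `[k%:~R, (k + 1)%:~R[).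
  rewrite -[X in measurable X]setTI.
  exact: (measurableT_comp mf (@measurable_coord R n i)).
apply/seteqP; split => x /=; rewrite in_itv/=.
  by move=> <-; rewrite floor_le_tmp floorD1_gt.
by move=> h; apply/floor_def.
Qed.

Lemma measurable_floor_row n (a : R) (k : 'rV[int]_n) :
  measurable ((fun x : 'rV[R]_n => map_mx (fun y => Num.floor (a * y)) x) @^-1` [set k]).
Proof.
rewrite (_ : _ @^-1` _ = \bigcap_(i in [set: 'I_n])
    [set x : 'rV[R]_n | Num.floor (a * x ord0 i) = k ord0 i]).
  apply: fin_bigcap_measurable => // i _; exact: measurable_floor_coord.
apply/seteqP; split => x /=.
  by move=> <- i _; rewrite /= mxE.
by move=> h; apply/rowP => i; rewrite mxE; exact: h.
Qed.

(** The measurable structure is generated by the coordinates, not by the open sets. So [u] is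
    written as the pointwise limit of its values at points rounded down to a grid of mesh $1/(m+1)$;
    each approximation factors through a countable set. *)
Lemma continuous_measurable_rV n (u : 'rV[R]_n -> R) : continuous u ->
  measurable_fun setT u.
Proof.
move=> cu.
pose K m x : 'rV[int]_n := map_mx (fun y : R => Num.floor (m.+1%:R * y)) x.
pose g m (x : 'rV[R]_n) : 'rV[R]_n := map_mx (fun z : int => z%:~R / m.+1%:R) (K m x).
have cvg_g x : g m x @[m --> \oo] --> x.
  apply/cvgrPdist_le => e e0; exists (Num.truncn (e^-1)) => // m /= em.
  rewrite /Num.norm /= mx_normrE; apply: bigmax_le => [|[i j] _]; first exact: ltW.
  rewrite !mxE /= ord1.
  have m0 : 0 < m.+1%:R :> R by [].
  set y := x ord0 j.
  have -> : y - (Num.floor (m.+1%:R * y))%:~R / m.+1%:R =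
      (m.+1%:R * y - (Num.floor (m.+1%:R * y))%:~R) / m.+1%:R by field; rewrite gt_eqF.
  rewrite normrM normfV (gtr0_norm m0) ler_pdivrMr//.
  rewrite ger0_norm ?subr_ge0 ?floor_le_tmp// lerBlDr.
  apply: (le_trans (ltW (floorD1_gt _))); rewrite intrD addrC lerD2r.
  rewrite mulrC -ler_pdivrMr// mul1r (le_trans (ltW (truncnS_gt _)))// ler_nat.
  by rewrite ltnS.
apply: (measurable_fun_cvg (h := fun m x => u (g m x))) => //.
  move=> m _ Y mY; rewrite setTI; apply: (@measurable_saturated _ _ _ (K m)).
    by move=> k; exact: measurable_floor_row.
  by move=> x y; rewrite /preimage /= /g => ->.
by move=> x _; exact: cvg_comp (cvg_g x) (cu x).
Qed.

Lemma normc_Re (z : C) : `|complex.Re z| <= Normc.normc z.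
Proof.
case: z => a b /=; rewrite -sqrtr_sqr ler_wsqrtr// lerDl; exact: sqr_ge0.
Qed.

Lemma normc_Im (z : C) : `|complex.Im z| <= Normc.normc z.
Proof.
case: z => a b /=; rewrite -sqrtr_sqr ler_wsqrtr// lerDr; exact: sqr_ge0.
Qed.

Lemma norm1_le (z : C) : norm1 z <= 2 * Normc.normc z.
Proof. rewrite /norm1; have := normc_Re z; have := normc_Im z; lra. Qed.

Lemma schwartz_bound n (g : 'rV[R]_n -> C) N : schwartz g ->
  exists K, forall x, (1 + `|x|) ^+ N * Normc.normc (g x) <= K.
Proof.
move=> [_ /(_ N) goo]; exists (fine (seminorm N g)) => x.
rewrite -lee_fin fineK.
  by apply: ereal_sup_ubound; exists [::], x.
rewrite ge0_fin_numE//; apply: le_trans (_ : ((1 + `|0 : 'rV[R]_n|) ^+ N *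
    Normc.normc (g 0))%:E <= _)%E.
  rewrite lee_fin mulr_ge0// ?exprn_ge0 ?addr_ge0//.
  by case: (g 0) => a b /=; exact: sqrtr_ge0.
by apply: ereal_sup_ubound; exists [::], 0.
Qed.

Lemma schwartz_measurable n (g : 'rV[R]_n -> C) : schwartz g -> cmeasurable g.
Proof.
move=> [sg _]; split; apply: continuous_measurable_rV => x.
- by apply: differentiable_continuous; have [] := sg [::] x.
- by apply: differentiable_continuous; have [] := sg [::] x.
Qed.

Lemma cintegrable_real d (X : measurableType d) (nu : {measure set X -> \bar R})
    (f : X -> R) : nu.-integrable setT (EFin \o f) ->
  cintegrable nu (fun x => (f x)%:C%C).
Proof. by move=> ig; split => //=; exact: integrable0. Qed.

Lemma prod_realC (I : Type) (s : seq I) (f : I -> R) :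
  \prod_(i <- s) (f i)%:C%C = (\prod_(i <- s) f i)%:C%C.
Proof. by rewrite rmorph_prod. Qed.

Lemma integrable_tensor n (f : 'I_n -> measurableTypeR R -> R) :
  (forall i, mu.-integrable setT (EFin \o f i)) ->
  (lebesgue_rV R n).-integrable setT (EFin \o (fun x : 'rV[R]_n => \prod_i f i (x ord0 i))).
Proof.
move=> hf; have [] := @cint_tensor R n (fun i y => (f i y)%:C%C).
  by move=> i; exact: cintegrable_real.
by move=> [+ _] _; under eq_fun do rewrite prod_realC.
Qed.

Lemma schwartz_cintegrable n (g : 'rV[R]_n -> C) : schwartz g ->
  cintegrable (lebesgue_rV R n) g.
Proof.
(* Two powers for each coordinate: $(1+|x|)^{2n}$ dominates the product of the $1+x_i^2$. *)
move=> sg; have [K hK] := schwartz_bound (2 * n) sg.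
have it := integrable_tensor (fun i : 'I_n => @integrable_oneDsqrV R).
have it2 := integrableZl measurableT (2 * K) it.
apply: (@le_cintegrable R _ _ (lebesgue_rV R n) g
  (fun x => 2 * K * \prod_(i < n) (oneDsqr (x ord0 i))^-1)
  (schwartz_measurable sg) it2).
move=> x; rewrite ger0_norm; last first.
  rewrite mulr_ge0//.
    rewrite mulr_ge0//; apply: le_trans (hK 0); rewrite mulr_ge0 ?exprn_ge0 ?addr_ge0//.
    by case: (g 0) => a b /=; exact: sqrtr_ge0.
  by apply: prodr_ge0 => i _; rewrite invr_ge0 (le_trans ler01)// oneDsqr_ge1.
apply: (le_trans (norm1_le _)); rewrite -mulrA ler_pM2l//.
rewrite prodfV ler_pdivlMr; last first.
  by apply: prodr_gt0 => i _; rewrite (lt_le_trans ltr01)// oneDsqr_ge1.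
apply: le_trans (hK x); rewrite mulrC ler_wpM2r//.
  by case: (g x) => a b /=; exact: sqrtr_ge0.
have -> : (1 + `|x|) ^+ (2 * n) = \prod_(i < n) (1 + `|x|) ^+ 2.
  by rewrite prodr_const card_ord exprM.
apply: ler_prod => i _.
rewrite (le_trans ler01) ?oneDsqr_ge1//= /oneDsqr.
have : `|x ord0 i| <= `|x|.
  by rewrite [leRHS]mx_normrE; apply: (le_bigmax _ (fun ij => `|x ij.1 ij.2|) (ord0, i)).
rewrite -(real_normK (num_real (x ord0 i))).
have := normr_ge0 (x ord0 i); nra.
Qed.

End schwartz_functions.

(** * The multiplication formula and affine changes of variable *)

Section fourier_transforms.
Context {R : realType}.
Local Notation C := R[i].

Lemma expiD (a b : R) : expi (a + b) = expi a * expi b.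
Proof.
apply/eqP; rewrite eq_complex ReM ImM /= cosD sinD; apply/andP; split => //.
by rewrite addrC.
Qed.

Lemma expi0 : expi (0 : R) = 1.
Proof. by rewrite /expi cos0 sin0. Qed.

Lemma expi_sum (I : Type) (s : seq I) (f : I -> R) :
  expi (\sum_(i <- s) f i) = \prod_(i <- s) expi (f i).
Proof.
elim: s => [|i s IH]; first by rewrite !big_nil expi0.
by rewrite !big_cons expiD IH.
Qed.

Lemma norm1_expi (t : R) : norm1 (expi t) <= 2.
Proof. by rewrite /norm1 /=; have := cos_max t; have := sin_max t; lra. Qed.

Lemma cmeasurable_expi d (X : measurableType d) (f : X -> R) :
  measurable_fun setT f -> cmeasurable (fun x => expi (f x)).
Proof.
move=> mf; split; rewrite /=.
- apply: (measurableT_comp (f := @cos R)) => //.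
  by apply: continuous_measurable_fun; exact: continuous_cos.
- apply: (measurableT_comp (f := @sin R)) => //.
  by apply: continuous_measurable_fun; exact: continuous_sin.
Qed.

Lemma cintegrableM_bounded d (X : measurableType d) (nu : {measure set X -> \bar R})
    (g h : X -> C) (B : R) : cintegrable nu g -> cmeasurable h ->
  (forall x, norm1 (h x) <= B) -> cintegrable nu (fun x => g x * h x).
Proof.
move=> ig mh hB; have mg := cintegrable_measurable ig.
have ib := integrableZl measurableT B (cintegrable_norm1 ig).
apply: (@le_cintegrable R _ _ nu _ (fun x => B * norm1 (g x)) (cmeasurableM mg mh) ib).
move=> x; rewrite (le_trans (norm1M _ _))// mulrC.
by rewrite (le_trans (ler_wpM2r (norm1_ge0 _) (hB x)))// ler_norm.
Qed.

Lemma measurable_dot d (X : measurableType d) n (f g : X -> 'rV[R]_n) :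
  measurable_fun setT f -> measurable_fun setT g ->
  measurable_fun setT (fun x => dot (f x) (g x)).
Proof.
move=> mf mg; apply: measurable_sum => i; apply: measurable_funM.
- exact: (measurableT_comp (@measurable_coord R n i) mf).
- exact: (measurableT_comp (@measurable_coord R n i) mg).
Qed.

Lemma cintegrable_fourier n (g : 'rV[R]_n -> C) xi : cintegrable (lebesgue_rV R n) g ->
  cintegrable (lebesgue_rV R n) (fun x => g x * expi (- dot x xi)).
Proof.
move=> ig; apply: cintegrableM_bounded ig _ (fun x => norm1_expi _).
apply: cmeasurable_expi; apply: measurableT_comp => //.
by apply: measurable_dot => //; exact: measurable_cst.
Qed.

Lemma dotC n (x y : 'rV[R]_n) : dot x y = dot y x.
Proof. by apply: eq_bigr => i _; rewrite mulrC. Qed.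

(** The kernel $e^{-ix\cdot y}$ is symmetric and bounded, so $w(x)G(y)e^{-ix\cdot y}$ may be
    integrated in either order. *)
Lemma Cintegral_fourier n (w G : 'rV[R]_n -> C) :
  cintegrable (lebesgue_rV R n) w -> cintegrable (lebesgue_rV R n) G ->
  Cintegral (fun x => w x * fourier G x) = Cintegral (fun xi => fourier w xi * G xi).
Proof.
move=> iw iG.
pose F (z : 'rV[R]_n * 'rV[R]_n) := w z.1 * G z.2 * expi (- dot z.2 z.1).
have mF : cmeasurable F.
  apply: cmeasurableM; first apply: (@cmeasurableM _ _ _ (w \o fst) (G \o snd)).
  - by apply: cmeasurable_comp => //; exact: cintegrable_measurable iw.
  - by apply: cmeasurable_comp => //; exact: cintegrable_measurable iG.
  - apply: cmeasurable_expi; apply: measurableT_comp => //.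
    by apply: measurable_dot.
have n1 := cintegrable_norm1 iw.
have n2 : (lebesgue_rV R n).-integrable setT (EFin \o (fun x => 2 * norm1 (G x))).
  by have := integrableZl measurableT 2 (cintegrable_norm1 iG).
have dom z : norm1 (F z) <= `|norm1 (w z.1)| * `|2 * norm1 (G z.2)|.
  rewrite normrM !ger0_norm ?norm1_ge0// mulrCA mulrC.
  apply: (le_trans (norm1M _ _)); apply: ler_pM; rewrite ?norm1_ge0//.
  - exact: norm1M.
  - exact: norm1_expi.
have := cint_prod12 mF n1 n2 dom; rewrite (cint_prod21 mF n1 n2 dom) => E.
transitivity (cint (lebesgue_rV R n)
    (fun x => cint (lebesgue_rV R n) (fun y => F (x, y)))).
  rewrite -[LHS]/(cint (lebesgue_rV R n) _); congr cint; apply/funext => x.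
  rewrite -[fourier G x]/(cint (lebesgue_rV R n) _) -cintZ; last exact: cintegrable_fourier.
  by congr cint; apply/funext => y; rewrite mulrA.
rewrite -E -[RHS]/(cint (lebesgue_rV R n) _); congr cint; apply/funext => y.
rewrite -[fourier w y]/(cint (lebesgue_rV R n) _) -cintZr; last exact: cintegrable_fourier.
by congr cint; apply/funext => x; rewrite /F /= dotC mulrAC.
Qed.

Lemma cintegrable_affine n (a : R) v (g : 'rV[R]_n -> C) : 0 < a ->
  cintegrable (lebesgue_rV R n) g -> cintegrable (lebesgue_rV R n) (g \o affine a v).
Proof.
move=> a0 ig.
have mg : cmeasurable (g \o affine a v).
  by apply: cmeasurable_comp; [exact: measurable_affine|exact: cintegrable_measurable ig].
(* Pulling back along the inverse affine map recovers [g], so the change of variables is applied in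
   the opposite direction. *)
have [] := @cint_affine R n a^-1 (- (a^-1 *: v)) _ _ mg => //; first by rewrite invr_gt0.
rewrite (_ : _ \o _ = g)//; apply/funext => x /=; congr g.
by rewrite /affine scalerBr !scalerA mulfV ?gt_eqF// !scale1r subrK.
Qed.

Lemma fourier_affine n (a : R) (v : 'rV[R]_n) (g : 'rV[R]_n -> C) xi : 0 < a ->
  cintegrable (lebesgue_rV R n) g ->
  fourier (fun x => g (a *: x + v)) xi =
  (a ^- n)%:C%C * expi (a^-1 * dot v xi) * fourier g (a^-1 *: xi).
Proof.
move=> a0 ig; have ag := cintegrable_affine v a0 ig.
have if1 := cintegrable_fourier (a^-1 *: xi) ig.
have := @cint_affine R n a v _ a0 (cintegrable_measurable if1) (cintegrable_affine v a0 if1).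
move=> [_]; rewrite -[cint _ _]/(fourier g _) => ->.
rewrite mulrACA mulrA -rmorphM /= mulVf ?mul1r; last by rewrite expf_neq0// gt_eqF.
rewrite -cintZ; last exact: cintegrable_affine.
rewrite -[LHS]/(cint (lebesgue_rV R n) _); congr cint; apply/funext => x.
rewrite /= /affine mulrCA -expiD; congr (_ * expi _).
rewrite /dot !mulr_sumr -!sumrN -big_split /=; apply: eq_bigr => i _.
by rewrite !mxE; field; rewrite gt_eqF.
Qed.

End fourier_transforms.

(** * Tensor products of rapidly decreasing functions are Schwartz *)

Section schwartz_tensors.
Context {R : realType} (n : nat).
Local Notation C := R[i].
Local Notation V := 'rV[R]_n.
Variables (c : R) (D : 'I_n -> nat -> R -> R).
Hypothesis dD : forall i k x, is_derive x (1:R) (D i k) (D i k.+1 x).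
Hypothesis rD : forall i k, rapid (D i k).

(** [a] is a multi-index: coordinate [i] carries the derivative of order [a i]. The family is
    thereby closed under partial derivatives. *)
Definition tensor (a : 'I_n -> nat) (x : V) : R := c * \prod_i D i (a i) (x ord0 i).

Definition incr (i : 'I_n) (a : 'I_n -> nat) (j : 'I_n) := ((j == i) + a j)%N.

Lemma derive_line (F : V -> R) (v x : V) :
  'D_v F x = derive1 (fun t : R => F (t *: v + x)) 0.
Proof.
rewrite /derive /derive1.
by under [in RHS]eq_fun do rewrite addr0 scale0r add0r.
Qed.

Lemma derive_tensor a i (x : V) : 'D_(delta_mx ord0 i) (tensor a) x = tensor (incr i a) x.
Proof.
rewrite derive_line.
pose P := \prod_(j | j != i) D j (a j) (x ord0 j).
rewrite (_ : (fun t => _) = (fun t => c * (D i (a i) (t + x ord0 i) * P))); last first.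
  apply/funext => t; rewrite /tensor (bigD1 i)//= !mxE !eqxx mulr1; congr (_ * (_ * _)).
  by apply: eq_bigr => j ji; rewrite !mxE (negPf ji) andbF mulr0 add0r.
have d0 : is_derive (0:R) (1:R) (fun t => D i (a i) (t + x ord0 i)) (D i (a i).+1 (x ord0 i)).
  by rewrite -[X in D i _ X]add0r; apply: is_derive_comp_shift.
have := is_derive_mulf (is_derive_cstf c 0) (is_derive_mulf d0 (is_derive_cstf P 0)).
rewrite derive1E => -[_ ->]; rewrite mul0r add0r mulr0 addr0.
rewrite /tensor [in RHS](bigD1 i)//= /incr eqxx add1n; congr (_ * (_ * _)).
by apply: eq_bigr => j ji; rewrite (negPf ji).
Qed.

Lemma partials_tensor s : exists2 a : 'I_n -> nat, (forall i, (a i <= size s)%N) &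
  partials s (fun x => (tensor (fun=> 0%N) x)%:C%C) = (fun x => (tensor a x)%:C%C).
Proof.
elim: s => [|i s [a sa E]]; first by exists (fun=> 0%N).
exists (incr i a).
  move=> j; rewrite /incr /=; have := sa j; case: (j == i) => /=; first by rewrite ltnS.
  by move/leq_trans; apply; rewrite leqnSn.
rewrite /= E; apply/funext => x; rewrite /partial /= derive_tensor.
by rewrite (_ : 'D_(delta_mx ord0 i) _ x = 0)//; exact: derive_cst.
Qed.

Lemma coord_differentiable (i : 'I_n) (x : V) : differentiable (fun y : V => y ord0 i : R^o) x.
Proof. exact: differentiable_coord. Qed.

Lemma differentiable_prod (I : Type) (s : seq I) (F : I -> V -> R) (x : V) :
  (forall i, differentiable (F i : V -> R^o) x) ->
  differentiable ((fun y => \prod_(i <- s) F i y) : V -> R^o) x.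
Proof.
move=> dF; elim: s => [|i s IH].
  by under eq_fun do rewrite big_nil; exact: differentiable_cst.
under eq_fun do rewrite big_cons.
exact: (differentiableM (dF i) IH).
Qed.

Lemma differentiable_tensor a (x : V) : differentiable (tensor a : V -> R^o) x.
Proof.
apply: (@differentiableM _ _ (fun=> c) _ x); first exact: differentiable_cst.
apply: differentiable_prod => i.
apply: (@differentiable_comp _ _ _ _ (fun y : V => y ord0 i : R^o) (D i (a i))).
  exact: coord_differentiable.
by apply/derivable1_diffP; have [] := dD i (a i) (x ord0 i).
Qed.

Lemma rapid_bound N : exists2 M : 'I_n -> R, (forall i, 0 <= M i) &
  forall i k x, (k <= N)%N -> (1 + `|x|) ^+ N * `|D i k x| <= M i.
Proof.
have h i : exists m : R, 0 <= m /\
    forall k x, (k <= N)%N -> (1 + `|x|) ^+ N * `|D i k x| <= m.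
  elim: {1}N => [|N' [m [m0 hm]]].
    have [K hK] := rD i 0 N; exists K; split.
      by apply: le_trans (hK 0); rewrite mulr_ge0// exprn_ge0// addr_ge0.
    by move=> k x; rewrite leqn0 => /eqP ->.
  have [K hK] := rD i N'.+1 N; exists (Num.max m K); split; first by rewrite le_max m0.
  move=> k x; rewrite leq_eqVlt => /orP[/eqP ->|]; rewrite le_max; first by rewrite hK orbT.
  by rewrite ltnS => kN; rewrite hm.
have [M hM] := choice h.
by exists M => [i|i k x kN]; [case: (hM i)|case: (hM i) => _; apply].
Qed.

(** Lets a weight in the norm of [x] be distributed over the one-dimensional factors. *)
Lemma norm_prod (x : V) : 1 + `|x| <= \prod_i (1 + `|x ord0 i|).
Proof.
have P1 (Q : pred 'I_n) : 1 <= \prod_(i | Q i) (1 + `|x ord0 i|).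
  apply: (@le_trans _ _ (\prod_(i < n | Q i) (1 : R))); first by rewrite big1.
  by apply: ler_prod => i _; rewrite ler01 lerDl/=.
rewrite -lerBrDl {1}/Num.norm /= mx_normrE; apply: bigmax_le.
  by rewrite subr_ge0 P1.
move=> [i j] _ /=; rewrite ord1 lerBrDl (bigD1 j)//=.
by rewrite ler_peMr// addr_ge0.
Qed.

Lemma schwartz_tensor : schwartz (fun x : V => (tensor (fun=> 0%N) x)%:C%C).
Proof.
split.
  move=> s x; have [a _ ->] := partials_tensor s; rewrite /=; split.
    exact: differentiable_tensor.
  exact: differentiable_cst.
move=> N; have [M M0 hM] := rapid_bound N.
apply: (@le_lt_trans _ _ (`|c| * \prod_i M i)%:E); last exact: ltry.
apply: ge_ereal_sup => _ [s [x [sN ->]]]; rewrite lee_fin.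
have [a sa ->] := partials_tensor s.
have -> : Normc.normc (tensor a x)%:C%C = `|tensor a x|.
  by rewrite /= expr0n addr0 sqrtr_sqr.
rewrite /tensor normrM mulrCA ler_wpM2l// normr_prod.
apply: (@le_trans _ _ (\prod_i ((1 + `|x ord0 i|) ^+ N * `|D i (a i) (x ord0 i)|))).
  rewrite big_split /= ler_wpM2r//; first by apply: prodr_ge0.
  by rewrite prodrXl lerXn2r ?nnegrE ?norm_prod ?addr_ge0 ?prodr_ge0// => i _; rewrite addr_ge0.
apply: ler_prod => i _; rewrite mulr_ge0 ?exprn_ge0 ?addr_ge0//=.
by apply: hM; exact: leq_trans (sa i) sN.
Qed.

End schwartz_tensors.

(** * Wave packets *)

Section wave_packets.
Context {R : realType}.
Local Notation C := R[i].
Local Notation mu := (@lebesgue_measure R).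

Definition even (u : R -> R) := forall x, u (- x) = u x.

Lemma lebesgue_opp (A : set (measurableTypeR R)) : measurable A ->
  mu A = mu ((fun x : measurableTypeR R => (- x : measurableTypeR R)) @^-1` A).
Proof.
move=> mA.
have mN : measurable_fun setT (fun x : measurableTypeR R => (- x : measurableTypeR R)).
  exact: oppr_measurable.
pose push : {measure set (measurableTypeR R) -> \bar R} :=
  measure_function_pushforward__canonical__measure_function_Measure mu mN.
apply: (@lebesgue_measure_unique R push) => // _ [[c d] _ <-] /=.
rewrite /pushforward.
have -> : (fun x : measurableTypeR R => (- x : measurableTypeR R)) @^-1` `]c, d] =
    `[(- d), (- c)[%classic.
  by apply/seteqP; split => x /=; rewrite !in_itv/= lerNl ltrNr => /andP[-> ->].
rewrite !lebesgue_measure_itv/= !lte_fin ltrN2.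
by case: ifPn => // _; rewrite -!EFinD opprK addrC.
Qed.

Lemma Is_even u b : bump u -> even u -> Is u b = 0.
Proof.
move=> bu eu.
have mN : measurable_fun setT (fun x : measurableTypeR R => (- x : measurableTypeR R)).
  exact: oppr_measurable.
have iu := bump_integrableM (@continuous_sinM R b) bu.
have miu : measurable_fun setT (fun x => sin (b * x) * u x).
  by apply/measurable_EFinP; exact: measurable_int iu.
have E : (fun x => sin (b * x) * u x) \o -%R = (fun x => - (sin (b * x) * u x)).
  by apply/funext => x /=; rewrite eu mulrN sinN mulNr.
have iN : mu.-integrable setT (EFin \o (fun x => - (sin (b * x) * u x))).
  have := integrableZl measurableT (-1) iu.
  by congr (is_true (integrable _ _ _)); apply/funext => x; rewrite /= -EFinM mulN1r.
have := @Rintegral_image R _ _ _ _ mu mu (fun x => - x) (NngNum (@ler01 R)) mN _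
  (fun x => sin (b * x) * u x) miu.
move=> H; have {H} : \int[mu]_x (sin (b * x) * u x) =
    1 * \int[mu]_x (sin (b * - x) * u (- x)).
  apply: H; last by rewrite E.
  by move=> A mA; rewrite mul1e; exact: lebesgue_opp.
rewrite mul1r.
have -> : \int[mu]_x (sin (b * - x) * u (- x)) = -1 * Is u b.
  rewrite /Is -RintegralZl//; apply: eq_Rintegral => x _.
  by rewrite eu mulrN sinN; ring.
by rewrite -/(Is u b); lra.
Qed.

(** The sine part is the integral of an odd function, so the transform is real; this is why only
    [Ic] appears from here on in the coefficients. *)
Lemma cint_expi u b : bump u -> even u ->
  cintegrable mu (fun y => expi (b * y) * (u y)%:C%C) /\
  cint mu (fun y => expi (b * y) * (u y)%:C%C) = (Ic u b)%:C%C.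
Proof.
move=> bu eu.
have er y : complex.Re (expi (b * y) * (u y)%:C%C) = cos (b * y) * u y.
  by rewrite ReM /= mulr0 subr0.
have ei y : complex.Im (expi (b * y) * (u y)%:C%C) = sin (b * y) * u y.
  by rewrite ImM /= mulr0 add0r.
split.
  split.
  - by under eq_fun do rewrite er; exact: bump_integrableM (@continuous_cosM R b) bu.
  - by under eq_fun do rewrite ei; exact: bump_integrableM (@continuous_sinM R b) bu.
rewrite /cint; under eq_Rintegral do rewrite er.
under [X in (_ +i* X)%C]eq_Rintegral do rewrite ei.
by rewrite -/(Ic u b) -/(Is u b) Is_even.
Qed.

Lemma cint_expi_tensor n (u : 'I_n -> R -> R) (b : 'I_n -> R) :
  (forall i, bump (u i)) -> (forall i, even (u i)) ->
  cintegrable (lebesgue_rV R n)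
    (fun x : 'rV[R]_n => \prod_i (expi (b i * x ord0 i) * (u i (x ord0 i))%:C%C)) /\
  cint (lebesgue_rV R n)
    (fun x : 'rV[R]_n => \prod_i (expi (b i * x ord0 i) * (u i (x ord0 i))%:C%C)) =
  (\prod_i Ic (u i) (b i))%:C%C.
Proof.
move=> bu eu.
have [h1 h2] := @cint_tensor R n (fun i y => expi (b i * y) * (u i y)%:C%C)
  (fun i => (cint_expi (b i) (bu i) (eu i)).1).
split => //; rewrite h2 -prod_realC; apply: eq_bigr => i _.
by have [_ ->] := cint_expi (b i) (bu i) (eu i).
Qed.

Lemma Ic_opp u (b : R) : Ic u (- b) = Ic u b.
Proof. by apply: eq_Rintegral => y _; rewrite mulNr cosN. Qed.

Section packet.
Variables (n : nat) (c : R) (u : 'I_n -> R -> R) (s : 'I_n -> R).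
Hypothesis bu : forall i, bump (u i).
Hypothesis eu : forall i, even (u i).

(** The common shape of the Fourier transform of a wavelet and of its heat-damped symbol: real even
    factors carrying linear phases. *)
Definition packet (xi : 'rV[R]_n) : C :=
  c%:C%C * \prod_i (expi (s i * xi ord0 i) * (u i (xi ord0 i))%:C%C).

Lemma cintegrableZ d (X : measurableType d) (nu : {measure set X -> \bar R}) (a : C) g :
  cintegrable nu g -> cintegrable nu (fun x => a * g x).
Proof.
move=> ig; have := cintegrableM_bounded ig (cmeasurable_cst _ a) (fun _ => lexx (norm1 a)).
by under eq_fun do rewrite mulrC.
Qed.

Lemma cintegrable_packet : cintegrable (lebesgue_rV R n) packet.
Proof. by apply: cintegrableZ; have [] := cint_expi_tensor s bu eu. Qed.

Lemma fourier_packet : fourier packet =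
  (fun x => (tensor c (fun i k y => Icsn true k (u i) (y - s i)) (fun=> 0%N) x)%:C%C).
Proof.
apply/funext => x; rewrite -[LHS]/(cint (lebesgue_rV R n) _).
have [h1 h2] := cint_expi_tensor (fun i => s i - x ord0 i) bu eu.
transitivity (c%:C%C * cint (lebesgue_rV R n) (fun y : 'rV[R]_n => 
  \prod_i (expi ((s i - x ord0 i) * y ord0 i) * (u i (y ord0 i))%:C%C))).
  rewrite -cintZ//; congr cint; apply/funext => y; rewrite /packet -mulrA; congr (_ * _).
  rewrite /dot -sumrN expi_sum -big_split /=; apply: eq_bigr => i _.
  by rewrite mulrAC -expiD mulrBl [y ord0 i * _]mulrC.
rewrite h2 -rmorphM /=; congr (_ %:C)%C; rewrite /tensor; congr (_ * _).
by apply: eq_bigr => i _; rewrite /= -Ic_opp opprB.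
Qed.

Lemma schwartz_fourier_packet : schwartz (fourier packet).
Proof.
rewrite fourier_packet; apply: schwartz_tensor.
- by move=> i k x; apply: is_derive_comp_shift; exact: Icsn_derive.
- by move=> i k; apply: (rapid_shift (- s i)); exact: Icsn_rapid.
Qed.

(** The double transform factors over the coordinates, and the factor of index [i] vanishes by
    [Ic_gap_transform], with the phase [s i] acting as a translation. *)
Lemma fourier_fourier_packet_eq0 (i : 'I_n) (a : R) (xi : 'rV[R]_n) :
  gap a (u i) -> `|xi ord0 i| < a -> fourier (fourier packet) xi = 0.
Proof.
move=> ga xia; rewrite -[LHS]/(cint (lebesgue_rV R n) _) fourier_packet.
pose g j (y : measurableTypeR R) : C := (Ic (u j) (y - s j))%:C%C * expi (- (y * xi ord0 j)).
have rj j : rapid (fun y => Ic (u j) (y - s j)).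
  by apply: (rapid_shift (- s j)); exact: Ic_rapid.
have cj j : continuous (fun y => Ic (u j) (y - s j)).
  have du y : is_derive y (1:R) (fun y => Ic (u j) (y - s j))
      (- Is (fun y => y * u j y) (y - s j)).
    exact: is_derive_comp_shift (Ic_derive _ (bu j)).
  exact: (is_derive_continuous du).
have ig j : cintegrable mu (g j).
  apply: cintegrableM_bounded (cintegrable_real _) _ (fun y => norm1_expi _).
  - exact: (rapid_integrable (cj j) (rj j)).
  - by apply: cmeasurable_expi; apply: measurableT_comp => //; apply: measurable_funM.
have [h1 h2] := cint_tensor ig.
transitivity (c%:C%C * \prod_j cint mu (g j)); last first.
  rewrite (bigD1 i)//= (_ : cint mu (g i) = 0) ?mul0r ?mulr0//.
  have [hc hs] := Ic_gap_transform (- s i) (bu i) ga xia.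
  rewrite /cint; under eq_Rintegral do rewrite /g ReM /= mul0r subr0 cosN mulrC (mulrC _ (xi _ _)).
  rewrite hc; under [X in (_ +i* X)%C]eq_Rintegral do
    rewrite /g ImM /= mul0r addr0 sinN mulrN mulrC (mulrC _ (xi _ _)) -mulN1r.
  rewrite RintegralZl//.
    by rewrite hs mulr0.
  apply: (@rapid_integrable _ (fun x => sin (xi ord0 i * x) * Ic (u i) (x - s i))).
  - by apply: continuousMf => //; exact: continuous_sinM.
  - by apply: (rapidMl _ (rj i)) => x; exact: sin_max.
rewrite -h2 -cintZ//; congr cint; apply/funext => x.
rewrite /g big_split /= -expi_sum prod_realC sumrN mulrA -rmorphM /=.
by [].
Qed.

Lemma partials_near0 (g : 'rV[R]_n -> C) (r : R) sq (x : 'rV[R]_n) :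
  (forall x : 'rV[R]_n, `|x| < r -> g x = 0) -> `|x| < r -> partials sq g x = 0.
Proof.
move=> g0; elim: sq x => [|j sq IH] x xr; first exact: g0.
rewrite /= /partial.
have nx : \forall y \near x, `|y| < r.
  exact: (@cvgr_norm_lt R 'rV[R]_n 'rV[R]_n (nbhs x) _ id x cvg_id r xr).
rewrite (near_eq_derive (g := fun=> 0)) ?derive_cst; last first.
  by near=> y; rewrite IH//; near: y; exact: nx.
rewrite (near_eq_derive (g := fun=> 0)) ?derive_cst//.
by near=> y; rewrite IH//; near: y; exact: nx.
Unshelve. all: by end_near. Qed.

(** One coordinate with a gap is enough: the norm bounds that coordinate, so the double transform
    vanishes on a ball about the origin, together with all its derivatives there. *)
Lemma schwartz0_fourier_packet (i : 'I_n) (a : R) : 0 < a -> gap a (u i) ->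
  schwartz0 (fourier packet).
Proof.
move=> a0 ga; split; first exact: schwartz_fourier_packet.
move=> sq; apply: (@partials_near0 _ a); last by rewrite normr0.
move=> xi xia; apply: (fourier_fourier_packet_eq0 ga); apply: le_lt_trans xia.
by rewrite [leRHS]mx_normrE; apply: (le_bigmax _ (fun ij => `|xi ij.1 ij.2|) (ord0, i)).
Qed.

End packet.
End wave_packets.

(** * Wavelet coefficients of the heat flow *)

Section meyer_windows.
Context {R : realType}.
Local Notation mu := (@lebesgue_measure R).

Lemma Ic_scale u (a b : R) : 0 < a -> bump u ->
  Ic (fun y => u (a^-1 * y)) b = a * Ic u (a * b).
Proof.
move=> a0 bu.
have bv : bump (fun y => u (a^-1 * y)) by apply: bump_scale; rewrite ?invr_eq0 ?gt_eqF.
have iv := bump_integrableM (@continuous_cosM R b) bv.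
have iu := bump_integrableM (@continuous_cosM R (a * b)) bu.
have E : (fun x => cos (b * x) * u (a^-1 * x)) \o affine1 a 0 =
         (fun x => cos (a * b * x) * u x).
  by apply/funext => x; rewrite /= /affine1 addr0 mulKf ?gt_eqF// mulrCA mulrA.
have := @Rintegral_image R _ _ _ _ mu mu (affine1 a 0) (NngNum (ltW a0))
  (measurable_affine1 a 0) (fun A => @lebesgue_affine1 R a 0 A a0)
  (fun x => cos (b * x) * u (a^-1 * x)).
rewrite E => H; apply: (etrans (H _ _)) => //=.
  by apply/measurable_EFinP; exact: measurable_int iv.
by congr (_ * _); apply: eq_Rintegral => x _; exact: (congr1 (@^~ x) E).
Qed.

Variables (phi0 : R -> R).
Hypothesis mphi0 : meyer_scaling phi0.

Definition psi (e : bool) : R -> R := if e then meyer_varphi phi0 else phi0.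

Lemma pi_third_gt0 : 0 < 2 * (pi : R) / 3.
Proof. by rewrite divr_gt0// mulr_gt0// pi_gt0. Qed.

(** The radius comes from $\phi^0(\xi/2)$ inside $\varphi$; it also covers the smaller support of
    $\phi^0$. *)
Lemma psi_supp e x : 8 * pi / 3 < `|x| -> psi e x = 0.
Proof.
have p0 := @pi_gt0 R.
case: e => /= h; last by apply: (phi0_supp mphi0); lra.
rewrite /meyer_varphi !(phi0_supp mphi0); first by rewrite expr0n subrr sqrtr0.
  by lra.
by rewrite normrM (@ger0_norm _ 2^-1)//; lra.
Qed.

Lemma varphi_eq0 x : `|x| <= 2 * pi / 3 -> psi true x = 0.
Proof.
move=> h; rewrite /psi /meyer_varphi !(phi0_one mphi0) ?subrr ?sqrtr0//.
by rewrite normrM (@ger0_norm _ 2^-1)//; have := normr_ge0 x; lra.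
Qed.

Lemma bump_psi e : bump (psi e).
Proof.
split; last by exists (8 * pi / 3) => x; exact: psi_supp.
by apply: smooth1_derive1n; case: e; [exact: (varphi_smooth mphi0)|exact: (phi0_smooth mphi0)].
Qed.

Lemma even_psi e : even (psi e).
Proof.
case: e => x /=; last exact: (phi0_even mphi0).
by rewrite /meyer_varphi mulNr !(phi0_even mphi0).
Qed.

Definition gap_radius (e : bool) : R := if e then 2 * pi / 3 else 0.

Lemma gap_radius_ge0 e : 0 <= gap_radius e.
Proof. by case: e => //; exact: ltW pi_third_gt0. Qed.

Lemma gap_psi e : gap (gap_radius e) (psi e).
Proof.
case: e => x /= h; first exact: varphi_eq0 (ltW h).
by move: h; rewrite ltNge normr_ge0.
Qed.

Lemma even_gauss t : even (@gauss R t).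
Proof. by move=> x; rewrite /gauss sqrrN. Qed.

Lemma evenM (u v : R -> R) : even u -> even v -> even (fun x => u x * v x).
Proof. by move=> eu ev x; rewrite eu ev. Qed.

Lemma even_scale (u : R -> R) (a : R) : even u -> even (fun x => u (a * x)).
Proof. by move=> eu x; rewrite mulrN eu. Qed.

(** The product of the symbols of two wavelets after rescaling to the scale of the first; [r] will
    be $2^{j-j'}$. *)
Definition psi2 (e e' : bool) (r y : R) := psi e' (r * y) * psi e y.

Lemma bump_psi2 e e' r : r != 0 -> bump (psi2 e e' r).
Proof.
move=> r0; apply: bumpMl; last exact: bump_psi.
by apply: bump_smooth; exact: (bump_scale r0 (bump_psi e')).
Qed.

Lemma gap_psi2 e e' r : gap (gap_radius e) (psi2 e e' r).
Proof. exact: (gapM _ (@gap_psi e)). Qed.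

(** The exponent 4 is chosen to produce the square of the weight [wt] in each coordinate. *)
Lemma psi2_decay e e' r : r != 0 -> exists2 K, 0 <= K & forall t x, 0 <= t ->
  (1 + `|x|) ^+ 4 * `|Ic (fun y => gauss t y * psi2 e e' r y) x| <=
    K * ((1 + t) ^+ 4 * expR (- (t * gap_radius e ^+ 2))).
Proof.
move=> r0; have bp := @bump_psi2 e e' r r0; have gp := @gap_psi2 e e' r.
have [K0 K00 h0] := gauss_decay 0 bp gp (gap_radius_ge0 e).
have [K4 K40 h4] := gauss_decay 4 bp gp (gap_radius_ge0 e).
exists (2 ^+ 4 * (K0 + K4)) => [|t x t0]; first by rewrite mulr_ge0// addr_ge0.
have [+ _] := h0 t x t0; have [+ _] := h4 t x t0.
set J := `|Ic _ x|; set E := expR _; move=> {}h4 {}h0.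
have J0 : 0 <= J by exact: normr_ge0.
apply: (@le_trans _ _ (2 ^+ 4 * (1 + `|x| ^+ 4) * J)).
  by rewrite ler_wpM2r// onep_pow.
set P := (1 + t) ^+ 4 in h4 *; set Q := `|x| ^+ 4 in h4 *.
have P1 : 1 <= P by rewrite expr_ge1//; lra.
rewrite -[leLHS]mulrA -[leRHS]mulrA ler_pM2l ?exprn_gt0// [leLHS]mulrDl [leRHS]mulrDl mul1r.
apply: lerD => //; apply: le_trans (_ : K0 * (1 * E) <= _).
  by move: h0; rewrite !expr0 !mul1r.
by rewrite ler_wpM2l// ler_wpM2r ?expR_ge0.
Qed.

(** With $Q$ the exponent, $e^{tb}=(e^{tb/Q})^Q\ge(1+tb/Q)^Q$, and $1+t\le(1+Q/b)(1+tb/Q)$. *)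
Lemma expR_poly (b : R) (P : nat) : 0 < b -> exists2 K : R, 0 <= K & forall t, 0 <= t ->
  (1 + t) ^+ P * expR (- (t * b)) <= K.
Proof.
move=> b0; case: P => [|P].
  exists 1 => // t t0; by rewrite expr0 mul1r -expR0 ler_expR oppr_le0 mulr_ge0// ltW.
pose K := 1 + P.+1%:R / b.
have K1 : 0 <= P.+1%:R / b by rewrite divr_ge0// ltW.
exists (K ^+ P.+1) => [|t t0]; first by rewrite exprn_ge0// addr_ge0.
rewrite expRN ler_pdivrMr ?expR_gt0//.
rewrite (_ : expR (t * b) = expR (P.+1%:R * (t * b / P.+1%:R))); last first.
  by congr expR; rewrite [RHS]mulrC divfK// pnatr_eq0.
rewrite expRM_natl -exprMn lerXn2r ?nnegrE ?mulr_ge0 ?expR_ge0//.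
- by rewrite addr_ge0.
- by rewrite addr_ge0.
apply: le_trans (_ : K * (1 + t * b / P.+1%:R) <= _); last first.
  by rewrite ler_wpM2l ?addr_ge0// expR_ge1Dx.
have x0 : 0 <= t * b / P.+1%:R by rewrite divr_ge0// mulr_ge0// ltW.
have -> : K * (1 + t * b / P.+1%:R) = 1 + t * b / P.+1%:R + P.+1%:R / b + t.
  have : (P.+1%:R : R) != 0 by rewrite pnatr_eq0.
  by rewrite /K; move: (P.+1%:R : R) => c c0; field; rewrite c0 gt_eqF.
by rewrite lerD2r -addrA lerDl addr_ge0.
Qed.

End meyer_windows.

(** * Matrix entries of the heat semigroup *)

Section wavelet_coefficients.
Context {R : realType} {n : nat}.
Local Notation C := R[i].
Local Notation V := 'rV[R]_n.
Variables (phi0 : R -> R) (phi : {ffun 'I_n -> bool} -> V -> C).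
Hypothesis mphi0 : meyer_scaling phi0.
Hypothesis mphi : meyer_functions phi0 phi.
Local Notation psi := (psi phi0).

(** The position of the wavelet, read off as the phase of its Fourier transform; the half step comes
    from the factor $e^{-i\xi/2}$ in $\phi^1$. *)
Definition wshift (e : {ffun 'I_n -> bool}) (j : int) (k : 'rV[int]_n) (i : 'I_n) : R :=
  ((2 : R) ^ j)^-1 * ((k ord0 i)%:~R + (e i)%:R / 2).

Definition wnorm (j : int) : R := 2 `^ (n%:R * j%:~R / 2).

(** Normalization times the Jacobian of the dilation, that is $2^{-nj/2}$. *)
Definition wamp (j : int) : R := wnorm j * ((2 : R) ^ j) ^- n.

Lemma two_gt0 (j : int) : 0 < (2 : R) ^ j. Proof. exact: exprz_gt0. Qed.

Lemma waveletE e j k : wavelet phi e j k =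
  (fun x => (wnorm j)%:C%C * (phi e \o affine ((2 : R) ^ j) (- map_mx intr k)) x).
Proof. by []. Qed.

Lemma cintegrable_wavelet e j k : cintegrable (lebesgue_rV R n) (wavelet phi e j k).
Proof.
rewrite waveletE; apply: cintegrableZ; apply: cintegrable_affine; first exact: two_gt0.
by apply: schwartz_cintegrable; have [] := mphi e.
Qed.

Lemma meyer_symbolE b (x : R) :
  meyer_symbol phi0 b x = expi (- (b%:R / 2) * x) * (psi b x)%:C%C.
Proof.
case: b => /=; last by rewrite mul0r oppr0 mul0r expi0 mul1r.
by congr (expi _ * _); field.
Qed.

Lemma fourier_wavelet e j k xi : fourier (wavelet phi e j k) xi =
  packet (wamp j) (fun i y => psi (e i) (((2 : R) ^ j)^-1 * y))
    (fun i => - wshift e j k i) xi.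
Proof.
have a0 := two_gt0 j; have [sphi fphi] := mphi e.
have ip := schwartz_cintegrable sphi.
transitivity ((wnorm j)%:C%C * fourier (phi e \o affine (2 ^ j) (- map_mx intr k)) xi).
  rewrite -[LHS]/(cint (lebesgue_rV R n) _) -[fourier _ xi]/(cint (lebesgue_rV R n) _).
  rewrite -cintZ; last exact: (cintegrable_fourier xi (cintegrable_affine _ a0 ip)).
  by congr cint; apply/funext => x; rewrite waveletE mulrA.
rewrite (fourier_affine (- map_mx intr k) xi a0 ip) fphi /packet -mulrA mulrA -rmorphM /=.
congr (_ * _); rewrite /dot mulr_sumr expi_sum -big_split /=.
apply: eq_bigr => i _; rewrite meyer_symbolE !mxE mulrA -expiD; congr (expi _ * _).
by rewrite /wshift; field; rewrite gt_eqF.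
Qed.

(** [heat t f] tests [f] against the Fourier transform of this packet. The phases are opposite to
    those in [fourier_wavelet], and the power of $2\pi$ appears, because [heat] passes through
    [ifourier]. *)
Definition heat_symbol (t : R) (e : {ffun 'I_n -> bool}) (j : int) (k : 'rV[int]_n) : V -> C :=
  packet ((2 * pi) ^- n * wamp j)
    (fun i y => gauss t y * psi (e i) (((2 : R) ^ j)^-1 * y)) (wshift e j k).

Lemma gauss_prod t (xi : V) : expR (- (t * dot xi xi)) = \prod_i gauss t (xi ord0 i).
Proof.
rewrite /dot mulr_sumr -sumrN expR_sum; apply: eq_bigr => i _.
by rewrite /gauss expr2.
Qed.

Lemma heat_symbolE t e j k :
  (fun xi => (expR (- (t * dot xi xi)))%:C%C * ifourier (wavelet phi e j k) xi) =
  heat_symbol t e j k.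
Proof.
apply/funext => xi.
have -> : ifourier (wavelet phi e j k) xi =
    ((2 * pi) ^- n)%:C%C * fourier (wavelet phi e j k) (- xi).
  rewrite /ifourier /fourier; congr (_ * Cintegral _); apply/funext => x.
  congr (_ * expi _); rewrite /dot -sumrN; apply: eq_bigr => i _.
  by rewrite mxE mulrN opprK mulrC.
rewrite fourier_wavelet /heat_symbol /packet gauss_prod -prod_realC.
rewrite mulrCA [X in _ * X]mulrCA mulrA -rmorphM /=; congr (_ * _).
rewrite -big_split /=; apply: eq_bigr => i _.
by rewrite !mxE mulrNN mulrCA rmorphM /= mulrN even_psi.
Qed.

Lemma heat_waveletE t (f : (V -> C) -> C) e j k :
  heat t f (wavelet phi e j k) = f (fourier (heat_symbol t e j k)).
Proof. by rewrite -heat_symbolE. Qed.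

Lemma bump_heat_factor t (b : bool) (j : int) :
  bump (fun y => gauss t y * psi b (((2 : R) ^ j)^-1 * y)).
Proof.
apply: bumpMl; first exact: smooth1_gauss.
by apply: bump_scale; [rewrite invr_eq0 gt_eqF// two_gt0|exact: bump_psi].
Qed.

Lemma even_heat_factor t (b : bool) (j : int) :
  even (fun y => gauss t y * psi b (((2 : R) ^ j)^-1 * y)).
Proof.
by apply: evenM; [exact: even_gauss|apply: (even_scale _ (even_psi mphi0 b))].
Qed.

Lemma nonzero_ffun (e : {ffun 'I_n -> bool}) : e != [ffun=> false] -> exists i, e i.
Proof.
move=> e0; apply/existsP; apply: contraNT e0; rewrite negb_exists => /forallP h.
by apply/eqP/ffunP => i; rewrite ffunE; exact/negbTE/h.
Qed.

Lemma schwartz0_heat_symbol t e j k : e != [ffun=> false] ->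
  schwartz0 (fourier (heat_symbol t e j k)).
Proof.
move=> /nonzero_ffun[i ei]; have a0 := two_gt0 j.
apply: (@schwartz0_fourier_packet _ _ _ _ _ _ _ i (2 ^ j * (2 * pi / 3))).
- by move=> l; exact: bump_heat_factor.
- by move=> l; exact: even_heat_factor.
- by rewrite mulr_gt0// pi_third_gt0.
- move=> y h; rewrite ei (gap_psi mphi0 (e := true)) ?mulr0//=.
  by rewrite normrM normfV (gtr0_norm a0) mulrC ltr_pdivrMr// mulrC.
Qed.

(** The pairing of the wavelet of index $(e',j',k')$ with $e^{t\Delta}$ applied to the one of index
    $(e,j,k)$; evenness of all factors makes it real. *)
Definition kappa t (e : {ffun 'I_n -> bool}) j k (e' : {ffun 'I_n -> bool}) j' k' : R :=
  wamp j' * ((2 * pi) ^- n * wamp j) *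
  \prod_i Ic (fun y => psi (e' i) (((2 : R) ^ j')^-1 * y) *
                (gauss t y * psi (e i) (((2 : R) ^ j)^-1 * y)))
    (wshift e j k i - wshift e' j' k' i).

Lemma Cintegral_wavelet_heat t e j k e' j' k' :
  Cintegral (fun x => wavelet phi e' j' k' x * fourier (heat_symbol t e j k) x) =
  (kappa t e j k e' j' k')%:C%C.
Proof.
rewrite Cintegral_fourier; last 2 first.
- exact: cintegrable_wavelet.
- apply: cintegrable_packet => i; [exact: bump_heat_factor|exact: even_heat_factor].
have [h1 h2] := @cint_expi_tensor R n (fun i y => psi (e' i) (((2 : R) ^ j')^-1 * y) *
                (gauss t y * psi (e i) (((2 : R) ^ j)^-1 * y)))
    (fun i => wshift e j k i - wshift e' j' k' i)
    (fun i => bumpMl (bump_smooth (bump_scale (lt0r_neq0 (etrans (invr_gt0 _) (two_gt0 j')))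
       (bump_psi mphi0 _)))
       (bump_heat_factor t (e i) j))
    (fun i => evenM (even_scale _ (even_psi mphi0 _)) (even_heat_factor t (e i) j)).
rewrite /kappa rmorphM /= -h2 -cintZ// -[LHS]/(cint (lebesgue_rV R n) _).
congr cint; apply/funext => xi; rewrite fourier_wavelet /heat_symbol /packet.
rewrite mulrACA -rmorphM /= -big_split /=; congr (_ * _); apply: eq_bigr => i _.
by rewrite mulrACA -expiD -rmorphM /= -mulrDl [- _ + _]addrC.
Qed.

Lemma wnorm_gt0 j : 0 < wnorm j. Proof. by rewrite powR_gt0. Qed.

Lemma wnorm_sqr j : wnorm j ^+ 2 = ((2 : R) ^ j) ^+ n.
Proof.
rewrite -(powR_intmul j (ler0n R 2)) -(powR_mulrn 2 (powR_ge0 _ _)).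
rewrite -(powR_mulrn n (powR_ge0 _ _)) -!powRrM.
by congr (_ `^ _); field.
Qed.

(** In the variable $2^{-j}y$ the time becomes $t4^j$ and the scales enter the windows only through
    $2^{j-j'}$, so bounds can be made uniform in $j$. *)
Lemma kappaE t e j k e' j' k' : kappa t e j k e' j' k' =
  (2 * pi) ^- n * (wnorm j / wnorm j') *
  \prod_i Ic (fun y => gauss (t * (2 ^ j) ^+ 2) y * psi2 phi0 (e i) (e' i) (2 ^ j / 2 ^ j') y)
    (2 ^ j * (wshift e j k i - wshift e' j' k' i)).
Proof.
have a0 := two_gt0 j; have a'0 := two_gt0 j'; have q0 := wnorm_gt0 j; have q'0 := wnorm_gt0 j'.
rewrite /kappa.
have -> : \prod_i Ic (fun y => psi (e' i) (((2 : R) ^ j')^-1 * y) *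
                (gauss t y * psi (e i) (((2 : R) ^ j)^-1 * y)))
    (wshift e j k i - wshift e' j' k' i) = (2 ^ j) ^+ n *
  \prod_i Ic (fun y => gauss (t * (2 ^ j) ^+ 2) y * psi2 phi0 (e i) (e' i) (2 ^ j / 2 ^ j') y)
    (2 ^ j * (wshift e j k i - wshift e' j' k' i)).
  have -> : ((2 : R) ^ j) ^+ n = \prod_(i < n) (2 ^ j) by rewrite prodr_const card_ord.
  rewrite -big_split /=; apply: eq_bigr => i _.
  rewrite -Ic_scale//; last first.
    apply: bumpMl; first exact: smooth1_gauss.
    by apply: bump_psi2 => //; rewrite mulf_neq0 ?invr_eq0 ?gt_eqF.
  congr (Ic _ _); apply/funext => y; rewrite mulrCA /psi2; congr (_ * _).
    by rewrite /gauss; congr (expR (- _)); field; rewrite gt_eqF.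
  by congr (psi _ _ * _); field; rewrite !gt_eqF.
rewrite mulrA; congr (_ * _); rewrite /wamp -!wnorm_sqr.
by field; rewrite !gt_eqF ?exprn_gt0// mulr_gt0// pi_gt0.
Qed.

End wavelet_coefficients.

(** * Almost diagonal bounds for the heat semigroup *)

Section coefficient_bounds.
Context {R : realType} {n : nat}.
Local Notation C := R[i].
Local Notation V := 'rV[R]_n.
Variables (phi0 : R -> R) (phi : {ffun 'I_n -> bool} -> V -> C).
Hypothesis mphi0 : meyer_scaling phi0.
Hypothesis mphi : meyer_functions phi0 phi.
Local Notation psi := (psi phi0).
Local Notation kappa := (@kappa R n phi0).
Local Notation wnorm := (@wnorm R n).
Local Notation wshift := (@wshift R n).

(** The first factor lives in $|y|>2\pi a'/3$ and the second in $|y|\le 8\pi a/3$. *)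
Lemma psi_disjoint (a a' : R) e y : 0 < a -> 4 * a <= a' ->
  psi true (a'^-1 * y) * psi e (a^-1 * y) = 0.
Proof.
move=> a0 aa'; have a'0 : 0 < a' by lra.
have [h|h] := leP `|a'^-1 * y| (2 * pi / 3); first by rewrite varphi_eq0 ?mul0r.
rewrite [X in _ * X]psi_supp ?mulr0//.
move: h; rewrite !normrM !normfV (gtr0_norm a0) (gtr0_norm a'0).
rewrite ![_^-1 * `|y|]mulrC !ltr_pdivlMr//.
by apply: le_lt_trans; have := @pi_third_gt0 R; nra.
Qed.

Lemma Ic_0 (b : R) : Ic (fun=> 0) b = 0.
Proof.
by rewrite /Ic; under eq_Rintegral do rewrite mulr0; rewrite /Rintegral integral0.
Qed.

Lemma exp2_ge4 (j j' : int) : j + 2 <= j' -> 4 * (2 : R) ^ j <= 2 ^ j'.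
Proof.
move=> jj'; rewrite (_ : 4 = (2 : R) ^ (2%:Z)); last by rewrite -exprnP; ring.
by rewrite -expfzDr// ler_weXz2l ?ler1n// addrC.
Qed.

(** The finer of the two wavelets has a coordinate of type $\varphi$; there its support misses that
    of the coarser symbol, whatever the type of the latter. *)
Lemma kappa_eq0 t e j k e' j' k' : e != [ffun=> false] -> e' != [ffun=> false] ->
  j' - j \notin [:: -1; 0; 1] -> kappa t e j k e' j' k' = 0.
Proof.
move=> /nonzero_ffun[i ei] /nonzero_ffun[i' ei'] jj'.
have [h|h] : (j + 2 <= j') \/ (j' + 2 <= j).
  by move: jj'; rewrite !inE; lia.
- rewrite /kappa (bigD1 i')//= (_ : Ic _ _ = 0) ?mul0r ?mulr0//.
  rewrite -[RHS](Ic_0 (wshift e j k i' - wshift e' j' k' i')); congr (Ic _ _).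
  apply/funext => y; rewrite ei' mulrCA psi_disjoint ?mulr0// ?two_gt0//.
  exact: exp2_ge4.
- rewrite /kappa (bigD1 i)//= (_ : Ic _ _ = 0) ?mul0r ?mulr0//.
  rewrite -[RHS](Ic_0 (wshift e j k i - wshift e' j' k' i)); congr (Ic _ _).
  apply/funext => y; rewrite ei mulrCA [psi _ _ * _]mulrC psi_disjoint ?mulr0// ?two_gt0//.
  exact: exp2_ge4.
Qed.

Lemma psi2_decay_uniform : exists2 K : R, 0 <= K & forall e e' (d : int) t x,
  d \in [:: -1; 0; 1] -> 0 <= t ->
  (1 + `|x|) ^+ 4 * `|Ic (fun y => gauss t y * psi2 phi0 e e' (2 ^ (- d)) y) x| <=
    K * ((1 + t) ^+ 4 * expR (- (t * gap_radius e ^+ 2))).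
Proof.
have h (z : bool * bool * 'I_3) : exists K : R, 0 <= K /\ forall t x, 0 <= t ->
  (1 + `|x|) ^+ 4 * `|Ic (fun y => gauss t y *
      psi2 phi0 z.1.1 z.1.2 (2 ^ (- ((z.2)%:Z - 1))) y) x| <=
    K * ((1 + t) ^+ 4 * expR (- (t * gap_radius z.1.1 ^+ 2))).
  have [|K K0 hK] := @psi2_decay R phi0 mphi0 z.1.1 z.1.2 (2 ^ (- ((z.2)%:Z - 1))).
    by rewrite gt_eqF// two_gt0.
  by exists K.
have [K hK] := choice h.
(* Only finitely many triples of two types and a scale difference occur; the sum of their constants
   serves for all. *)
exists (\sum_z K z) => [|e e' d t x dd t0].
  by apply: sumr_ge0 => z _; case: (hK z).
have [i di] : exists i : 'I_3, d = (i : nat)%:Z - 1.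
  by move: dd; rewrite !inE => /or3P[]/eqP ->;
    [exists (inord 0)|exists (inord 1)|exists (inord 2)]; rewrite inordK.
have [_ /(_ t x t0)] := hK (e, e', i); rewrite /= -di => /le_trans; apply.
rewrite ler_wpM2r ?mulr_ge0 ?expR_ge0 ?exprn_ge0 ?addr_ge0//.
rewrite (bigD1 (e, e', i))//= lerDl sumr_ge0// => z _; by case: (hK z).
Qed.

Lemma kappa_bound (M : nat) : exists2 K : R, 0 <= K & forall t e j k e' j' k',
  e != [ffun=> false] -> j' - j \in [:: -1; 0; 1] -> 0 <= t ->
  `|kappa t e j k e' j' k'| * (1 + t * (2 ^ j) ^+ 2) ^+ M *
    \prod_i (1 + `|2 ^ j * (wshift e j k i - wshift e' j' k' i)|) ^+ 4 <=
  K * (wnorm j / wnorm j').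
Proof.
have [K K0 hK] := psi2_decay_uniform.
have b0 : 0 < (2 * pi / 3) ^+ 2 :> R by rewrite exprn_gt0// pi_third_gt0.
(* Each of the [n] coordinates costs $(1+\tau)^4$, and [M] further powers are to be gained; the
   exponential must absorb all of them. *)
have [L L0 hL] := expR_poly (4 * n + M) b0.
have c0 : 0 <= (2 * pi) ^- n :> R by rewrite invr_ge0 exprn_ge0// mulr_ge0// pi_ge0.
exists ((2 * pi) ^- n * (K ^+ n * L)) => [|t e j k e' j' k' e0 jj' t0].
  by rewrite !mulr_ge0// exprn_ge0.
have [i0 ei0] := nonzero_ffun e0.
set w := wnorm j / wnorm j'; have w0 : 0 < w by rewrite divr_gt0// wnorm_gt0.
set tau := t * (2 ^ j) ^+ 2; have tau0 : 0 <= tau by rewrite mulr_ge0// exprn_ge0// ltW// two_gt0.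
rewrite kappaE// -/w -/tau; have -> : (2 : R) ^ j / 2 ^ j' = 2 ^ (- (j' - j)).
  by rewrite opprB expfzDr// invr_expz.
rewrite normrM (ger0_norm (mulr_ge0 c0 (ltW w0))) normr_prod.
pose y i : R := 2 ^ j * (wshift e j k i - wshift e' j' k' i).
pose I i := `|Ic (fun z => gauss tau z * psi2 phi0 (e i) (e' i) (2 ^ (- (j' - j))) z) (y i)|.
pose Y i := (1 + `|y i|) ^+ 4.
suff : (2 * pi) ^- n * w * \prod_i I i * (1 + tau) ^+ M * \prod_i Y i <=
  (2 * pi) ^- n * (K ^+ n * L) * w by [].
have hI i : Y i * I i <= K * ((1 + tau) ^+ 4 * expR (- (tau * gap_radius (e i) ^+ 2))).
  exact: hK.
have Y0 i : 0 <= Y i by rewrite exprn_ge0// addr_ge0.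
have I0 i : 0 <= I i by exact: normr_ge0.
have -> : (2 * pi) ^- n * w * \prod_i I i * (1 + tau) ^+ M * \prod_i Y i =
    (2 * pi) ^- n * (w * ((1 + tau) ^+ M * \prod_i (Y i * I i))).
  rewrite (_ : \prod_i (Y i * I i) = \prod_i Y i * \prod_i I i); last exact: big_split.
  by move: (\prod_i Y i) (\prod_i I i) (_ ^+ M) (_ ^- n) => x1 x2 x3 x4; ring.
have -> : (2 * pi) ^- n * (K ^+ n * L) * w = (2 * pi) ^- n * (w * (K ^+ n * L)).
  by rewrite -mulrA [_ * w]mulrC.
rewrite ler_wpM2l// ler_pM2l//.
apply: (@le_trans _ _ ((1 + tau) ^+ M *
    \prod_(i < n) (K * ((1 + tau) ^+ 4 * expR (- (tau * gap_radius (e i) ^+ 2)))))).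
  rewrite ler_wpM2l ?exprn_ge0 ?addr_ge0//; apply: ler_prod => i _.
  by apply/andP; split; [exact: mulr_ge0|exact: hI].
have bs (a b : R) (F : 'I_n -> R) :
    \prod_i (a * (b * F i)) = a ^+ n * (b ^+ n * \prod_i F i).
  by rewrite !big_split /= !prodr_const card_ord.
rewrite bs -expR_sum -exprM mulrCA ler_wpM2l ?exprn_ge0//.
rewrite mulrA -exprD addnC; apply: le_trans (hL _ tau0); rewrite ler_wpM2l ?exprn_ge0 ?addr_ge0//.
rewrite ler_expR sumrN lerN2 -mulr_sumr ler_wpM2l//.
(* A single coordinate of type $\varphi$ supplies the exponential; the remaining exponents are
   nonnegative. *)
rewrite (bigD1 i0)//= ei0 /= lerDl sumr_ge0// => i _; exact: sqr_ge0.
Qed.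

Lemma normc_sum_le (I : Type) (s : seq I) (F : I -> C) :
  Normc.normc (\sum_(i <- s) F i) <= \sum_(i <- s) Normc.normc (F i).
Proof.
elim: s => [|i s IH]; first by rewrite !big_nil Normc.normc0.
by rewrite !big_cons (le_trans (le_normcD _ _))// lerD2l.
Qed.

Lemma normc_ge0 (z : C) : 0 <= Normc.normc z.
Proof. by case: z => a b /=; exact: sqrtr_ge0. Qed.

(** Unconditional convergence is used through finite sums only: for every error [r] one finite set
    suffices, and its sum is below the possibly infinite total. *)
Lemma wavelet_series_bound (f : (V -> C) -> C) g : wavelet_series phi f -> schwartz0 g ->
  ((Normc.normc (f g))%:E <= \esum_(b in setT `*` @Gamma n)
    (Normc.normc (f (wavelet phi b.2.1 b.1 b.2.2)) *
     Normc.normc (Cintegral (fun x => wavelet phi b.2.1 b.1 b.2.2 x * g x)))%:E)%E.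
Proof.
move=> ws sg; apply/lee_addgt0Pr => r r0.
have [A0 [fA0 A0G hA]] := ws g sg r r0.
have {hA} := hA A0 fA0 (@subset_refl _ _) A0G.
set S := \sum_(b \in A0) _ => hS.
apply: (@le_trans _ _ ((Normc.normc S)%:E + r%:E)%E).
  rewrite -EFinD lee_fin -{1}[f g](subrK S) (le_trans (le_normcD _ _))//.
  by rewrite addrC lerD2l ltW.
rewrite leeD2r//; apply: esum_ge; exists A0; first by split.
rewrite fsbig_finite// sumEFin lee_fin /S fsbig_finite//.
apply: (le_trans (normc_sum_le _ _)); apply: ler_sum => b _.
by rewrite Normc.normcM.
Qed.

Lemma heat_wavelet_bound (f : (V -> C) -> C) t e j k : wavelet_series phi f ->
  e != [ffun=> false] ->
  ((Normc.normc (heat t f (wavelet phi e j k)))%:E <= \esum_(b in setT `*` @Gamma n)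
    (Normc.normc (f (wavelet phi b.2.1 b.1 b.2.2)) *
     `|kappa t e j k b.2.1 b.1 b.2.2|)%:E)%E.
Proof.
move=> ws e0; rewrite (heat_waveletE mphi0 mphi).
apply: (le_trans (wavelet_series_bound ws (schwartz0_heat_symbol mphi0 t j k e0))).
apply: le_esum => b _; rewrite (Cintegral_wavelet_heat mphi0 mphi) lee_fin.
by rewrite /= expr0n addr0 sqrtr_sqr.
Qed.

End coefficient_bounds.

(** * Lattice sums and weak norms *)

Section lattice_sums.
Context {R : realType}.

Lemma esumZ (T : choiceType) (A : set T) (c : R) (a : T -> \bar R) : 0 <= c ->
  (forall i, (0 <= a i)%E) ->
  (\esum_(i in A) (c%:E * a i) = c%:E * \esum_(i in A) a i)%E.
Proof.
have le (b : R) (f : T -> \bar R) : 0 <= b -> (forall i, (0 <= f i)%E) ->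
    (\esum_(i in A) (b%:E * f i) <= b%:E * \esum_(i in A) f i)%E.
  move=> b0 f0; apply: ge_ereal_sup => _ [X XA <-].
  rewrite -ge0_mule_fsumr// lee_wpmul2l// ?lee_fin//.
  by apply: esum_ge; exists X.
rewrite le_eqVlt => /predU1P[<-|c0] a0.
  by rewrite mul0e esum1// => i _; rewrite mul0e.
apply/eqP; rewrite eq_le le ?(ltW c0)//=.
have ca0 i : (0 <= c%:E * a i)%E by rewrite mule_ge0// lee_fin ltW.
have := le c^-1 (fun i => (c%:E * a i)%E) (ltW (etrans (invr_gt0 _) c0)) ca0.
under eq_esum do rewrite muleA -EFinM mulVf ?gt_eqF// mul1e.
have cE : (0 <= c%:E)%E by rewrite lee_fin ltW.
move/(lee_wpmul2l cE).
by rewrite [leRHS]muleA -EFinM mulfV ?gt_eqF// mul1e.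
Qed.

Lemma le_esum_subset (T : choiceType) (A B : set T) (a : T -> \bar R) : A `<=` B ->
  (\esum_(i in A) a i <= \esum_(i in B) a i)%E.
Proof.
move=> AB; apply: ereal_sup_le => _ [X [fX XA] <-]; exists X => //; split => //.
exact: subset_trans XA AB.
Qed.

Lemma le_esum_inj (T T' : choiceType) (A : set T) (B : set T') (h : T -> T')
    (a : T -> \bar R) (b : T' -> \bar R) :
  set_inj A h -> (forall i, A i -> B (h i)) -> (forall i, A i -> (a i <= b (h i))%E) ->
  (\esum_(i in A) a i <= \esum_(i in B) b i)%E.
Proof.
move=> ih AB ab; apply: (le_trans (le_esum ab)).
rewrite -(@esum_image _ _ _ A h b ih); apply: le_esum_subset => _ [i Ai <-]; exact: AB.
Qed.

Lemma esum_support (T : choiceType) (A B : set T) (a : T -> \bar R) :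
  (forall i, A i -> (0 <= a i)%E) -> (forall i, A i -> ~ B i -> a i = 0%E) ->
  (\esum_(i in A) a i = \esum_(i in A `&` B) a i)%E.
Proof.
move=> a0 az; rewrite (esumID B)// [X in (_ + X)%E]esum1 ?adde0//.
by move=> i [Ai nBi]; exact: az.
Qed.

Lemma esum_finType (I : finType) (a : I -> \bar R) : (forall i, (0 <= a i)%E) ->
  (\esum_(u in [set: I]) a u = \sum_(u : I) a u)%E.
Proof.
move=> a0; rewrite esum_fset//; last exact: finite_finset.
have -> : (\sum_(u : I) a u = \sum_(u \in [set` index_enum I]) a u)%E.
  exact: fsbig_seq (index_enum_uniq I).
by rewrite (_ : [set` _] = setT)//; apply/seteqP; split => // u _; exact: mem_index_enum.
Qed.

(** [h] may repeat values, which only enlarges the right-hand side; choosing one preimage per value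
    gives an injection. *)
Lemma esum_le_finite (T : choiceType) (I : finType) (A : set T) (h : I -> T)
    (a : T -> \bar R) :
  (forall i, (0 <= a i)%E) -> (forall i, A i -> (forall u, i <> h u) -> a i = 0%E) ->
  (\esum_(i in A) a i <= \sum_(u : I) a (h u))%E.
Proof.
move=> a0 az; rewrite (@esum_support _ A (range h))//; last first.
  by move=> i Ai hi; apply: az => // u iu; apply: hi; exists u.
have [[_ [_ [u0 _ _]]]|A0] := pselect (exists i, (A `&` range h) i); last first.
  rewrite (_ : _ `&` _ = set0) ?esum_set0 ?sume_ge0//.
  by apply/seteqP; split => // i Ahi; apply: A0; exists i.
pose k i := odflt u0 [pick u | h u == i].
have hk i : range h i -> h (k i) = i.
  move=> [u _ ui]; rewrite /k; case: pickP => [v /eqP//|/(_ u)].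
  by rewrite ui eqxx.
apply: (@le_trans _ _ (\esum_(u in [set: I]) a (h u))%E).
  apply: (@le_esum_inj _ _ _ _ k) => //.
    by move=> i i' /set_mem[_ ri] /set_mem[_ ri'] kk; rewrite -(hk i)// -(hk i')// kk.
  by move=> i [_ ri]; rewrite hk.
by rewrite esum_finType.
Qed.

Lemma esum_nat_sqr : (\esum_(m in [set: nat]) (((1 + m%:R) ^- 2 : R)%:E) <= 2%:E)%E.
Proof.
rewrite -nneseries_esumT; last by move=> m; rewrite lee_fin invr_ge0 exprn_ge0// addr_ge0.
apply: lime_le.
  by apply: is_cvg_nneseries => m _ _; rewrite lee_fin invr_ge0 exprn_ge0// addr_ge0.
apply: nearW => N; rewrite sumEFin lee_fin.
case: N => [|N]; first by rewrite big_nil.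
(* Telescoping: the subtracted term strengthens the bound so that the induction closes. *)
suff : \sum_(0 <= m < N.+1) (1 + m%:R) ^- 2 <= 2 - (1 + N%:R)^-1 :> R.
  by move/le_trans; apply; rewrite gerBl invr_ge0 addr_ge0.
elim: N => [|N IH]; first by rewrite big_nat1 addr0 expr1n invr1; lra.
rewrite big_nat_recr//= (le_trans (lerD IH (lexx _)))// -[N.+1%:R]natr1.
have N0 : 0 <= N%:R :> R by [].
move: (N%:R : R) N0 => x x0; rewrite -subr_ge0.
have -> : 2 - (1 + (x + 1))^-1 - (2 - (1 + x)^-1 + (1 + (x + 1)) ^- 2) =
   ((1 + x) * (1 + (x + 1)) ^+ 2)^-1.
  by field; apply/andP; split; rewrite gt_eqF//; lra.
by rewrite invr_ge0 mulr_ge0// ?sqr_ge0//; lra.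
Qed.

Definition wt (z : int) : R := (1 + `|z|%:~R) ^- 2.

Lemma wt_gt0 z : 0 < wt z.
Proof. by rewrite invr_gt0 exprn_gt0// ltr_wpDr// ler0z. Qed.

Lemma wt_le1 z : wt z <= 1.
Proof. by rewrite invf_le1 ?exprn_gt0 ?expr_ge1 ?ltr_wpDr ?lerDl ?ler0z. Qed.

(** Each constructor of [int] contributes at most 2; [Negz m] is $-(m+1)$, whose weight is below
    that of $m$. *)
Lemma esum_wt : (\esum_(z in [set: int]) (wt z)%:E <= 4%:E)%E.
Proof.
rewrite (esumID (range Posz))//; last by move=> z _; rewrite lee_fin ltW ?wt_gt0.
rewrite (_ : 4%:E = 2%:E + 2%:E)%E; last by rewrite -EFinD; congr EFin; ring.
rewrite !setTI; apply: leeD; apply: le_trans esum_nat_sqr.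
  by rewrite esum_image//; move=> m m' _ _ [].
apply: (@le_trans _ _ (\esum_(z in range Negz) (wt z)%:E)%E).
  apply: le_esum_subset => -[m|m] h /=; last by exists m.
  by exfalso; apply: h; exists m.
rewrite esum_image//; last by move=> m m' _ _ [].
apply: le_esum => m _; rewrite lee_fin /wt lef_pV2 ?posrE ?exprn_gt0 ?ltr_wpDr ?ler0z//.
by rewrite lerXn2r ?nnegrE ?addr_ge0 ?ler0z// lerD2l (ler_nat _ m m.+1).
Qed.

Definition wtn n (l : 'rV[int]_n) : R := \prod_i wt (l ord0 i).

Lemma wtn_gt0 n (l : 'rV[int]_n) : 0 < wtn l.
Proof. by apply: prodr_gt0 => i _; exact: wt_gt0. Qed.

Lemma wtn_le1 n (l : 'rV[int]_n) : wtn l <= 1.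
Proof.
apply: (@le_trans _ _ (\prod_(i < n) 1)); last by rewrite big1.
by apply: ler_prod => i _; rewrite wt_le1 ltW ?wt_gt0.
Qed.

Lemma esum_wtn n : (\esum_(l in [set: 'rV[int]_n]) (wtn l)%:E <= (4 ^+ n)%:E)%E.
Proof.
elim: n => [|n IH].
  rewrite (_ : [set: 'rV[int]_0] = [set 0]).
    by rewrite expr0 esum_set1 lee_fin ?wtn_le1// ltW// wtn_gt0.
  by apply/seteqP; split => // l _; apply/rowP => -[].
pose unc (l : 'rV[int]_n.+1) := (l ord0 ord0, \row_i l ord0 (lift ord0 i)).
apply: (@le_trans _ _ (\esum_(z in [set: int] `*`` (fun=> [set: 'rV[int]_n]))
    (wt z.1 * wtn z.2)%:E)%E).
  apply: (@le_esum_inj _ _ _ _ unc) => //.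
    move=> l l' _ _ [e0 /rowP e]; apply/rowP => i.
    by case: (unliftP ord0 i) => [i' ->|->]//; have := e i'; rewrite !mxE.
  move=> l _; rewrite /unc /= lee_fin /wtn big_ord_recl.
  by under [in leRHS]eq_bigr do rewrite mxE.
rewrite -(esum_esum (a := fun z l => (wt z * wtn l)%:E)); last first.
  by move=> z l _ _; rewrite lee_fin mulr_ge0 ?ltW ?wtn_gt0 ?wt_gt0.
apply: (@le_trans _ _ (\esum_(z in [set: int]) ((4 ^+ n)%:E * (wt z)%:E))%E).
  apply: le_esum => z _; under eq_esum do rewrite EFinM.
  rewrite esumZ ?(ltW (wt_gt0 _))//; last by move=> l; rewrite lee_fin ltW ?wtn_gt0.
  by rewrite muleC lee_wpmul2r// lee_fin ltW ?wt_gt0.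
rewrite esumZ ?exprn_ge0//; last by move=> l; rewrite lee_fin ltW ?wt_gt0.
by rewrite exprSr EFinM lee_wpmul2l ?esum_wt// lee_fin exprn_ge0.
Qed.

End lattice_sums.

(** * Union bounds for weak norms *)

Section weak_norms.
Context {R : realType}.

(** The sets are reindexed by their codes, with the empty set at naturals that code nothing. *)
Lemma countable_subadditive d (X : measurableType d) (mu : {measure set X -> \bar R})
    (I : countType) (B : I -> set X) : (forall i, measurable (B i)) ->
  (mu (\bigcup_i B i) <= \esum_(i in [set: I]) mu (B i))%E.
Proof.
move=> mB; pose D m := \bigcup_(i in [set i | pickle i = m]) B i.
have DE i : D (pickle i) = B i.
  apply/seteqP; split => [x [i' /(pcan_inj pickleK) ->]//|x Bx].
  by exists i.
have D0 m : ~ range (@pickle I) m -> D m = set0.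
  by move=> hm; apply/seteqP; split => // x [i im _]; apply: hm; exists i.
have mD m : measurable (D m).
  have [[i _ <-]|hm] := pselect (range (@pickle I) m); first by rewrite DE.
  by rewrite D0.
have -> : \bigcup_i B i = \bigcup_m D m.
  apply/seteqP; split => [x [i _ Bx]|x [m _ [i _ Bx]]]; last by exists i.
  by exists (pickle i) => //; rewrite DE.
have mDD : measurable (\bigcup_m D m) by exact: bigcup_measurable.
apply: (le_trans (measure_sigma_subadditive mu mD mDD (@subset_refl _ _))).
rewrite nneseries_esumT// (@esum_support _ _ _ (range (@pickle I))) ?setTI//; last first.
  by move=> m _ hm; rewrite D0.
rewrite esum_image; first by under eq_esum do rewrite DE.
by move=> i i' _ _; exact: (pcan_inj pickleK).
Qed.

Variables (n : nat).
Local Notation V := 'rV[R]_n.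
Local Notation mu := (lebesgue_rV R n).

Lemma weak_norm_ge0 p (F : V -> \bar R) : (0 <= weak_norm p F)%E.
Proof.
apply: (@le_trans _ _ (1%:E * (mu [set x | (1%:E < F x)%E]) `^ p^-1)%E).
  by rewrite mule_ge0// poweR_ge0.
by apply: ereal_sup_ubound; exists 1 => //=; exact: ltr01.
Qed.

Lemma weak_norm_distr (p r l : R) (F : V -> \bar R) : 0 < p -> 0 <= r -> 0 < l ->
  (weak_norm p F <= r%:E)%E -> (mu [set x | (l%:E < F x)%E] <= ((r / l) `^ p)%:E)%E.
Proof.
move=> p0 r0 l0 Fr; set m := mu _.
have m0 : (0 <= m)%E by exact: measure_ge0.
have h : (m `^ p^-1 <= (r / l)%:E)%E.
  rewrite EFinM lee_pdivlMr// muleC; apply: le_trans Fr.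
  by apply: ereal_sup_ubound; exists l.
rewrite -(poweRe1 m0) -(mulVf (lt0r_neq0 p0)) poweRrM -poweR_EFin.
apply: gt0_ler_poweR => //; rewrite ?in_itv/= ?leey ?andbT ?poweR_ge0//.
- exact: ltW.
- by rewrite lee_fin divr_ge0// ltW.
Qed.

(* Union bound: [F x > l] forces [g i x > l / (A Z w i)] for some [i]; the surplus factor
   [w i] in the weights makes the measures of these sets summable. *)
Lemma weak_norm_sum (I : countType) (p A Z : R) (N : \bar R) (w : I -> R) (F : V -> \bar R)
    (g : I -> V -> \bar R) :
  1 <= p -> 0 < A -> 1 <= Z -> (0 <= N)%E -> (forall i, 0 < w i <= 1) ->
  (\esum_(i in [set: I]) (w i)%:E <= Z%:E)%E ->
  (forall i (l : R), measurable [set x | (l%:E < g i x)%E]) ->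
  (forall i x, (0 <= g i x)%E) ->
  (forall i, (weak_norm p (g i) <= N)%E) ->
  (forall x, (F x <= A%:E * \esum_(i in [set: I]) ((w i ^+ 2)%:E * g i x))%E) ->
  (weak_norm p F <= (A * Z * Z)%:E * N)%E.
Proof.
move=> p1 A0 Z1 N0 w01 wZ mg g0 gN Fg.
have p0 : 0 < p by exact: lt_le_trans p1.
have Z0 : 0 < Z by exact: lt_le_trans Z1.
have w0 i : 0 < w i by have /andP[] := w01 i.
have w1 i : w i <= 1 by have /andP[] := w01 i.
have AZ0 : 0 < A * Z * Z by rewrite !mulr_gt0.
case: N N0 gN => [r|_ _|//]; last by rewrite gt0_muley ?lte_fin// leey.
rewrite lee_fin => r0 gN.
apply: ge_ereal_sup => _ [l /= l0 <-].
(* Chosen so that $A\sum_i w_i^2\,th_i=(l/Z)\sum_i w_i\le l$. *)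
pose th i := l / (A * Z * w i).
have th0 i : 0 < th i by rewrite divr_gt0// !mulr_gt0.
have sub : [set x | (l%:E < F x)%E] `<=` \bigcup_i [set x | ((th i)%:E < g i x)%E].
  move=> x /= lF; apply: contrapT => hx; move: lF; apply/negP; rewrite -leNgt.
  have {}hx i : (g i x <= (th i)%:E)%E.
    by rewrite leNgt; apply/negP => h; apply: hx; exists i.
  apply: (le_trans (Fg x)).
  apply: (@le_trans _ _ (A%:E * \esum_(i in [set: I]) ((l / (A * Z))%:E * (w i)%:E))%E).
    rewrite lee_wpmul2l ?lee_fin ?(ltW A0)//; apply: le_esum => i _.
    apply: (@le_trans _ _ ((w i ^+ 2)%:E * (th i)%:E)%E).
      by rewrite lee_wpmul2l// lee_fin exprn_ge0// ltW.
    by rewrite -!EFinM lee_fin /th le_eqVlt; apply/orP; left; apply/eqP; field;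
      rewrite !gt_eqF.
  have lAZ0 : 0 <= l / (A * Z) by rewrite divr_ge0 ?mulr_ge0// ltW.
  rewrite esumZ//; last by move=> i; rewrite lee_fin ltW.
  apply: (@le_trans _ _ (A%:E * ((l / (A * Z))%:E * Z%:E))%E).
    by rewrite !lee_wpmul2l// lee_fin// ltW.
  by rewrite -!EFinM lee_fin le_eqVlt; apply/orP; left; apply/eqP; field; rewrite !gt_eqF.
set c := A * Z / l * r.
have c0 : 0 <= c by rewrite mulr_ge0// divr_ge0 ?mulr_ge0// ltW.
have hm : (mu [set x | (l%:E < F x)%E] <= (Z * c `^ p)%:E)%E.
  (* The set on the left may fail to be measurable; the union on the right is measurable. *)
  apply: (le_trans (lebesgue_rV_mono sub)).
  apply: (le_trans (countable_subadditive _ (fun i => mg i (th i)))).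
  apply: (@le_trans _ _ (\esum_(i in [set: I]) ((c `^ p)%:E * (w i)%:E))%E).
    apply: le_esum => i _; apply: (le_trans (weak_norm_distr p0 r0 (th0 i) (gN i))).
    rewrite lee_fin (_ : r / th i = c * w i); last first.
      by rewrite /th /c; field; rewrite !gt_eqF.
    (* As $0<w_i\le1$ and $p\ge1$, $w_i^p\le w_i$, and the measures become summable. *)
    rewrite (powRM _ c0 (ltW (w0 i))) ler_wpM2l ?powR_ge0//.
    by rewrite -[leRHS](powRr1 (ltW (w0 i))) ger_powR// w0 w1.
  rewrite esumZ ?powR_ge0//; last by move=> i; rewrite lee_fin ltW.
  by rewrite mulrC EFinM lee_wpmul2l// lee_fin powR_ge0.
apply: (@le_trans _ _ (l%:E * ((Z * c `^ p)%:E `^ p^-1))%E).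
  rewrite lee_wpmul2l ?lee_fin ?(ltW l0)//; apply: gt0_ler_poweR => //.
  - by rewrite invr_ge0 ltW.
  - by rewrite in_itv/= leey andbT measure_ge0.
  - by rewrite in_itv/= leey andbT lee_fin mulr_ge0 ?powR_ge0// ltW.
rewrite poweR_EFin -!EFinM lee_fin (powRM _ (ltW Z0) (powR_ge0 _ _)).
rewrite -powRrM mulfV ?gt_eqF// powRr1//.
have Zp : Z `^ p^-1 <= Z.
  by rewrite -[leRHS](powRr1 (ltW Z0)) ler_powR// invf_le1.
rewrite (_ : l * _ = Z `^ p^-1 * (A * Z * r)); last by rewrite /c; field; rewrite gt_eqF.
apply: (le_trans (ler_wpM2r _ Zp)); first by rewrite !mulr_ge0// ltW.
by rewrite le_eqVlt; apply/orP; left; apply/eqP; ring.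
Qed.

End weak_norms.

(** * Level functions *)

Section levels.
Context {R : realType} {n : nat}.
Local Notation C := R[i].
Local Notation V := 'rV[R]_n.
Variables (phi0 : R -> R) (phi : {ffun 'I_n -> bool} -> V -> C).
Implicit Types (f : (V -> C) -> C).
Local Notation wnorm := (@wnorm R n).

Definition wcoef f j (a : {ffun 'I_n -> bool} * 'rV[int]_n) : R :=
  Normc.normc (f (wavelet phi a.1 j a.2)).

Lemma wcoef_ge0 f j a : 0 <= wcoef f j a. Proof. exact: normc_ge0. Qed.

Lemma level_ge0 f j x : (0 <= level phi f j x)%E.
Proof.
rewrite /level mule_ge0 ?lee_fin ?powR_ge0//; apply: esum_ge0 => a _.
by rewrite lee_fin mulr_ge0// wcoef_ge0.
Qed.

Definition cell (j : int) (x : V) : 'rV[int]_n := map_mx (fun y => Num.floor (2 ^ j * y)) x.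
(* Cells are closed cubes, so the set of cells containing a point depends on the floors of
   both [2^j x] and [- 2^j x]. *)
Definition opp_cell (j : int) (x : V) : 'rV[int]_n := map_mx (fun y => Num.floor (- 2 ^ j * y)) x.

Lemma unit_cube_dilate j k (x : V) : unit_cube (dilate j k x) <->
  forall i, (k ord0 i <= cell j x ord0 i) && (- (k ord0 i + 1) <= opp_cell j x ord0 i).
Proof.
rewrite /unit_cube /dilate /=; split => h i; have := h i; rewrite !mxE.
  move=> /andP[h1 h2]; rewrite !floor_ge_int_tmp; apply/andP; split; first lra.
  by rewrite intrN intrD mulNr lerN2; lra.
rewrite !floor_ge_int_tmp intrN intrD mulNr lerN2 => /andP[h1 h2].
by apply/andP; split; lra.
Qed.

(** The level function depends on [x] only through [cell] and [opp_cell], which take countably many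
    values. *)
Lemma measurable_level f j (v : V) (l : R) :
  measurable [set x | (l%:E < level phi f j (affine 1 v x))%E].
Proof.
have m0 : measurable [set x | (l%:E < level phi f j x)%E].
  apply: (@measurable_saturated _ _ _ (fun x => (cell j x, opp_cell j x))).
    move=> [k k']; rewrite (_ : _ @^-1` _ = (cell j @^-1` [set k]) `&` (opp_cell j @^-1` [set k'])).
      by apply: measurableI; exact: measurable_floor_row.
    by apply/seteqP; split => x /= [-> ->].
  move=> x y [exy exy'] /=.
  suff -> : level phi f j x = level phi f j y by [].
  congr (_ * _)%E; apply: eq_esum => a _; congr (_ * _)%:E.
  have E : unit_cube (dilate j a.2 x) <-> unit_cube (dilate j a.2 y).
    by split => /unit_cube_dilate h; apply/unit_cube_dilate; rewrite ?exy ?exy'//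
      -?exy -?exy'.
  rewrite !indicE (_ : (dilate j a.2 x \in @unit_cube R n) = (dilate j a.2 y \in @unit_cube R n))//.
  by apply/idP/idP => /set_mem/E/mem_set.
rewrite -[X in measurable X]setTI.
exact: (measurable_affine 1 v measurableT m0).
Qed.

Lemma eq_weak_norm p (F G : V -> \bar R) :
  (forall l : R, lebesgue_rV R n [set x | (l%:E < F x)%E] =
                 lebesgue_rV R n [set x | (l%:E < G x)%E]) ->
  weak_norm p F = weak_norm p G.
Proof.
move=> h; rewrite /weak_norm; congr ereal_sup; apply: eq_imagel => l _.
by rewrite h.
Qed.

Lemma weak_norm_translate p (F : V -> \bar R) (v : V) :
  (forall l : R, measurable [set x | (l%:E < F x)%E]) ->
  weak_norm p (F \o affine 1 v) = weak_norm p F.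
Proof.
move=> mF; apply: eq_weak_norm => l.
by rewrite (lebesgue_rV_affine v (@ltr01 R) (mF l)) expr1n mul1e.
Qed.

Lemma weak_norm_level p f j (v : V) :
  weak_norm p (level phi f j \o affine 1 v) = weak_norm p (level phi f j).
Proof.
apply: weak_norm_translate => l.
rewrite (_ : [set x | _] = [set x | (l%:E < level phi f j (affine 1 0 x))%E]).
  exact: measurable_level.
by apply: eq_set => x; rewrite /affine scale1r addr0.
Qed.

(** Translating [x] by $2^{-j}l$ with [l = a.2 - cell j x] moves it into the cell of [a]. So each
    term on the left occurs in the double sum on the right, at the index [(l, a)], and distinct [a]
    give distinct indices. *)
Lemma level_lower f j x :
  ((wnorm j)%:E * (\esum_(a in @Gamma n) (wcoef f j a * wtn (a.2 - cell j x) ^+ 2)%:E) <=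
   \esum_(l in [set: 'rV[int]_n])
     ((wtn l ^+ 2)%:E * level phi f j (affine 1 ((2 ^ j)^-1 *: map_mx intr l) x)))%E.
Proof.
have w0 : 0 <= wnorm j by rewrite ltW// wnorm_gt0.
have t0 a y : (0 <= (wcoef f j a * \1_(@unit_cube R n) (dilate j a.2 y) : R)%:E)%E.
  by rewrite lee_fin mulr_ge0// wcoef_ge0.
under [leRHS]eq_esum => l _.
  rewrite /level muleCA -(esumZ (Gamma (n := n)) (sqr_ge0 (wtn l))); last first.
    by move=> a; exact: t0.
  over.
rewrite esumZ//; last first.
  by move=> l; apply: esum_ge0 => a _; rewrite mule_ge0 ?lee_fin ?sqr_ge0//; exact: t0.
rewrite lee_wpmul2l// esum_esum; last first.
  by move=> l a _ _; rewrite mule_ge0 ?lee_fin ?sqr_ge0//; exact: t0.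
apply: (@le_esum_inj _ _ _ _ _ (fun a => (a.2 - cell j x, a))).
- by move=> a a' _ _ [].
- by move=> a Ga.
- move=> a _ /=; rewrite -EFinM lee_fin [leRHS]mulrCA ler_wpM2l ?wcoef_ge0//.
  rewrite indicE mem_set ?mulr1// => i.
  rewrite /dilate !mxE mul1r; set y := x ord0 i.
  rewrite mulrDr mulrA mulfV ?gt_eqF ?two_gt0// mul1r intrD intrN.
  have := floor_le_tmp (2 ^ j * y); have := floorD1_gt (2 ^ j * y); rewrite intrD.
  by move=> h1 h2; apply/andP; split; lra.
Qed.

End levels.

(** * Pointwise domination of the levels of the heat flow *)

Section heat_levels.
Context {R : realType} {n : nat}.
Local Notation C := R[i].
Local Notation V := 'rV[R]_n.
Variables (phi0 : R -> R) (phi : {ffun 'I_n -> bool} -> V -> C) (f : (V -> C) -> C).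
Hypothesis mphi0 : meyer_scaling phi0.
Hypothesis mphi : meyer_functions phi0 phi.
Hypothesis wsf : wavelet_series phi f.
Local Notation wnorm := (@wnorm R n).
Local Notation kappa := (@kappa R n phi0).

Definition offset (d : 'I_3) : int := (d : nat)%:Z - 1.

Lemma offsetP (d : int) : d \in [:: -1; 0; 1] -> exists u, d = offset u.
Proof.
by rewrite !inE => /or3P[]/eqP ->;
  [exists (inord 0)|exists (inord 1)|exists (inord 2)]; rewrite /offset inordK.
Qed.

Lemma offset_in d : offset d \in [:: -1; 0; 1].
Proof. by case: d => -[|[|[|//]]] i; rewrite /offset. Qed.

Lemma offset_ratio j d : 2^-1 <= (2 : R) ^ j / 2 ^ (j + offset d) <= 2.
Proof.
have t0 := @two_gt0 R j; rewrite expfzDr// invfM mulrA mulfV ?gt_eqF// mul1r.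
have := offset_in d; rewrite !inE => /or3P[]/eqP ->.
- by rewrite exprN1 invrK; apply/andP; split; lra.
- by rewrite expr0z invr1; apply/andP; split; lra.
- by rewrite expr1z; apply/andP; split; lra.
Qed.

(** Here [y] lies in the cell [k] at scale [j]. Since the scales differ by a factor at most 2,
    rounding and half steps cost a bounded amount: $1+|k'-p|\le6(1+|Y|)$ with $p$ the floor of
    $2^{j'}y$. The fourth power gives the square of [wt]. *)
Lemma wt_compare : exists2 c : R, 0 <= c & forall (j j' k k' : int) (e e' : bool) (y : R),
  2^-1 <= (2 : R) ^ j / 2 ^ j' <= 2 -> 0 <= 2 ^ j * y - k%:~R <= 1 ->
  (1 + `|2 ^ j * ((2 ^ j)^-1 * (k%:~R + e%:R / 2) - (2 ^ j')^-1 * (k'%:~R + e'%:R / 2))|)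
     ^- 4 <= c * wt (k' - Num.floor (2 ^ j' * y)) ^+ 2 :> R.
Proof.
exists (6 ^+ 4); first exact: exprn_ge0.
move=> j j' k k' e e' y /andP[r1 r2] /andP[h1 h2].
have a0 := @two_gt0 R j; have a'0 := @two_gt0 R j'.
set Y := _ * (_ - _).
have YE : Y = (k%:~R + e%:R / 2) - (2 ^ j / 2 ^ j') * (k'%:~R + e'%:R / 2).
  by rewrite /Y; field; rewrite !gt_eqF.
have p1 := floor_le_tmp (2 ^ j' * y); have := floorD1_gt (2 ^ j' * y); rewrite intrD => p2.
set p := Num.floor _ in p1 p2 *; set r := (2 : R) ^ j / 2 ^ j' in r1 r2 YE.
have ay : 2 ^ j * y = r * (2 ^ j' * y) by rewrite /r; field; rewrite gt_eqF.
rewrite ay in h1 h2; move: (2 ^ j' * y) p1 p2 h1 h2 {ay} => X p1 p2 h1 h2.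
have e01 (b : bool) : 0 <= (b%:R : R) <= 1 by case: b; rewrite ?lexx ler01.
have /andP[e1 e2] := e01 e; have /andP[e'1 e'2] := e01 e'.
have b1 : 1 + `|(k' - p)%:~R : R| <= 6 * (1 + `|Y|).
  have Yp : - `|Y| <= Y <= `|Y| by rewrite -ler_norml.
  move: Yp => /andP[Y1 Y2]; rewrite -lerBrDl ler_norml intrD intrN.
  have Y0 := normr_ge0 Y.
  apply/andP; split; nra.
have Y0 : 0 < 1 + `|Y| by rewrite ltr_wpDr.
rewrite /wt intr_norm exprVn -exprM; set z := 1 + `|_%:~R| in b1 *.
have z0 : 0 < z by rewrite ltr_wpDr.
rewrite ler_pdivlMr ?exprn_gt0// ler_pdivrMl ?exprn_gt0// mulrC.
by rewrite -exprMn lerXn2r// ?nnegrE ltW// mulr_gt0.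
Qed.

Lemma esum_bands (j : int) (G : int * ({ffun 'I_n -> bool} * 'rV[int]_n) -> R) :
  (forall b, 0 <= G b) ->
  (forall b, (@Gamma n) b.2 -> b.1 - j \notin [:: -1; 0; 1] -> G b = 0) ->
  (\esum_(b in setT `*` @Gamma n) (G b)%:E <=
   \sum_(d : 'I_3) \esum_(a in @Gamma n) (G (j + offset d, a))%:E)%E.
Proof.
move=> G0 Gz.
have -> : setT `*` @Gamma n = setT `*`` (fun _ : int => @Gamma n).
  by apply/seteqP; split => -[].
have E b : (G b)%:E = (G (b.1, b.2))%:E by case: b.
under eq_esum do rewrite E.
rewrite -(esum_esum (a := fun j' a => (G (j', a))%:E)); last first.
  by move=> j' a _ _; rewrite lee_fin.
apply: (@esum_le_finite _ _ _ _ (fun d => j + offset d)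
  (fun j' => (\esum_(a in Gamma (n := n)) (G (j', a))%:E)%E)).
  by move=> j'; apply: esum_ge0 => a _; rewrite lee_fin.
move=> j' _ hj'; apply: esum1 => a Ga; rewrite Gz//=.
apply/negP => /offsetP[u ju]; apply: (hj' u).
by rewrite -ju addrC subrK.
Qed.

(** Closed cells overlap on their faces: each coordinate of [k] is the floor of $2^jx_i$ or one
    less. A pair of Boolean vectors records the type and, coordinate by coordinate, this choice. *)
Lemma card_cells (g : {ffun 'I_n -> bool} * 'rV[int]_n -> \bar R) j (x : V) (T : \bar R) :
  (forall a, (0 <= g a)%E) -> (0 <= T)%E ->
  (forall a, ~ unit_cube (dilate j a.2 x) -> g a = 0%E) ->
  (forall a, (@Gamma n) a -> unit_cube (dilate j a.2 x) -> (g a <= T)%E) ->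
  (\esum_(a in @Gamma n) g a <=
    (#|{: {ffun 'I_n -> bool} * {ffun 'I_n -> bool}}|%:R : R)%:E * T)%E.
Proof.
move=> g0 T0 gz gT; rewrite esum_mkcond.
pose h (u : {ffun 'I_n -> bool} * {ffun 'I_n -> bool}) :=
  (u.1, \row_i (cell j x ord0 i - (u.2 i)%:R)).
apply: (le_trans (@esum_le_finite _ _ _ _ h _ _ _)).
- by move=> a; case: ifP.
- move=> [e k] _ hk; case: ifP => // _; apply: gz => /unit_cube_dilate xk.
  apply: (hk (e, [ffun i => cell j x ord0 i != k ord0 i])); congr pair.
  apply/rowP => i; rewrite !mxE ffunE; have := xk i; rewrite /= !mxE.
  set y := 2 ^ j * _ => /andP[k1]; rewrite mulNr -/y => k2.
  have k3 : Num.floor y <= k ord0 i + 1.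
    have := floor_le_tmp y; have := floor_le_tmp (- y) => f1 f2.
    rewrite -(ler_int R); have : ((- (k ord0 i + 1))%:~R : R) <= (Num.floor (- y))%:~R.
      by rewrite ler_int.
    by rewrite intrN; lra.
  move: (Num.floor y) k1 k3 => z k1 k3; move: (k ord0 i) k1 k3 {k2 hk} => q k1 k3.
  case: eqVneq => [->|ne]; rewrite ?subr0//; clear -k1 k3 ne.
  by rewrite -[true%:R]/(1 : int); lia.
- set I := (X in #|X|); have -> : ((#|I|%:R : R)%:E * T = \sum_(u in I) T)%E.
    have -> : (#|I|%:R : R) = \sum_(u in I) 1 by rewrite sumr_const.
    rewrite -sumEFin ge0_sume_distrl; last by move=> u _; rewrite lee_fin.
    by apply: eq_bigr => u _; exact: mul1e.
  apply: lee_sum => u _.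
  case: ifP => // /set_mem hu.
  by have [xu|/gz ->//] := pselect (unit_cube (dilate j (h u).2 x)); exact: gT.
Qed.

Lemma heat_level_bound M : exists2 A : R, 0 < A & forall t j x, 0 <= t ->
  (level phi (heat t f) j x <= (A * (1 + t * (2 ^ j) ^+ 2) ^- M)%:E *
    \esum_(i in [set: 'I_3 * 'rV[int]_n]) ((wtn i.2 ^+ 2)%:E *
      level phi f (j + offset i.1)
        (affine 1 ((2 ^ (j + offset i.1))^-1 *: map_mx intr i.2) x)))%E.
Proof.
have [c6 c60 wtc] := wt_compare.
have [K K0 hK] := @kappa_bound R n phi0 mphi0 M.
pose N : R := #|{: {ffun 'I_n -> bool} * {ffun 'I_n -> bool}}|%:R.
have N0 : 0 <= N by exact: ler0n.
(* [N] counts the cells at a point, [K] and [c6] come from the two preceding bounds, and [2 ^+ n]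
   from comparing normalizations at adjacent scales; the added ones secure positivity. *)
exists (N * ((K + 1) * c6 ^+ n) * 2 ^+ n + 1).
  by rewrite ltr_wpDl// mulr_ge0 ?exprn_ge0// mulr_ge0// mulr_ge0 ?exprn_ge0// addr_ge0.
move=> t j x t0; set tau := (1 + t * (2 ^ j) ^+ 2) ^+ M.
have tau0 : 0 < tau.
  by rewrite exprn_gt0// ltr_wpDr// mulr_ge0// exprn_ge0// ltW// two_gt0.
pose c0 := K * c6 ^+ n / tau.
have c00 : 0 <= c0 by exact: divr_ge0 (mulr_ge0 K0 (exprn_ge0 _ c60)) (ltW tau0).
have q0 i := @wnorm_gt0 R n i.
pose G (b : int * ({ffun 'I_n -> bool} * 'rV[int]_n)) : R :=
  if b.1 - j \in [:: -1; 0; 1] then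
    wcoef phi f b.1 b.2 * (c0 * (wnorm j / wnorm b.1) * wtn (b.2.2 - cell b.1 x) ^+ 2)
  else 0.
have G0 b : 0 <= G b.
  rewrite /G; case: ifP => // _.
  rewrite mulr_ge0 ?wcoef_ge0// mulr_ge0 ?sqr_ge0// mulr_ge0//.
  exact: divr_ge0 (ltW (q0 _)) (ltW (q0 _)).
set T := (\esum_(b in setT `*` @Gamma n) (G b)%:E)%E.
have T0 : (0 <= T)%E by apply: esum_ge0 => b _; rewrite lee_fin.
(* The majorant depends on [x] but no longer on [a], so the sum over cells costs only their
   number. *)
have claim1 a : @Gamma n a -> unit_cube (dilate j a.2 x) ->
    ((wcoef phi (heat t f) j a)%:E <= T)%E.
  move=> Ga xa; apply: (le_trans (heat_wavelet_bound mphi0 mphi t j a.2 wsf Ga)).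
  apply: le_esum => b [_ Gb]; rewrite lee_fin /G; case: ifPn => hb; last first.
    by rewrite (kappa_eq0 mphi0 _ _ _ Ga Gb hb) normr0 mulr0.
  rewrite ler_wpM2l ?wcoef_ge0//.
  have [u bu] := offsetP hb; have b1E : b.1 = j + offset u by rewrite -bu addrC subrK.
  have := hK t a.1 j a.2 b.2.1 b.1 b.2.2 Ga hb t0; rewrite -/tau.
  set Y := \prod_i _; set k := `|kappa _ _ _ _ _ _ _|.
  have Y0 : 0 < Y by apply: prodr_gt0 => i _; rewrite exprn_gt0// ltr_wpDr.
  have YV : Y^-1 <= c6 ^+ n * wtn (b.2.2 - cell b.1 x) ^+ 2.
    rewrite /Y -prodfV.
    have -> : c6 ^+ n * wtn (b.2.2 - cell b.1 x) ^+ 2 =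
        \prod_i (c6 * wt ((b.2.2 - cell b.1 x) ord0 i) ^+ 2).
      by rewrite big_split /= prodr_const card_ord -prodrXl.
    apply: ler_prod => i _; apply/andP; split.
      by rewrite invr_ge0 exprn_ge0// addr_ge0.
    rewrite !mxE; apply: wtc; first by rewrite b1E; exact: offset_ratio.
    by have := xa i; rewrite /dilate !mxE.
  have : 0 <= wnorm j / wnorm b.1 by exact: divr_ge0 (ltW (q0 _)) (ltW (q0 _)).
  move: (wnorm j / wnorm b.1) => w w0 hk.
  have {hk} : k <= K * w / tau / Y by rewrite !ler_pdivlMr// mulrAC.
  move/le_trans; apply.
  apply: (@le_trans _ _ (K * w / tau * (c6 ^+ n * wtn (b.2.2 - cell b.1 x) ^+ 2))).
    by apply: ler_wpM2l YV; exact: divr_ge0 (mulr_ge0 K0 w0) (ltW tau0).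
  rewrite le_eqVlt; apply/orP; left; apply/eqP; rewrite /c0.
  by move: (c6 ^+ n) (wtn _ ^+ 2) (tau^-1) => x1 x2 x3; ring.
have claim2 : (level phi (heat t f) j x <= (wnorm j)%:E * (N%:E * T))%E.
  rewrite /level lee_wpmul2l ?lee_fin ?powR_ge0//.
  apply: (@card_cells _ j x) => //.
  - by move=> a; rewrite lee_fin mulr_ge0// wcoef_ge0.
  - by move=> a xa; rewrite indicE memNset// mulr0.
  - move=> a Ga xa; apply: le_trans (claim1 a Ga xa).
    by rewrite lee_fin indicE mem_set// mulr1.
apply: (le_trans claim2).
pose L d := (\esum_(l in [set: 'rV[int]_n])
     ((wtn l ^+ 2)%:E * level phi f (j + offset d)
        (affine 1 ((2 ^ (j + offset d))^-1 *: map_mx intr l) x)))%E.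
have L0 d : (0 <= L d)%E.
  by apply: esum_ge0 => l _; rewrite mule_ge0 ?level_ge0// lee_fin sqr_ge0.
have LE : (\esum_(i in [set: 'I_3 * 'rV[int]_n]) ((wtn i.2 ^+ 2)%:E *
      level phi f (j + offset i.1)
        (affine 1 ((2 ^ (j + offset i.1))^-1 *: map_mx intr i.2) x)) = \sum_d L d)%E.
  rewrite -esum_finType// /L esum_esum; last first.
    by move=> d l _ _; rewrite mule_ge0 ?level_ge0// lee_fin sqr_ge0.
  by congr (esum _ _); apply/seteqP; split.
rewrite LE.
apply: (@le_trans _ _ ((wnorm j)%:E * (N%:E *
    \sum_d \esum_(a in @Gamma n) (G (j + offset d, a))%:E))%E).
  rewrite lee_wpmul2l ?lee_fin ?(ltW (q0 _))// lee_wpmul2l ?lee_fin//.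
  apply: esum_bands => // b _ hb; by rewrite /G (negbTE hb).
rewrite muleA -EFinM !ge0_sume_distrr; last 2 first.
- by move=> d _; exact: L0.
- by move=> d _; apply: esum_ge0 => a _; rewrite lee_fin.
apply: lee_sum => d _; set j' := j + offset d.
have -> : (\esum_(a in @Gamma n) (G (j', a))%:E =
    (c0 * (wnorm j / wnorm j'))%:E *
      \esum_(a in @Gamma n) (wcoef phi f j' a * wtn (a.2 - cell j' x) ^+ 2)%:E)%E.
  rewrite -esumZ; last 2 first.
  - exact: mulr_ge0 c00 (divr_ge0 (ltW (q0 _)) (ltW (q0 _))).
  - by move=> a; rewrite lee_fin mulr_ge0 ?wcoef_ge0 ?sqr_ge0.
  apply: eq_esum => a _; rewrite /G /j' /= addrAC subrr add0r offset_in -EFinM.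
  by congr EFin; rewrite mulrCA.
set E := esum _ _; have E0 : (0 <= E)%E.
  by apply: esum_ge0 => a _; rewrite lee_fin mulr_ge0 ?wcoef_ge0 ?sqr_ge0.
apply: (@le_trans _ _ ((N * c0 * 2 ^+ n)%:E * ((wnorm j')%:E * E))%E).
  rewrite !muleA -!EFinM lee_wpmul2r// lee_fin.
  (* Since [wnorm j ^+ 2] is $2^{nj}$, this amounts to $2^j\le2\cdot2^{j'}$. *)
  have : wnorm j * (wnorm j / wnorm j') <= 2 ^+ n * wnorm j'.
    rewrite mulrA -expr2 ler_pdivrMr// -mulrA -expr2 !wnorm_sqr -exprMn.
    have a0 := @two_gt0 R j; have a'0 := @two_gt0 R j'.
    have /andP[_] := offset_ratio j d; rewrite -/j' ler_pdivrMr// => hr.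
    by apply: lerXn2r hr; rewrite nnegrE; [exact: ltW|exact: ltW (mulr_gt0 _ a'0)].
  have NC : 0 <= N * c0 by rewrite mulr_ge0.
  move/(ler_wpM2l NC); rewrite -/N => h.
  apply: le_trans (le_trans h _); rewrite le_eqVlt; apply/orP; left; apply/eqP; ring.
apply: (@le_trans _ _ ((N * c0 * 2 ^+ n)%:E * L d)%E).
  rewrite lee_wpmul2l ?level_lower// lee_fin; apply: mulr_ge0; first exact: mulr_ge0.
  exact: exprn_ge0.
rewrite lee_wpmul2r// lee_fin /c0.
have X0 : 0 <= c6 ^+ n by exact: exprn_ge0.
have Y0 : 0 <= 2 ^+ n :> R by exact: exprn_ge0.
move: (c6 ^+ n) (2 ^+ n) X0 Y0 => X Y X0 Y0.
have -> : N * (K * X / tau) * Y = N * (K * X) * Y / tau by rewrite !mulrA mulrAC.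
rewrite ler_wpM2r ?invr_ge0 ?(ltW tau0)// -subr_ge0.
have -> : N * ((K + 1) * X) * Y + 1 - N * (K * X) * Y = N * X * Y + 1 by ring.
by rewrite addr_ge0// mulr_ge0// mulr_ge0.
Qed.

End heat_levels.

(** * Flow norms from three neighbouring frequency bands *)

Section flow_bounds.
Context {R : realType} {n : nat}.
Local Notation C := R[i].
Local Notation V := 'rV[R]_n.

(** The sum is at most three times its largest term, an argument valid for every $r\ge0$. *)
Lemma sum_poweR_le (r : R) (x : 'I_3 -> \bar R) : 0 <= r -> (forall d, (0 <= x d)%E) ->
  ((\sum_d x d) `^ r <= (3 `^ r)%:E * \sum_d (x d `^ r))%E.
Proof.
move=> r0 x0; pose d0 := [arg max_(d > (ord0 : 'I_3)) x d]%O.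
have hd0 d : (x d <= x d0)%E.
  by rewrite /d0; case: arg_maxP => // i _ hi; exact: hi.
have h3 : (\sum_d x d <= 3%:E * x d0)%E.
  apply: (@le_trans _ _ (\sum_(d : 'I_3) x d0)%E); first exact: lee_sum.
  have -> : 3%:E = (\sum_(d : 'I_3) 1%:E)%E :> \bar R.
    by rewrite sumEFin sumr_const card_ord.
  rewrite ge0_sume_distrl; last by move=> d _; rewrite lee_fin.
  by apply: lee_sum => d _; rewrite mul1e.
apply: (@le_trans _ _ ((3%:E * x d0) `^ r)%E).
  apply: gt0_ler_poweR => //; rewrite in_itv/= leey andbT ?sume_ge0//.
  by rewrite mule_ge0.
rewrite poweRM// poweR_EFin lee_wpmul2l ?lee_fin ?powR_ge0//.
rewrite (bigD1 d0)//= leeDl// sume_ge0// => d _; exact: poweR_ge0.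
Qed.

Variables (phi0 : R -> R) (phi : {ffun 'I_n -> bool} -> V -> C) (f : (V -> C) -> C).
Variables (p m m' : R).
Hypothesis mphi0 : meyer_scaling phi0.
Hypothesis mphi : meyer_functions phi0 phi.
Hypothesis wsf : wavelet_series phi f.
Hypothesis p1 : 1 <= p.
Hypothesis m'0 : 0 <= m'.

Let s : R := n%:R / p - 1.

(** The contribution of scale [j] to the Besov-Lorentz norm of [f], before the summation in [j]. *)
Definition band (j : int) : \bar R :=
  ((2 `^ (j%:~R * s))%:E * weak_norm p (level phi f j))%E.

Lemma band_ge0 j : (0 <= band j)%E.
Proof. by rewrite mule_ge0 ?weak_norm_ge0// lee_fin powR_ge0. Qed.

Lemma esum_wtn_pair :
  (\esum_(i in [set: 'I_3 * 'rV[int]_n]) (wtn i.2 : R)%:E <= (3 * 4 ^+ n)%:E)%E.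
Proof.
have -> : (\esum_(i in [set: 'I_3 * 'rV[int]_n]) (wtn i.2 : R)%:E =
    \esum_(d in [set: 'I_3]) \esum_(l in [set: 'rV[int]_n]) (wtn l : R)%:E)%E.
  rewrite (esum_esum (a := fun (d : 'I_3) (l : 'rV[int]_n) => (wtn l : R)%:E)).
    by congr (esum _ _); apply/seteqP; split.
  by move=> d l _ _; rewrite lee_fin ltW// wtn_gt0.
rewrite esum_finType; last first.
  by move=> d; apply: esum_ge0 => l _; rewrite lee_fin ltW// wtn_gt0.
apply: (@le_trans _ _ (\sum_(d : 'I_3) (4 ^+ n)%:E)%E).
  by apply: lee_sum => d _; exact: esum_wtn.
by rewrite sumEFin lee_fin sumr_const card_ord mulr_natl.
Qed.

Lemma exp2_shift_le (j : int) d :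
  2 `^ (j%:~R * s) <= 2 `^ `|s| * 2 `^ ((j + offset d)%:~R * s) :> R.
Proof.
rewrite -powRD; last by rewrite pnatr_eq0 implybT.
apply: ler_powR; first by rewrite ler1n.
rewrite intrD mulrDl addrCA lerDl.
have h : `|(offset d)%:~R * s| <= `|s|.
  by rewrite normrM ler_piMl//; have := offset_in d; rewrite !inE => /or3P[]/eqP ->;
    rewrite ?normr0 ?intrN ?normrN ?normr1.
by move: h; rewrite ler_norml => /andP[h _]; lra.
Qed.

Lemma flow_coef_bound : exists2 K : R, 0 < K & forall j jt : int,
  (jt <= j -> (flow_coef phi p m (fun t => heat t f) j jt <=
     K%:E * \sum_(d : 'I_3) band (j + offset d))%E) /\
  (j < jt -> (flow_coef phi p m' (fun t => heat t f) j jt <=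
     K%:E * \sum_(d : 'I_3) band (j + offset d))%E).
Proof.
pose M := (Num.truncn m).+1.
have mM : m <= M%:R by exact: ltW (truncnS_gt m).
have [A A0 hA] := heat_level_bound mphi0 mphi wsf M.
pose Z : R := 3 * 4 ^+ n.
have Z1 : 1 <= Z.
  have : 1 <= 4 ^+ n :> R by rewrite exprn_ege1// ler1n.
  by rewrite /Z; lra.
have Z0 : 0 < Z by exact: lt_le_trans Z1.
pose S (j : int) := (\sum_(d : 'I_3) weak_norm p (level phi f (j + offset d)))%E.
have weak (j jt : int) (B : R) : 0 < B ->
    (forall t, (2 : R) ^ (- 2 * jt) <= t -> (1 + t * (2 ^ j) ^+ 2) ^- M <= B) ->
    (weak_norm p (flow_level phi (fun t => heat t f) j jt) <= (A * B * Z * Z)%:E * S j)%E.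
  move=> B0 hB.
  apply: (@weak_norm_sum R n _ p (A * B) Z (S j) (fun i : 'I_3 * 'rV[int]_n => wtn i.2) _
    (fun i => level phi f (j + offset i.1) \o
        affine 1 ((2 ^ (j + offset i.1))^-1 *: map_mx intr i.2))) => //.
  - exact: mulr_gt0.
  - by apply: sume_ge0 => d _; exact: weak_norm_ge0.
  - by move=> i; rewrite wtn_gt0 wtn_le1.
  - exact: esum_wtn_pair.
  - by move=> i l; exact: measurable_level.
  - by move=> i x; exact: level_ge0.
  - move=> i; rewrite weak_norm_level /S (bigD1 i.1)//= leeDl// sume_ge0// => d _.
    exact: weak_norm_ge0.
  - move=> x; apply: ge_ereal_sup => _ [t /= /andP[t1 _] <-].
    have t0 : 0 <= t by apply: le_trans t1; rewrite ltW// two_gt0.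
    apply: (le_trans (hA t j x t0)); apply: lee_wpmul2r.
      apply: esum_ge0 => i _; rewrite mule_ge0 ?level_ge0// lee_fin sqr_ge0//.
    by rewrite lee_fin ler_wpM2l ?(ltW A0)// hB.
have S0 j : (0 <= S j)%E by apply: sume_ge0 => d _; exact: weak_norm_ge0.
exists (A * Z * Z * 2 `^ `|s|); first by rewrite !mulr_gt0// powR_gt0.
(* Both ranges reduce to finding one bound [B] on the heat factor, valid throughout the time block,
   that cancels the weight. *)
have fin (j jt : int) (mu B : R) : 0 < B -> 2 `^ (2 * (j - jt)%:~R * mu) * B <= 1 ->
    (forall t, (2 : R) ^ (- 2 * jt) <= t -> (1 + t * (2 ^ j) ^+ 2) ^- M <= B) ->
    (flow_coef phi p mu (fun t => heat t f) j jt <=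
     (A * Z * Z * 2 `^ `|s|)%:E * \sum_(d : 'I_3) band (j + offset d))%E.
  move=> B0 hB1 hB; rewrite /flow_coef -EFinM.
  set u := 2 `^ (2 * _ * mu); set v := 2 `^ (_ * (n%:R / p - 1)).
  have u0 : 0 <= u by exact: powR_ge0.
  have v0 : 0 <= v by exact: powR_ge0.
  apply: (@le_trans _ _ ((u * v)%:E * ((A * B * Z * Z)%:E * S j))%E).
    by rewrite lee_wpmul2l ?lee_fin ?mulr_ge0//; exact: weak.
  rewrite muleA -EFinM.
  apply: (@le_trans _ _ ((A * Z * Z)%:E * (v%:E * S j))%E).
    rewrite muleA -EFinM lee_wpmul2r// lee_fin.
    have -> : u * v * (A * B * Z * Z) = (u * B) * (A * Z * Z * v) by ring.
    by rewrite ler_piMl// !mulr_ge0// ltW.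
  rewrite (EFinM (A * Z * Z)) -muleA.
  rewrite lee_wpmul2l ?lee_fin ?mulr_ge0 ?(ltW A0) ?(ltW Z0)//.
  rewrite !ge0_sume_distrr; last 2 first.
  - by move=> d _; exact: band_ge0.
  - by move=> d _; exact: weak_norm_ge0.
  apply: lee_sum => d _; rewrite /band muleA -EFinM lee_wpmul2r ?weak_norm_ge0//.
  by rewrite lee_fin exp2_shift_le.
have pos (t : R) (j jt : int) : (2 : R) ^ (- 2 * jt) <= t -> 0 <= t * (2 ^ j) ^+ 2.
  by move=> h; rewrite mulr_ge0 ?sqr_ge0// (le_trans _ h)// ltW// two_gt0.
move=> j jt; split => jjt.
(* For $j\ge j_t$ and $t\ge4^{-j_t}$, $1+t4^j\ge4^{j-j_t}\ge1$; with $M\ge m$ its power $M$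
   dominates the weight. *)
- apply: (fin j jt m ((2 `^ (2 * (j - jt)%:~R * m))^-1)).
  + by rewrite invr_gt0 powR_gt0.
  + by rewrite mulfV// gt_eqF// powR_gt0.
  + move=> t ht; rewrite lef_pV2 ?posrE ?powR_gt0 ?exprn_gt0//; last first.
      by rewrite ltr_wpDr// (pos _ _ jt).
    set e : R := 2 * (j - jt)%:~R.
    have e0 : 0 <= e by rewrite mulr_ge0// ler0z subr_ge0.
    have b1 : 1 <= 2 `^ e by rewrite -[leLHS](powRr0 2) ler_powR// ler1n.
    apply: (@le_trans _ _ ((2 `^ e) `^ M%:R)).
      by rewrite powRrM ler_powR.
    rewrite powR_mulrn ?powR_ge0// lerXn2r ?nnegrE ?powR_ge0 ?addr_ge0 ?(pos _ _ jt)//.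
    apply: (@le_trans _ _ (t * (2 ^ j) ^+ 2)); last by rewrite lerDr.
    have -> : 2 `^ e = 2 ^ (- 2 * jt) * (2 ^ j) ^+ 2 :> R.
      have -> : e = (2 * (j - jt))%:~R by rewrite intrM.
      rewrite powR_intmul// exprnP exprz_exp -expfzDr//; congr (_ ^ _); ring.
    by rewrite ler_wpM2r ?sqr_ge0.
(* For $j<j_t$ the heat factor is at most 1, and so is the weight, its exponent being
   nonpositive. *)
- apply: (fin j jt m' 1) => //.
  + rewrite mulr1 -[leRHS](powRr0 2) ler_powR ?ler1n//.
    rewrite mulr_le0_ge0// mulr_ge0_le0// lerz0 subr_le0; exact: ltW.
  + move=> t ht; rewrite invf_le1 ?exprn_gt0 ?ltr_wpDr ?(pos _ _ jt)//.
    by rewrite exprn_ege1// lerDl (pos _ _ jt).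
Qed.

Lemma flow_space_finite (r : R) : 1 <= r ->
  (\esum_(j in [set: int]) band j `^ r < +oo)%E ->
  flow_space phi m' m p r%:E (fun t => heat t f).
Proof.
move=> r1 boo; have r0 : 0 <= r by exact: le_trans r1.
have [K K0 hK] := flow_coef_bound.
set E := esum _ _ in boo; have E0 : (0 <= E)%E by apply: esum_ge0 => j _; exact: poweR_ge0.
pose D := ((K `^ r * 3 `^ r)%:E * \sum_(d : 'I_3) E)%E.
have Doo : (D < +oo)%E.
  rewrite lte_mul_pinfty ?lee_fin ?mulr_ge0 ?powR_ge0//.
  by apply: lte_sum_pinfty.
have key (A : set int) (c : int -> \bar R) : (forall j, 0 <= c j)%E ->
    (forall j, A j -> (c j <= K%:E * \sum_(d : 'I_3) band (j + offset d))%E) ->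
    (\esum_(j in A) c j `^ r <= D)%E.
  move=> c0 cK.
  apply: (@le_trans _ _ (\esum_(j in A)
      ((K `^ r * 3 `^ r)%:E * \sum_(d : 'I_3) (band (j + offset d) `^ r))))%E.
    apply: le_esum => j Aj.
    have s0 : (0 <= \sum_(d : 'I_3) band (j + offset d))%E.
      by apply: sume_ge0 => d _; exact: band_ge0.
    apply: (@le_trans _ _ ((K%:E * \sum_(d : 'I_3) band (j + offset d)) `^ r)%E).
      apply: gt0_ler_poweR => //; rewrite ?in_itv/= ?leey ?andbT//; last exact: cK.
      by rewrite mule_ge0// lee_fin ltW.
    rewrite poweRM ?lee_fin ?(ltW K0)// poweR_EFin EFinM -muleA.
    rewrite lee_wpmul2l ?lee_fin ?powR_ge0//; apply: sum_poweR_le => // d.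
    exact: band_ge0.
  rewrite esumZ; last 2 first.
  - by rewrite mulr_ge0 ?powR_ge0.
  - by move=> j; apply: sume_ge0 => d _; exact: poweR_ge0.
  rewrite lee_wpmul2l ?lee_fin ?mulr_ge0 ?powR_ge0//.
  rewrite esum_sum; last by move=> *; exact: poweR_ge0.
  (* Shifting [j] by a fixed offset is injective, so each of the three sums is at most the full sum
     [E]. *)
  apply: lee_sum => d _; apply: (@le_esum_inj _ _ _ _ _ (fun j => j + offset d)) => //.
  by move=> j j' _ _ /addIr.
have c0 (mu : R) jt j : (0 <= flow_coef phi p mu (fun t => heat t f) j jt)%E.
  by rewrite /flow_coef -EFinM mule_ge0 ?weak_norm_ge0// lee_fin mulr_ge0 ?powR_ge0.
rewrite /flow_space; apply: (@le_lt_trans _ _ (D + D)%E); last by rewrite lte_add_pinfty.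
apply: ge_ereal_sup => _ [jt _ <-]; apply: leeD; apply: key => //.
- by move=> j /= jjt; have [h _] := hK j jt; exact: h.
- by move=> j /= jjt; have [_ h] := hK j jt; exact: h.
Qed.

Lemma flow_space_infinite : (ereal_sup (range band) < +oo)%E ->
  flow_space phi m' m p +oo%E (fun t => heat t f).
Proof.
move=> boo; have [K K0 hK] := flow_coef_bound.
set B := ereal_sup _ in boo.
have bB j : (band j <= B)%E by apply: ereal_sup_ubound; exists j.
pose D := (K%:E * \sum_(d : 'I_3) B)%E.
have Doo : (D < +oo)%E.
  rewrite lte_mul_pinfty ?lee_fin ?(ltW K0)//.
  by apply: lte_sum_pinfty.
have hD j : (K%:E * \sum_(d : 'I_3) band (j + offset d) <= D)%E.
  by rewrite lee_wpmul2l ?lee_fin ?(ltW K0)//; apply: lee_sum => d _.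
rewrite /flow_space; apply: (@le_lt_trans _ _ (D + D)%E); last by rewrite lte_add_pinfty.
apply: leeD; apply: ge_ereal_sup => _ [[j jt] /= jjt <-]; apply: le_trans (hD j).
- by have [h _] := hK j jt; exact: h.
- by have [_ h] := hK j jt; exact: h.
Qed.

End flow_bounds.

Theorem theorem1p1 (R : realType) (n : nat) (p m' m : R) (q : \bar R)
  (phi0 : R -> R) (phi : {ffun 'I_n -> bool} -> 'rV[R]_n -> R[i])
  (f : ('rV[R]_n -> R[i]) -> R[i]) :
  (1 <= n)%N ->
  meyer_scaling phi0 ->
  meyer_functions phi0 phi ->
  [/\ 1 < p, (1 <= q < +oo)%E, 0 <= m' & 0 < m] \/
  [/\ 1 < p, q = +oo%E, 0 < m' & 0 < m] ->
  tempered f ->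
  wavelet_series phi f ->
  besov_lorentz phi (n%:R / p - 1) p q f ->
  flow_space phi m' m p q (fun t => heat t f).
Proof.
move=> _ mphi0 mphi pq _ wsf.
case: pq => -[p1 q1 m'0 m0] fB.
- case: q q1 fB => [r| |]; [|by rewrite ltxx andbF|by []].
  rewrite lee_fin => /andP[r1 _] fB; rewrite /besov_lorentz in fB.
  have r0 : r^-1 != 0 by rewrite invr_eq0 gt_eqF// (lt_le_trans ltr01).
  apply: (flow_space_finite m mphi0 mphi wsf (ltW p1) m'0 r1).
  (* Finiteness passes through the outer power $1/r$; the terms inside are the powers of [band]. *)
  move: (lty_poweRy r0 fB); apply: le_lt_trans; apply: le_esum => j _.
  rewrite /band poweRM ?weak_norm_ge0 ?lee_fin ?powR_ge0// poweR_EFin -powRrM.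
  by rewrite mulrAC.
- rewrite q1 in fB *.
  exact: (flow_space_infinite m mphi0 mphi wsf (ltW p1) (ltW m'0) fB).
Qed.
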